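(* Let $R$ be a commutative algebra over a commutative ring $k$. Let $A$ be an $R$-bialgebroid whose unit $R\otimes R\to A$ takes its values in the center of $A$. Then the following assertions are equivalent. (i) $A$ is a Hopf algebroid (via the given left bialgebroid structure and the right bialgebroid structure obtained by interchanging the roles of the unital maps $s$ and $t$). (ii) The natural transformation with components $$\varsigma_Q:Q\circ A\to Q/[Q,R]\bullet A,\qquad q\circ a\mapsto[q_0]\bullet q_1a,$$ for right $A$-comodules $Q$, is an isomorphism. (iii) The canonical comparison functor, from the category of $R$-modules to the category of $A$-Hopf modules, is an equivalence.
   Context: All algebras are associative and unital; $\otimes$ is the tensor product over $k$. For $R$-bimodules $M,N$ (over $k$) put $M\bullet N:=M\otimes N/\{m\cdot r\otimes n-m\otimes r\cdot n\mid r\in R\}$ (the usual $R$-bimodule tensor product, with left action from $M$ and right action from $N$) and $M\circ N:=M\otimes N/\{r\cdot m\cdot r'\otimes n-m\otimes r\cdot n\cdot r'\mid r,r'\in R\}$ (the tensor product over $R\otimes R$); classes are written $m\bullet n$ and $m\circ n$. $M/[M,R]$ is the quotient of $M$ by the $k$-submodule spanned by all $m\cdot r-r\cdot m$, with $[m]$ the class of $m$; its left and right $R$-actions coincide. An $R$-bialgebroid whose unit has central values is: a $k$-algebra $A$ with algebra homomorphisms $s,t$ from $R$ to the center of $A$ (the unit $R\otimes R\to A$ is $r\otimes r'\mapsto s(r)t(r')$), so that $A$ is an $R$-bimodule via $r\cdot a=s(r)a$ and $a\cdot r=t(r)a$; together with an $R$-coring structure on this bimodule, i.e. $R$-bimodule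 maps $\Delta:A\to A\bullet A$, $a\mapsto a_1\bullet a_2$, and $\varepsilon:A\to R$, coassociative and counital; such that $\Delta$ and $\varepsilon$ are algebra homomorphisms ($A\bullet A$ having the factorwise multiplication). $A$ is a Hopf algebroid (with the bialgebroid structures mentioned in (i)) if there is a $k$-module map $S:A\to A$ such that for all $a\in A$, $r\in R$: $S(as(r))=t(r)S(a)$, $S(t(r)a)=S(a)s(r)$, $a_1S(a_2)=s(\varepsilon(a))$, $S(a_1)a_2=t(\varepsilon(a))$. A right $A$-comodule is an $R$-bimodule $Q$ with a coassociative, counital $R$-bimodule map $Q\to Q\bullet A$, $q\mapsto q_0\bullet q_1$. An $A$-Hopf module is a right $A$-module $M$ that is also a right $A$-comodule with respect to the left and right $R$-actions induced on $M$ by $s$ and $t$, respectively, such that $(m\cdot a)_0\bullet(m\cdot a)_1=m_0\cdot a_1\bullet m_1a_2$ for all $m\in M$, $a\in A$; morphisms are $A$-module maps compatible with the coactions. The canonical comparison functor sends an $R$-module $N$ (regarded as an $R$-bimodule with equal left and right actions) to $N\bullet A$ with $A$-action $(n\bullet a)\cdot b=n\bullet ab$ and $A$-coaction $n\bullet a\mapsto(n\bullet a_1)\bullet a_2$, and a morphism $f$ to $f\bullet A$. *)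

(* Defs.v *)
From HB Require Import structures.
From mathcomp Require Import all_boot all_algebra.
From mathcomp Require Import boolp.

Set Implicit Arguments.
Unset Strict Implicit.
Unset Printing Implicit Defensive.

Import GRing.Theory.
Local Open Scope ring_scope.
Local Open Scope quotient_scope.

Section LinearMaps.
Variables (k : pzRingType) (U V W : lmodType k).

Section Make.
Variables (f : U -> V) (f_lin : forall a, {morph f : x y / a *: x + y}).
Definition mklin_fun (_ : forall a, {morph f : x y / a *: x + y}) := f.
HB.instance Definition _ :=
  GRing.isLinear.Build k U V *:%R (mklin_fun f_lin) f_lin.
Definition mklin : {linear U -> V} := mklin_fun f_lin.
End Make.

Lemma linear_ext (f g : {linear U -> V}) : f =1 g -> f = g.
Proof.
case: f g => f [[f1] [f2]] [g [[g1] [g2]]] /= /funext fg; subst g.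
by rewrite (Prop_irrelevance f1 g1) (Prop_irrelevance f2 g2).
Qed.

Lemma linD (f : {linear U -> V}) x y : f (x + y) = f x + f y.
Proof. exact: raddfD. Qed.
Lemma linB (f : {linear U -> V}) x y : f (x - y) = f x - f y.
Proof. exact: raddfB. Qed.
Lemma lin0 (f : {linear U -> V}) : f 0 = 0.
Proof. exact: raddf0. Qed.
Lemma linZ (f : {linear U -> V}) c x : f (c *: x) = c *: f x.
Proof. exact: linearZ. Qed.

Definition bilin (f : U -> V -> W) : Prop :=
  (forall a u u' v, f (a *: u + u') v = a *: f u v + f u' v) /\
  (forall a u v v', f u (a *: v + v') = a *: f u v + f u v').
End LinearMaps.

Section QuotientModule.
Variables (k : comPzRingType) (V : lmodType k) (X : V -> Prop).

Inductive span : V -> Prop :=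
| span_gen v : X v -> span v
| span_0 : span 0
| span_lin c u v : span u -> span v -> span (c *: u + v).

Definition spanp : {pred V} := fun v => `[< span v >].

Lemma spanp_submod : GRing.submod_closed spanp.
Proof.
split; first exact/asboolP/span_0.
by move=> c u v /asboolP su /asboolP sv; apply/asboolP/span_lin.
Qed.
HB.instance Definition _ := GRing.isSubmodClosed.Build k V spanp
  (GRing.submod_closed_semi spanp_submod).

Local Notation Q := (Quotient.quot spanp).

Definition quot_scale : k -> Q -> Q :=
  locked (fun c x => \pi_Q (c *: repr x)).

Lemma quot_scale_pi c v : quot_scale c (\pi_Q v) = \pi_Q (c *: v).
Proof.
rewrite /quot_scale -lock.
apply/eqP; rewrite -Quotient.idealrBE -scalerBr rpredZ//.
by rewrite Quotient.idealrBE reprK.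
Qed.

Lemma quot_scaleA a b x : quot_scale a (quot_scale b x) = quot_scale (a * b) x.
Proof.
by rewrite -[x]reprK [quot_scale b _]quot_scale_pi !quot_scale_pi scalerA.
Qed.
Lemma quot_scale1 : left_id 1 quot_scale.
Proof. by move=> x; rewrite -[x]reprK quot_scale_pi scale1r. Qed.
Lemma quot_scaleDr : right_distributive quot_scale +%R.
Proof.
move=> a x y; rewrite -[x]reprK -[y]reprK.
by rewrite -raddfD !quot_scale_pi scalerDr raddfD.
Qed.
Lemma quot_scaleDl x : {morph quot_scale^~ x : a b / a + b}.
Proof. by move=> a b; rewrite -[x]reprK !quot_scale_pi scalerDl raddfD. Qed.

HB.instance Definition _ := GRing.Zmodule_isLmodule.Build k Q
  quot_scaleA quot_scale1 quot_scaleDr quot_scaleDl.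

Definition quotm : lmodType k := Q.

Lemma qproj_lin a : {morph (\pi_Q : V -> quotm) : x y / a *: x + y}.
Proof.
move=> x y; rewrite raddfD; congr (_ + _); symmetry; exact: quot_scale_pi.
Qed.
Definition qproj : {linear V -> quotm} := mklin qproj_lin.

Lemma qproj_surj (x : quotm) : exists v, x = qproj v.
Proof. by exists (repr (x : Q)); rewrite /qproj /= /mklin_fun reprK. Qed.

Lemma qproj_eq0 v : qproj v = 0 <-> span v.
Proof.
rewrite -(raddf0 qproj) /qproj /= /mklin_fun; split.
  by move/eqP; rewrite -Quotient.idealrBE subr0 => /asboolP.
by move=> sv; apply/eqP; rewrite -Quotient.idealrBE subr0; apply/asboolP.
Qed.

Lemma qproj_gen v : X v -> qproj v = 0.
Proof. by move=> Xv; apply/qproj_eq0/span_gen. Qed.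

Section Lift.
Variables (W : lmodType k) (f : {linear V -> W}).
Hypothesis fX : forall v, X v -> f v = 0.

Lemma span_lift0 v : span v -> f v = 0.
Proof.
elim=> [u /fX //||c u w _ fu _ fw]; first exact: raddf0.
by rewrite linearP fu fw scaler0 addr0.
Qed.

Definition qlift_fun (x : quotm) : W := f (repr (x : Q)).

Lemma qlift_pi v : qlift_fun (qproj v) = f v.
Proof.
apply/eqP; rewrite -subr_eq0 -raddfB; apply/eqP/span_lift0/qproj_eq0.
by rewrite raddfB /qproj /= /mklin_fun reprK subrr.
Qed.

Lemma qlift_lin a : {morph qlift_fun : x y / a *: x + y}.
Proof.
move=> x y; have [u ->] := qproj_surj x; have [v ->] := qproj_surj y.
by rewrite -linearP !qlift_pi linearP.
Qed.
Definition qlift : {linear quotm -> W} := mklin qlift_lin.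

Lemma qliftE v : qlift (qproj v) = f v.
Proof. exact: qlift_pi. Qed.
End Lift.
End QuotientModule.
Arguments quotm : simpl never.
Arguments qproj : simpl never.

(* M ⊗ N: formal finite sums of pairs (m, n), modulo the least congruence    *)
(* making the sum commutative and (m, n) biadditive and k-balanced.           *)
Section TensorProduct.
Variables (k : comPzRingType) (M N : lmodType k).
Implicit Types (s t u : seq (M * N)) (m : M) (n : N).

Inductive tcong : seq (M * N) -> seq (M * N) -> Prop :=
| tc_refl s : tcong s s
| tc_sym s t : tcong s t -> tcong t s
| tc_trans s t u : tcong s t -> tcong t u -> tcong s u
| tc_cat s s' t t' : tcong s s' -> tcong t t' -> tcong (s ++ t) (s' ++ t')
| tc_comm s t : tcong (s ++ t) (t ++ s)
| tc_addl m m' n : tcong [:: (m + m', n)] [:: (m, n); (m', n)]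
| tc_addr m n n' : tcong [:: (m, n + n')] [:: (m, n); (m, n')]
| tc_0l n : tcong [:: (0, n)] [::]
| tc_scale c m n : tcong [:: (c *: m, n)] [:: (m, c *: n)].

Definition tcongb s t := `[< tcong s t >].
Lemma tcongb_refl : reflexive tcongb.
Proof. by move=> s; apply/asboolP/tc_refl. Qed.
Lemma tcongb_sym : symmetric tcongb.
Proof. by move=> s t; apply/asboolP/asboolP => /tc_sym. Qed.
Lemma tcongb_trans : transitive tcongb.
Proof.
by move=> t s u /asboolP st /asboolP tu; apply/asboolP/(tc_trans st tu).
Qed.
Canonical tcong_equiv := EquivRel tcongb tcongb_refl tcongb_sym tcongb_trans.

Definition tens := {eq_quot tcong_equiv}.
HB.instance Definition _ := Choice.on tens.
HB.instance Definition _ := EqQuotient.on tens.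

Lemma tens_eqP s t : \pi_tens s = \pi_tens t <-> tcong s t.
Proof.
split=> [/eqP|st]; first by rewrite eqmodE => /asboolP.
by apply/eqP; rewrite eqmodE; apply/asboolP.
Qed.

Lemma tens_repr s : tcong (repr (\pi_tens s)) s.
Proof. by apply/tens_eqP; rewrite reprK. Qed.

Definition smap (f : M -> M) s := [seq (f x.1, x.2) | x <- s].

Definition tens_add : tens -> tens -> tens :=
  locked (fun x y => \pi_tens (repr x ++ repr y)).
Definition tens_0 : tens := \pi_tens [::].
Definition tens_opp : tens -> tens :=
  locked (fun x => \pi_tens (smap -%R (repr x))).
Definition tens_scale : k -> tens -> tens :=
  locked (fun c x => \pi_tens (smap ( *:%R c) (repr x))).

Lemma tens_add_pi s t : tens_add (\pi_tens s) (\pi_tens t) = \pi_tens (s ++ t).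
Proof.
by rewrite /tens_add -lock; apply/tens_eqP/tc_cat; apply: tens_repr.
Qed.

Lemma smap_cong (f : M -> M) : {morph f : x y / x + y} -> f 0 = 0 ->
  (forall c, {morph f : x / c *: x}) ->
  forall s t, tcong s t -> tcong (smap f s) (smap f t).
Proof.
move=> fD f0 fZ s t; elim=> {s t}; rewrite /smap.
- by move=> s; apply: tc_refl.
- by move=> s t _; apply: tc_sym.
- by move=> s t u _ st _; apply: tc_trans.
- by move=> s s' t t' _ ? _ ?; rewrite !map_cat; apply: tc_cat.
- by move=> s t; rewrite !map_cat; apply: tc_comm.
- by move=> m m' n /=; rewrite fD; apply: tc_addl.
- by move=> m n n' /=; apply: tc_addr.
- by move=> n /=; rewrite f0; apply: tc_0l.
- by move=> c m n /=; rewrite fZ; apply: tc_scale.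
Qed.

Lemma tens_opp_pi s : tens_opp (\pi_tens s) = \pi_tens (smap -%R s).
Proof.
rewrite /tens_opp -lock; apply/tens_eqP/smap_cong/tens_repr.
- exact: opprD.
- exact: oppr0.
by move=> c x; rewrite scalerN.
Qed.

Lemma tens_scale_pi c s :
  tens_scale c (\pi_tens s) = \pi_tens (smap ( *:%R c) s).
Proof.
rewrite /tens_scale -lock; apply/tens_eqP/smap_cong/tens_repr.
- exact: scalerDr.
- exact: scaler0.
by move=> a x; rewrite !scalerA mulrC.
Qed.

Lemma tens_addA : associative tens_add.
Proof.
move=> x y z; rewrite -[x]reprK -[y]reprK -[z]reprK.
by rewrite !tens_add_pi catA.
Qed.
Lemma tens_addC : commutative tens_add.
Proof.
move=> x y; rewrite -[x]reprK -[y]reprK !tens_add_pi.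
by apply/tens_eqP/tc_comm.
Qed.
Lemma tens_add0 : left_id tens_0 tens_add.
Proof. by move=> x; rewrite -[x]reprK tens_add_pi. Qed.


Lemma tens_smapD (f g h : M -> M) : (forall m, h m = f m + g m) ->
  forall s, \pi_tens (smap h s) = \pi_tens (smap f s ++ smap g s).
Proof.
move=> fgh; elim=> [|[m n] s IHs] //=.
rewrite -cat1s -tens_add_pi IHs fgh.
have /tens_eqP -> := tc_addl (f m) (g m) n.
rewrite -[X in _ = \pi_tens X]cat1s -[(g m, n) :: smap g s]cat1s.
rewrite -[[:: (f m, n); (g m, n)]]cat1s -!tens_add_pi -!tens_addA.
congr tens_add; rewrite !tens_addA; congr tens_add; exact: tens_addC.
Qed.

Lemma tens_addN : left_inverse tens_0 tens_opp tens_add.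
Proof.
move=> x; rewrite -[x]reprK tens_opp_pi tens_add_pi.
have {2}-> : repr x = smap id (repr x).
  by rewrite /smap -[LHS]map_id; apply: eq_map => -[].
rewrite -(@tens_smapD -%R id (fun=> 0)); last by move=> m; rewrite addNr.
elim: (repr x) => [|[m n] s IHs] //=.
rewrite -cat1s -tens_add_pi IHs; have /tens_eqP -> := tc_0l n.
exact: tens_add0.
Qed.

HB.instance Definition _ := GRing.isZmodule.Build tens
  tens_addA tens_addC tens_add0 tens_addN.

Lemma tens_scaleA a b x : tens_scale a (tens_scale b x) = tens_scale (a * b) x.
Proof.
rewrite -[x]reprK !tens_scale_pi /smap -map_comp; congr (\pi_tens _).
by apply: eq_map => y /=; rewrite scalerA.
Qed.
Lemma tens_scale1 : left_id 1 tens_scale.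
Proof.
move=> x; rewrite -[x]reprK tens_scale_pi; congr (\pi_tens _).
by rewrite /smap -[RHS]map_id; apply: eq_map => -[? ?] /=; rewrite scale1r.
Qed.
Lemma tens_scaleDr : right_distributive tens_scale +%R.
Proof.
move=> a x y; rewrite -[x]reprK -[y]reprK.
change (tens_scale a (tens_add (\pi_tens (repr x)) (\pi_tens (repr y))) =
  tens_add (tens_scale a (\pi_tens (repr x)))
    (tens_scale a (\pi_tens (repr y)))).
by rewrite tens_add_pi !tens_scale_pi tens_add_pi /smap map_cat.
Qed.
Lemma tens_scaleDl x : {morph tens_scale^~ x : a b / a + b}.
Proof.
move=> a b; change (tens_scale (a + b) x =
  tens_add (tens_scale a x) (tens_scale b x)).
rewrite -[x]reprK !tens_scale_pi tens_add_pi; apply: tens_smapD.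
by move=> m; rewrite scalerDl.
Qed.
HB.instance Definition _ := GRing.Zmodule_isLmodule.Build k tens
  tens_scaleA tens_scale1 tens_scaleDr tens_scaleDl.

Definition tensor : lmodType k := tens.
Definition tpure m n : tensor := \pi_tens [:: (m, n)].

Lemma tpure_bilin : bilin tpure.
Proof.
split=> [a m m' n|a m n n'].
  change (tpure (a *: m + m') n =
    tens_add (tens_scale a (tpure m n)) (tpure m' n)).
  rewrite tens_scale_pi tens_add_pi; exact/tens_eqP/tc_addl.
change (tpure m (a *: n + n') =
  tens_add (tens_scale a (tpure m n)) (tpure m n')).
rewrite tens_scale_pi /=; have /tens_eqP -> := tc_scale a m n.
rewrite tens_add_pi; exact/tens_eqP/tc_addr.
Qed.

Lemma tensor_ind (P : tensor -> Prop) : P 0 ->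
  (forall x y, P x -> P y -> P (x + y)) -> (forall m n, P (tpure m n)) ->
  forall x, P x.
Proof.
move=> P0 PD Pt x; rewrite -[x]reprK; elim: (repr _) => [|[m n] s IHs] //.
rewrite -cat1s -tens_add_pi; exact: PD (Pt m n) IHs.
Qed.

Section Lift.
Variables (W : lmodType k) (f : M -> N -> W) (f_bilin : bilin f).

Lemma bilinDl m m' n : f (m + m') n = f m n + f m' n.
Proof. by have := f_bilin.1 1 m m' n; rewrite !scale1r. Qed.
Lemma bilinDr m n n' : f m (n + n') = f m n + f m n'.
Proof. by have := f_bilin.2 1 m n n'; rewrite !scale1r. Qed.
Lemma bilin0l n : f 0 n = 0.
Proof. by apply: (addrI (f 0 n)); rewrite -bilinDl !addr0. Qed.
Lemma bilin0r m : f m 0 = 0.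
Proof. by apply: (addrI (f m 0)); rewrite -bilinDr !addr0. Qed.
Lemma bilinZl a m n : f (a *: m) n = a *: f m n.
Proof. by have := f_bilin.1 a m 0 n; rewrite bilin0l !addr0. Qed.
Lemma bilinZr a m n : f m (a *: n) = a *: f m n.
Proof. by have := f_bilin.2 a m n 0; rewrite bilin0r !addr0. Qed.

Definition ssum s : W := \sum_(x <- s) f x.1 x.2.
Lemma ssum_cong s t : tcong s t -> ssum s = ssum t.
Proof.
rewrite /ssum; elim=> {s t} //.
- by move=> s t u _ -> _ ->.
- by move=> s s' t t' _ ? _ ?; rewrite !big_cat /=; congr (_ + _).
- by move=> s t; rewrite !big_cat /= addrC.
- by move=> m m' n; rewrite !big_cons big_nil /= bilinDl !addr0.
- by move=> m n n'; rewrite !big_cons big_nil /= bilinDr !addr0.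
- by move=> n; rewrite !big_cons big_nil /= bilin0l addr0.
- by move=> c m n; rewrite !big_cons big_nil /= bilinZl bilinZr.
Qed.

Definition tlift_fun (x : tensor) : W := ssum (repr (x : tens)).
Lemma tlift_pi s : tlift_fun (\pi_tens s) = ssum s.
Proof. exact/ssum_cong/tens_repr. Qed.
Lemma tlift_lin a : {morph tlift_fun : x y / a *: x + y}.
Proof.
move=> x y; change (tlift_fun (tens_add (tens_scale a x) y) =
  a *: tlift_fun x + tlift_fun y).
rewrite -[x]reprK -[y]reprK.
rewrite tens_scale_pi tens_add_pi !tlift_pi /ssum big_cat /=.
rewrite big_map scaler_sumr; congr (_ + _); apply: eq_bigr => z _.
by rewrite bilinZl.
Qed.
Definition tlift : {linear tensor -> W} := mklin tlift_lin.
Lemma tliftE m n : tlift (tpure m n) = f m n.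
Proof. by rewrite [LHS]tlift_pi /ssum big_seq1. Qed.
End Lift.
End TensorProduct.
Arguments tensor : simpl never.
Arguments tpure : simpl never.

Section Restriction.
Variables (k S : pzRingType) (f : {rmorphism k -> S}) (N : lmodType S).
Definition restr_of (_ : {rmorphism k -> S}) : Type := N.
Local Notation restr := (restr_of f).
HB.instance Definition _ := GRing.Zmodule.copy restr N.
Definition restr_scale (c : k) (x : restr) : restr := f c *: (x : N).
Lemma restr_scaleA a b x :
  restr_scale a (restr_scale b x) = restr_scale (a * b) x.
Proof. by rewrite /restr_scale scalerA rmorphM. Qed.
Lemma restr_scale1 : left_id 1 restr_scale.
Proof. by move=> x; rewrite /restr_scale rmorph1 scale1r. Qed.
Lemma restr_scaleDr : right_distributive restr_scale +%R.
Proof. by move=> a x y; apply: (@scalerDr S N). Qed.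
Lemma restr_scaleDl x : {morph restr_scale^~ x : a b / a + b}.
Proof. by move=> a b; rewrite /restr_scale rmorphD; apply: (@scalerDl S N). Qed.
HB.instance Definition _ := GRing.Zmodule_isLmodule.Build k restr
  restr_scaleA restr_scale1 restr_scaleDr restr_scaleDl.
Definition restrict : lmodType k := restr.
Lemma restrictZ (c : k) (x : restrict) : c *: x = f c *: (x : N) :> N.
Proof. by []. Qed.
End Restriction.
Arguments restrict : simpl never.

(* Since algType excludes the zero ring, the algebras R and A over k are      *)
(* rings with a structure map from k; scalars are restricted along it.        *)
Section Bimodules.
Variables (k R : comPzRingType) (kR : {rmorphism k -> R}).

(* The last two axioms make k act in the same way through both actions.       *)
Record bimod := Bimod {
  bm_car :> lmodType k;
  lact : R -> bm_car -> bm_car;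
  ract : bm_car -> R -> bm_car;
  lactDl : forall r r' m, lact (r + r') m = lact r m + lact r' m;
  lactDr : forall r m m', lact r (m + m') = lact r m + lact r m';
  lactA : forall r r' m, lact r (lact r' m) = lact (r * r') m;
  lact1 : forall m, lact 1 m = m;
  ractDl : forall m m' r, ract (m + m') r = ract m r + ract m' r;
  ractDr : forall m r r', ract m (r + r') = ract m r + ract m r';
  ractA : forall m r r', ract (ract m r) r' = ract m (r * r');
  ract1 : forall m, ract m 1 = m;
  lractA : forall r m r', ract (lact r m) r' = lact r (ract m r');
  lact_k : forall c m, lact (kR c) m = c *: m;
  ract_k : forall c m, ract m (kR c) = c *: m
}.

Section BimodTheory.
Variable M : bimod.
Implicit Types (m : M) (r : R) (c : k).

Lemma lactZr r c m : lact r (c *: m) = c *: lact r m.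
Proof. by rewrite -!lact_k !lactA mulrC. Qed.
Lemma lactZl c r m : lact (kR c * r) m = c *: lact r m.
Proof. by rewrite -lactA lact_k. Qed.
Lemma ractZl c m r : ract (c *: m) r = c *: ract m r.
Proof. by rewrite -!ract_k !ractA mulrC. Qed.
Lemma ractZr c m r : ract m (kR c * r) = c *: ract m r.
Proof. by rewrite -ractA ract_k ractZl. Qed.

Lemma lact_lin r a : {morph (@lact M r) : x y / a *: x + y}.
Proof. by move=> x y; rewrite lactDr lactZr. Qed.
Definition lactm r : {linear M -> M} := mklin (lact_lin r).
Lemma ract_lin r a : {morph ((@ract M)^~ r) : x y / a *: x + y}.
Proof. by move=> x y; rewrite ractDl ractZl. Qed.
Definition ractm r : {linear M -> M} := mklin (ract_lin r).
Lemma lactB r x y : lact r (x - y) = lact r x - lact r y :> M.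
Proof. exact: (linB (lactm r)). Qed.
Lemma lact0 r : lact r 0 = 0 :> M.
Proof. exact: (lin0 (lactm r)). Qed.
Lemma ractB x y r : ract (x - y) r = ract x r - ract y r :> M.
Proof. exact: (linB (ractm r)). Qed.
Lemma ract0 r : ract 0 r = 0 :> M.
Proof. exact: (lin0 (ractm r)). Qed.
End BimodTheory.

Record bimap (M N : bimod) := Bimap {
  bimap_lin :> {linear M -> N};
  bimapl : forall r m, bimap_lin (lact r m) = lact r (bimap_lin m);
  bimapr : forall m r, bimap_lin (ract m r) = ract (bimap_lin m) r
}.

Lemma bimap_ext (M N : bimod) (f g : bimap M N) : f =1 g -> f = g.
Proof.
case: f g => f fl fr [g gl gr] /= /linear_ext fg; subst g.
by rewrite (Prop_irrelevance fl gl) (Prop_irrelevance fr gr).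
Qed.

Lemma bimap_id_lin (M : bimod) a : {morph (@id M) : x y / a *: x + y}.
Proof. by []. Qed.
Definition bimap_id (M : bimod) : bimap M M :=
  @Bimap M M (mklin (@bimap_id_lin M)) (fun _ _ => erefl) (fun _ _ => erefl).

Section BimapComp.
Variables (M N P : bimod) (g : bimap N P) (f : bimap M N).
Lemma bimap_comp_lin a : {morph (g \o f) : x y / a *: x + y}.
Proof. by move=> x y /=; rewrite !linearP. Qed.
Lemma bimap_compl r m : (g \o f) (lact r m) = lact r ((g \o f) m).
Proof. by rewrite /= !bimapl. Qed.
Lemma bimap_compr m r : (g \o f) (ract m r) = ract ((g \o f) m) r.
Proof. by rewrite /= !bimapr. Qed.
Definition bimap_comp : bimap M P :=
  @Bimap M P (mklin bimap_comp_lin) bimap_compl bimap_compr.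
End BimapComp.

(* bul M N is M • N and bpure m n is m • n.                                   *)
Section Bullet.
Variables M N : bimod.

Definition bul_rel (x : tensor M N) : Prop :=
  exists m r n, x = tpure (ract m r) n - tpure m (lact r n).
Definition bul_mod : lmodType k := quotm bul_rel.
Definition bpure (m : M) (n : N) : bul_mod := qproj bul_rel (tpure m n).

Lemma bpure_bilin : bilin bpure.
Proof.
have [bl br] := tpure_bilin M N.
by split=> *; rewrite /bpure (bl, br) linearP.
Qed.

Lemma bpure_bal m r n : bpure (ract m r) n = bpure m (lact r n).
Proof.
apply/eqP; rewrite -subr_eq0 -linB; apply/eqP/qproj_gen.
by exists m, r, n.
Qed.

Lemma bpureDl m m' n : bpure (m + m') n = bpure m n + bpure m' n.
Proof. exact: bilinDl bpure_bilin _ _ _. Qed.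
Lemma bpureDr m n n' : bpure m (n + n') = bpure m n + bpure m n'.
Proof. exact: bilinDr bpure_bilin _ _ _. Qed.
Lemma bpureZl c m n : bpure (c *: m) n = c *: bpure m n.
Proof. exact: bilinZl bpure_bilin _ _ _. Qed.
Lemma bpureZr c m n : bpure m (c *: n) = c *: bpure m n.
Proof. exact: bilinZr bpure_bilin _ _ _. Qed.

Lemma bul_ind (P : bul_mod -> Prop) : P 0 ->
  (forall x y, P x -> P y -> P (x + y)) -> (forall m n, P (bpure m n)) ->
  forall x, P x.
Proof.
move=> P0 PD Pb x; have [t ->] := qproj_surj x.
elim/tensor_ind: t => [|t u Pt Pu|m n]; first by rewrite lin0.
  by rewrite linD; apply: PD.
exact: Pb.
Qed.

Lemma bul_ext (W : lmodType k) (f g : {linear bul_mod -> W}) :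
  (forall m n, f (bpure m n) = g (bpure m n)) -> f =1 g.
Proof.
move=> fg; elim/bul_ind=> [|x y fgx fgy|//]; first by rewrite !lin0.
by rewrite (linD f) (linD g) fgx fgy.
Qed.

Section Lift.
Variables (W : lmodType k) (f : M -> N -> W).
Hypotheses (f_bilin : bilin f)
  (f_bal : forall m r n, f (ract m r) n = f m (lact r n)).
Lemma blift_rel v : bul_rel v -> tlift f_bilin v = 0.
Proof.
move=> [m [r [n ->]]].
by rewrite linB !tliftE f_bal subrr.
Qed.
Definition blift : {linear bul_mod -> W} := qlift blift_rel.
Lemma bliftE m n : blift (bpure m n) = f m n.
Proof. by rewrite /blift /bpure qliftE tliftE. Qed.
End Lift.

Definition bul_lf r m n : bul_mod := bpure (lact r m) n.
Lemma bul_lf_bilin r : bilin (bul_lf r).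
Proof.
split=> *; rewrite /bul_lf; last exact: bpure_bilin.2.
by rewrite lactDr lactZr bpure_bilin.1.
Qed.
Lemma bul_lf_bal r m r' n : bul_lf r (ract m r') n = bul_lf r m (lact r' n).
Proof. by rewrite /bul_lf -lractA bpure_bal. Qed.
Definition bul_lact r : bul_mod -> bul_mod :=
  blift (bul_lf_bilin r) (bul_lf_bal r).

Definition bul_rf r m n : bul_mod := bpure m (ract n r).
Lemma bul_rf_bilin r : bilin (bul_rf r).
Proof.
split=> *; rewrite /bul_rf; first exact: bpure_bilin.1.
by rewrite ractDl ractZl bpure_bilin.2.
Qed.
Lemma bul_rf_bal r m r' n : bul_rf r (ract m r') n = bul_rf r m (lact r' n).
Proof. by rewrite /bul_rf lractA bpure_bal. Qed.
Definition bul_ract (x : bul_mod) r : bul_mod :=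
  blift (bul_rf_bilin r) (bul_rf_bal r) x.

Lemma bul_lactE r m n : bul_lact r (bpure m n) = bpure (lact r m) n.
Proof. exact: bliftE. Qed.
Lemma bul_ractE m n r : bul_ract (bpure m n) r = bpure m (ract n r).
Proof. exact: bliftE. Qed.
Lemma bul_lactDr r x y : bul_lact r (x + y) = bul_lact r x + bul_lact r y.
Proof. exact: linD. Qed.
Lemma bul_ractDl x y r : bul_ract (x + y) r = bul_ract x r + bul_ract y r.
Proof. exact: linD. Qed.
Lemma bul_lact0 r : bul_lact r 0 = 0. Proof. exact: lin0. Qed.
Lemma bul_ract0 r : bul_ract 0 r = 0. Proof. exact: lin0. Qed.

Lemma bul_lactDl r r' x : bul_lact (r + r') x = bul_lact r x + bul_lact r' x.
Proof.
elim/bul_ind: x => [|x y Hx Hy|m n].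
- by rewrite !bul_lact0 addr0.
- by rewrite !bul_lactDr Hx Hy addrACA.
- by rewrite !bul_lactE lactDl bpureDl.
Qed.
Lemma bul_lactA r r' x : bul_lact r (bul_lact r' x) = bul_lact (r * r') x.
Proof.
elim/bul_ind: x => [|x y Hx Hy|m n].
- by rewrite !bul_lact0.
- by rewrite !bul_lactDr Hx Hy.
- by rewrite !bul_lactE lactA.
Qed.
Lemma bul_lact1 x : bul_lact 1 x = x.
Proof.
elim/bul_ind: x => [|x y Hx Hy|m n].
- by rewrite !bul_lact0.
- by rewrite !bul_lactDr Hx Hy.
- by rewrite !bul_lactE lact1.
Qed.
Lemma bul_ractDr x r r' : bul_ract x (r + r') = bul_ract x r + bul_ract x r'.
Proof.
elim/bul_ind: x => [|x y Hx Hy|m n].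
- by rewrite !bul_ract0 addr0.
- by rewrite !bul_ractDl Hx Hy addrACA.
- by rewrite !bul_ractE ractDr bpureDr.
Qed.
Lemma bul_ractA x r r' : bul_ract (bul_ract x r) r' = bul_ract x (r * r').
Proof.
elim/bul_ind: x => [|x y Hx Hy|m n].
- by rewrite !bul_ract0.
- by rewrite !bul_ractDl Hx Hy.
- by rewrite !bul_ractE ractA.
Qed.
Lemma bul_ract1 x : bul_ract x 1 = x.
Proof.
elim/bul_ind: x => [|x y Hx Hy|m n].
- by rewrite !bul_ract0.
- by rewrite !bul_ractDl Hx Hy.
- by rewrite !bul_ractE ract1.
Qed.
Lemma bul_lractA r x r' :
  bul_ract (bul_lact r x) r' = bul_lact r (bul_ract x r').
Proof.
elim/bul_ind: x => [|x y Hx Hy|m n].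
- by rewrite !(bul_ract0, bul_lact0).
- by rewrite !(bul_ractDl, bul_lactDr) Hx Hy.
- by rewrite !(bul_ractE, bul_lactE).
Qed.
Lemma bul_lact_k c x : bul_lact (kR c) x = c *: x.
Proof.
elim/bul_ind: x => [|x y Hx Hy|m n].
- by rewrite bul_lact0 scaler0.
- by rewrite bul_lactDr Hx Hy scalerDr.
- by rewrite bul_lactE lact_k bpureZl.
Qed.
Lemma bul_ract_k c x : bul_ract x (kR c) = c *: x.
Proof.
elim/bul_ind: x => [|x y Hx Hy|m n].
- by rewrite bul_ract0 scaler0.
- by rewrite bul_ractDl Hx Hy scalerDr.
- by rewrite bul_ractE ract_k bpureZr.
Qed.

Canonical bul : bimod := Bimod bul_lactDl bul_lactDr bul_lactA bul_lact1
  bul_ractDl bul_ractDr bul_ractA bul_ract1 bul_lractA bul_lact_k bul_ract_k.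

Lemma lact_bpure r m n : lact (b := bul) r (bpure m n) = bpure (lact r m) n.
Proof. exact: bul_lactE. Qed.
Lemma ract_bpure m n r : ract (b := bul) (bpure m n) r = bpure m (ract n r).
Proof. exact: bul_ractE. Qed.
End Bullet.

Section BulletMap.
Variables (M M' N N' : bimod) (f : bimap M M') (g : bimap N N').
Definition bulmap_fun m n : bul M' N' := bpure (f m) (g n).
Lemma bulmap_bilin : bilin bulmap_fun.
Proof.
split=> *; rewrite /bulmap_fun linearP; first exact: (bpure_bilin M' N').1.
exact: (bpure_bilin M' N').2.
Qed.
Lemma bulmap_bal m r n : bulmap_fun (ract m r) n = bulmap_fun m (lact r n).
Proof. by rewrite /bulmap_fun bimapr bimapl bpure_bal. Qed.
Definition bulmap_lin : {linear bul M N -> bul M' N'} :=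
  blift bulmap_bilin bulmap_bal.
Lemma bulmap_linE m n : bulmap_lin (bpure m n) = bpure (f m) (g n).
Proof. exact: bliftE. Qed.
Lemma bulmapl r x : bulmap_lin (lact r x) = lact r (bulmap_lin x).
Proof.
elim/bul_ind: x => [|x y Hx Hy|m n].
- by rewrite [lact r 0]bul_lact0 lin0 [RHS]bul_lact0.
- by rewrite lactDr !linD Hx Hy -lactDr.
- by rewrite lact_bpure !bulmap_linE lact_bpure bimapl.
Qed.
Lemma bulmapr x r : bulmap_lin (ract x r) = ract (bulmap_lin x) r.
Proof.
elim/bul_ind: x => [|x y Hx Hy|m n].
- by rewrite [ract 0 r]bul_ract0 lin0 [RHS]bul_ract0.
- by rewrite ractDl !linD Hx Hy -ractDl.
- by rewrite ract_bpure !bulmap_linE ract_bpure bimapr.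
Qed.
Definition bulmap : bimap (bul M N) (bul M' N') := Bimap bulmapl bulmapr.
Lemma bulmapE m n : bulmap (bpure m n) = bpure (f m) (g n).
Proof. exact: bulmap_linE. Qed.
End BulletMap.

(* m • (n • p) |-> (m • n) • p *)
Section Associator.
Variables M N P : bimod.
Local Notation T := (bul (bul M N) P).
Definition assoc2_fun (m : M) (n : N) (p : P) : T := bpure (bpure m n) p.
Lemma assoc2_bilin m : bilin (assoc2_fun m).
Proof.
split=> *; rewrite /assoc2_fun; last exact: (bpure_bilin (bul M N) P).2.
by rewrite (bpure_bilin M N).2 (bpure_bilin (bul M N) P).1.
Qed.
Lemma assoc2_bal m n r p :
  assoc2_fun m (ract n r) p = assoc2_fun m n (lact r p).
Proof. by rewrite /assoc2_fun -bpure_bal ract_bpure. Qed.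
Definition assoc1_fun (m : M) (x : bul N P) : T :=
  blift (assoc2_bilin m) (assoc2_bal m) x.
Lemma assoc1_pure m n p : assoc1_fun m (bpure n p) = bpure (bpure m n) p.
Proof. exact: bliftE. Qed.
Lemma assoc1_0 m : assoc1_fun m 0 = 0.
Proof. exact: lin0. Qed.
Lemma assoc1_D m x y : assoc1_fun m (x + y) = assoc1_fun m x + assoc1_fun m y.
Proof. exact: linD. Qed.
Lemma assoc1_bilin : bilin assoc1_fun.
Proof.
split=> [a m m' x|a m x y]; last exact: linearP.
elim/bul_ind: x => [|x y Hx Hy|n p].
- by rewrite !assoc1_0 scaler0 addr0.
- by rewrite !assoc1_D Hx Hy scalerDr addrACA.
- rewrite !assoc1_pure (bpure_bilin M N).1.
  by rewrite (bpure_bilin (bul M N) P).1.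
Qed.
Lemma assoc1_bal m r x : assoc1_fun (ract m r) x = assoc1_fun m (lact r x).
Proof.
elim/bul_ind: x => [|x y Hx Hy|n p].
- by rewrite [lact r 0]bul_lact0 !assoc1_0.
- by rewrite lactDr !assoc1_D Hx Hy.
- by rewrite lact_bpure !assoc1_pure bpure_bal.
Qed.
Definition bulassoc : {linear bul M (bul N P) -> T} :=
  blift assoc1_bilin assoc1_bal.
Lemma bulassocE m n p :
  bulassoc (bpure m (bpure n p : bul N P)) = bpure (bpure m n : bul M N) p.
Proof. by rewrite [LHS]bliftE assoc1_pure. Qed.
End Associator.

(* circ M N is M ∘ N and cpure m n is m ∘ n.                                  *)
Section Circ.
Variables M N : bimod.

Definition circ_rel (x : tensor M N) : Prop := exists r m r' n,
  x = tpure (ract (lact r m) r') n - tpure m (ract (lact r n) r').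
Definition circ : lmodType k := quotm circ_rel.
Definition cpure (m : M) (n : N) : circ := qproj circ_rel (tpure m n).

Lemma cpure_bilin : bilin cpure.
Proof.
have [bl br] := tpure_bilin M N.
by split=> *; rewrite /cpure (bl, br) linearP.
Qed.

Lemma cpure_bal r m r' n :
  cpure (ract (lact r m) r') n = cpure m (ract (lact r n) r').
Proof.
apply/eqP; rewrite -subr_eq0 -linB; apply/eqP/qproj_gen.
by exists r, m, r', n.
Qed.

Lemma circ_ind (P : circ -> Prop) : P 0 ->
  (forall x y, P x -> P y -> P (x + y)) -> (forall m n, P (cpure m n)) ->
  forall x, P x.
Proof.
move=> P0 PD Pb x; have [t ->] := qproj_surj x.
elim/tensor_ind: t => [|t u Pt Pu|m n]; first by rewrite lin0.
  by rewrite linD; apply: PD.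
exact: Pb.
Qed.

Lemma circ_ext (W : lmodType k) (f g : {linear circ -> W}) :
  (forall m n, f (cpure m n) = g (cpure m n)) -> f =1 g.
Proof.
move=> fg; elim/circ_ind=> [|x y fgx fgy|//]; first by rewrite !lin0.
by rewrite (linD f) (linD g) fgx fgy.
Qed.

Section Lift.
Variables (W : lmodType k) (f : M -> N -> W).
Hypotheses (f_bilin : bilin f) (f_bal : forall r m r' n,
  f (ract (lact r m) r') n = f m (ract (lact r n) r')).
Lemma clift_rel v : circ_rel v -> tlift f_bilin v = 0.
Proof.
by move=> [r [m [r' [n ->]]]]; rewrite linB !tliftE f_bal subrr.
Qed.
Definition clift : {linear circ -> W} := qlift clift_rel.
Lemma cliftE m n : clift (cpure m n) = f m n.
Proof. by rewrite /clift /cpure qliftE tliftE. Qed.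
End Lift.
End Circ.

Section CircMap.
Variables (M M' N N' : bimod) (f : bimap M M') (g : bimap N N').
Definition circmap_fun m n : circ M' N' := cpure (f m) (g n).
Lemma circmap_bilin : bilin circmap_fun.
Proof.
split=> *; rewrite /circmap_fun linearP; first exact: (cpure_bilin M' N').1.
exact: (cpure_bilin M' N').2.
Qed.
Lemma circmap_bal r m r' n :
  circmap_fun (ract (lact r m) r') n = circmap_fun m (ract (lact r n) r').
Proof. by rewrite /circmap_fun !bimapr !bimapl cpure_bal. Qed.
Definition circmap : {linear circ M N -> circ M' N'} :=
  clift circmap_bilin circmap_bal.
Lemma circmapE m n : circmap (cpure m n) = cpure (f m) (g n).
Proof. exact: cliftE. Qed.
End CircMap.

(* cq M is M / [M, R].                                                        *)
Section CommutatorQuotient.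
Variable M : bimod.
Definition comm_rel (x : M) : Prop := exists m r, x = ract m r - lact r m.
Definition cq_mod : lmodType k := quotm comm_rel.
Definition cq_class : {linear M -> cq_mod} := qproj comm_rel.

Lemma cq_surj (x : cq_mod) : exists m, x = cq_class m.
Proof. exact: qproj_surj. Qed.
Lemma cq_lr r m : cq_class (lact r m) = cq_class (ract m r).
Proof.
apply/eqP; rewrite eq_sym -subr_eq0 -linB; apply/eqP/qproj_gen.
by exists m, r.
Qed.

Lemma cq_l_lin r a :
  {morph (fun m => cq_class (lact r m)) : x y / a *: x + y}.
Proof. by move=> x y; rewrite lact_lin linearP. Qed.
Lemma cq_l_rel r v : comm_rel v -> mklin (cq_l_lin r) v = 0.
Proof.
move=> [m [r' ->]]; rewrite -[LHS]/(cq_class _) lactB (linB cq_class).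
by rewrite -lractA -cq_lr !lactA mulrC subrr.
Qed.
Lemma cq_r_lin r a :
  {morph (fun m => cq_class (ract m r)) : x y / a *: x + y}.
Proof. by move=> x y; rewrite ract_lin linearP. Qed.
Lemma cq_r_rel r v : comm_rel v -> mklin (cq_r_lin r) v = 0.
Proof.
by move=> Rv; rewrite -(cq_l_rel r Rv) -[LHS]/(cq_class _) -cq_lr.
Qed.
Definition cq_lact r : cq_mod -> cq_mod := qlift (@cq_l_rel r).
Definition cq_ract (x : cq_mod) r : cq_mod := qlift (@cq_r_rel r) x.

Lemma cq_lactE r m : cq_lact r (cq_class m) = cq_class (lact r m).
Proof. exact: qliftE. Qed.
Lemma cq_ractE m r : cq_ract (cq_class m) r = cq_class (ract m r).
Proof. exact: qliftE. Qed.
Lemma cq_act r x : cq_lact r x = cq_ract x r.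
Proof. by have [m ->] := cq_surj x; rewrite cq_lactE cq_ractE cq_lr. Qed.

Lemma cq_lactDl r r' x : cq_lact (r + r') x = cq_lact r x + cq_lact r' x.
Proof. by have [m ->] := cq_surj x; rewrite !cq_lactE lactDl linD. Qed.
Lemma cq_lactDr r x y : cq_lact r (x + y) = cq_lact r x + cq_lact r y.
Proof. exact: linD. Qed.
Lemma cq_lactA r r' x : cq_lact r (cq_lact r' x) = cq_lact (r * r') x.
Proof. by have [m ->] := cq_surj x; rewrite !cq_lactE lactA. Qed.
Lemma cq_lact1 x : cq_lact 1 x = x.
Proof. by have [m ->] := cq_surj x; rewrite cq_lactE lact1. Qed.
Lemma cq_ractDl x y r : cq_ract (x + y) r = cq_ract x r + cq_ract y r.
Proof. exact: linD. Qed.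
Lemma cq_ractDr x r r' : cq_ract x (r + r') = cq_ract x r + cq_ract x r'.
Proof. by have [m ->] := cq_surj x; rewrite !cq_ractE ractDr linD. Qed.
Lemma cq_ractA x r r' : cq_ract (cq_ract x r) r' = cq_ract x (r * r').
Proof. by have [m ->] := cq_surj x; rewrite !cq_ractE ractA. Qed.
Lemma cq_ract1 x : cq_ract x 1 = x.
Proof. by have [m ->] := cq_surj x; rewrite cq_ractE ract1. Qed.
Lemma cq_lractA r x r' : cq_ract (cq_lact r x) r' = cq_lact r (cq_ract x r').
Proof.
have [m ->] := cq_surj x.
by rewrite cq_lactE !cq_ractE cq_lactE lractA.
Qed.
Lemma cq_lact_k c x : cq_lact (kR c) x = c *: x.
Proof. by have [m ->] := cq_surj x; rewrite cq_lactE lact_k linearZ. Qed.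
Lemma cq_ract_k c x : cq_ract x (kR c) = c *: x.
Proof. by have [m ->] := cq_surj x; rewrite cq_ractE ract_k linearZ. Qed.

Canonical cq : bimod := Bimod cq_lactDl cq_lactDr cq_lactA cq_lact1
  cq_ractDl cq_ractDr cq_ractA cq_ract1 cq_lractA cq_lact_k cq_ract_k.

Definition cq_proj : bimap M cq := @Bimap M cq cq_class
  (fun r m => esym (cq_lactE r m)) (fun m r => esym (cq_ractE m r)).
End CommutatorQuotient.

Section CommutatorQuotientMap.
Variables (M N : bimod) (f : bimap M N).
Lemma cqmap_rel v :
  comm_rel v -> (bimap_comp (cq_proj N) f : {linear _ -> _}) v = 0.
Proof.
move=> [m [r ->]]; rewrite -[LHS]/(cq_class N (f _)) linB bimapl bimapr.
by rewrite (linB (cq_class N)) cq_lr subrr.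
Qed.
Definition cqmap_lin : {linear cq M -> cq N} := qlift cqmap_rel.
Lemma cqmap_linE m : cqmap_lin (cq_class M m) = cq_class N (f m).
Proof. exact: qliftE. Qed.
Lemma cqmapl r x : cqmap_lin (lact r x) = lact r (cqmap_lin x).
Proof.
have [m ->] := cq_surj x.
by rewrite /= cq_lactE !cqmap_linE cq_lactE bimapl.
Qed.
Lemma cqmapr x r : cqmap_lin (ract x r) = ract (cqmap_lin x) r.
Proof.
have [m ->] := cq_surj x.
by rewrite /= cq_ractE !cqmap_linE cq_ractE bimapr.
Qed.
Definition cqmap : bimap (cq M) (cq N) := Bimap cqmapl cqmapr.
Lemma cqmapE m : cqmap (cq_class M m) = cq_class N (f m).
Proof. exact: cqmap_linE. Qed.
End CommutatorQuotientMap.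

Section SymmetricBimodule.
Variable N : lmodType R.
Local Notation V := (restrict kR N).
Definition sym_lact (r : R) (n : V) : V := r *: (n : N).
Definition sym_ract (n : V) (r : R) : V := r *: (n : N).
Lemma sym_lactDl r r' n : sym_lact (r + r') n = sym_lact r n + sym_lact r' n.
Proof. exact: (@scalerDl R N). Qed.
Lemma sym_lactDr r n n' : sym_lact r (n + n') = sym_lact r n + sym_lact r n'.
Proof. exact: (@scalerDr R N). Qed.
Lemma sym_lactA r r' n : sym_lact r (sym_lact r' n) = sym_lact (r * r') n.
Proof. exact: (@scalerA R N). Qed.
Lemma sym_lact1 n : sym_lact 1 n = n.
Proof. exact: (@scale1r R N). Qed.
Lemma sym_ractDl n n' r : sym_ract (n + n') r = sym_ract n r + sym_ract n' r.
Proof. exact: (@scalerDr R N). Qed.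
Lemma sym_ractDr n r r' : sym_ract n (r + r') = sym_ract n r + sym_ract n r'.
Proof. exact: (@scalerDl R N). Qed.
Lemma sym_ractA n r r' : sym_ract (sym_ract n r) r' = sym_ract n (r * r').
Proof. by rewrite /sym_ract (@scalerA R N) mulrC. Qed.
Lemma sym_ract1 n : sym_ract n 1 = n.
Proof. exact: (@scale1r R N). Qed.
Lemma sym_lractA r n r' : sym_ract (sym_lact r n) r' = sym_lact r (sym_ract n r').
Proof. by rewrite /sym_ract /sym_lact !(@scalerA R N) mulrC. Qed.
Lemma sym_lact_k c n : sym_lact (kR c) n = c *: n.
Proof. by []. Qed.
Lemma sym_ract_k c n : sym_ract n (kR c) = c *: n.
Proof. by []. Qed.
Definition symbim : bimod := Bimod sym_lactDl sym_lactDr sym_lactA sym_lact1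
  sym_ractDl sym_ractDr sym_ractA sym_ract1 sym_lractA sym_lact_k sym_ract_k.
End SymmetricBimodule.

Section SymmetricBimoduleMap.
Variables (N N' : lmodType R) (f : {linear N -> N'}).
Lemma symmap_lin a :
  {morph (f : symbim N -> symbim N') : x y / a *: x + y}.
Proof. by move=> x y; exact: (linearP f). Qed.
Definition symmap : bimap (symbim N) (symbim N') :=
  @Bimap (symbim N) (symbim N') (mklin symmap_lin)
    (linZ f) (fun n r => linZ f r n).
End SymmetricBimoduleMap.

Definition Rbim : bimod := symbim R^o.

End Bimodules.
Arguments bul_mod : simpl never.
Arguments bpure : simpl never.
Arguments circ : simpl never.
Arguments cpure : simpl never.
Arguments cq_mod : simpl never.
Arguments cq_class : simpl never.

Section Bialgebroids.
Variables (k R : comPzRingType) (kR : {rmorphism k -> R}).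
Local Notation bimod := (bimod kR).

Record ralgebra := RAlgebra {
  ra :> pzRingType;
  ra_k : {rmorphism k -> ra};
  src : {rmorphism R -> ra};
  tgt : {rmorphism R -> ra};
  ra_kC : forall c a, ra_k c * a = a * ra_k c;
  src_k : forall c, src (kR c) = ra_k c;
  tgt_k : forall c, tgt (kR c) = ra_k c;
  srcC : forall r a, src r * a = a * src r;
  tgtC : forall r a, tgt r * a = a * tgt r
}.

Section RegularBimodule.
Variable A : ralgebra.
Local Notation V := (restrict (ra_k A) A^o).
Definition reg_lact (r : R) (a : V) : V := src A r * (a : A).
Definition reg_ract (a : V) (r : R) : V := tgt A r * (a : A).
Lemma reg_lactDl r r' a : reg_lact (r + r') a = reg_lact r a + reg_lact r' a.
Proof. by rewrite /reg_lact rmorphD; exact: (@mulrDl A). Qed.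
Lemma reg_lactDr r a b : reg_lact r (a + b) = reg_lact r a + reg_lact r b.
Proof. exact: (@mulrDr A). Qed.
Lemma reg_lactA r r' a : reg_lact r (reg_lact r' a) = reg_lact (r * r') a.
Proof. by rewrite /reg_lact rmorphM mulrA. Qed.
Lemma reg_lact1 a : reg_lact 1 a = a.
Proof. by rewrite /reg_lact rmorph1 mul1r. Qed.
Lemma reg_ractDl a b r : reg_ract (a + b) r = reg_ract a r + reg_ract b r.
Proof. exact: (@mulrDr A). Qed.
Lemma reg_ractDr a r r' : reg_ract a (r + r') = reg_ract a r + reg_ract a r'.
Proof. by rewrite /reg_ract rmorphD; exact: (@mulrDl A). Qed.
Lemma reg_ractA a r r' : reg_ract (reg_ract a r) r' = reg_ract a (r * r').
Proof. by rewrite /reg_ract [r * r']mulrC rmorphM mulrA. Qed.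
Lemma reg_ract1 a : reg_ract a 1 = a.
Proof. by rewrite /reg_ract rmorph1 mul1r. Qed.
Lemma reg_lractA r a r' :
  reg_ract (reg_lact r a) r' = reg_lact r (reg_ract a r').
Proof. by rewrite /reg_ract /reg_lact !mulrA srcC. Qed.
Lemma reg_lact_k c a : reg_lact (kR c) a = c *: a.
Proof. by rewrite /reg_lact src_k. Qed.
Lemma reg_ract_k c a : reg_ract a (kR c) = c *: a.
Proof. by rewrite /reg_ract tgt_k. Qed.
Definition ra_bim : bimod := Bimod reg_lactDl reg_lactDr reg_lactA reg_lact1
  reg_ractDl reg_ractDr reg_ractA reg_ract1 reg_lractA reg_lact_k reg_ract_k.

Section RightMul.
Variable a : A.
Definition rmul_fun (b : ra_bim) : ra_bim := (b : A) * a.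
Lemma rmul_lin c : {morph rmul_fun : x y / c *: x + y}.
Proof.
move=> x y; rewrite /rmul_fun.
change ((ra_k A c * (x : A) + (y : A)) * a =
  ra_k A c * ((x : A) * a) + (y : A) * a).
by rewrite mulrDl mulrA.
Qed.
Lemma rmull r b : rmul_fun (lact r b) = lact r (rmul_fun b).
Proof. by rewrite /rmul_fun /= /reg_lact mulrA. Qed.
Lemma rmulr b r : rmul_fun (ract b r) = ract (rmul_fun b) r.
Proof. by rewrite /rmul_fun /= /reg_ract mulrA. Qed.
Definition rmulm : bimap ra_bim ra_bim :=
  @Bimap _ _ kR ra_bim ra_bim (mklin rmul_lin) rmull rmulr.

(* (p • b) a := p • (b a) *)
Definition bul_mulr (P : bimod) : bimap (bul P ra_bim) (bul P ra_bim) :=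
  bulmap (bimap_id P) rmulm.
Lemma bul_mulrE (P : bimod) (p : P) (b : ra_bim) :
  bul_mulr P (bpure p b) = bpure p ((b : A) * a : ra_bim).
Proof. exact: bulmapE. Qed.
End RightMul.

(* The bimodule structure is the one induced along src and tgt; it is carried *)
(* along, rather than recomputed, to have M • A at hand.                      *)
Record rmodule := RModule {
  rm_bim :> bimod;
  rm_act : rm_bim -> A -> rm_bim;
  rm_actDl : forall m m' a, rm_act (m + m') a = rm_act m a + rm_act m' a;
  rm_actDr : forall m a b, rm_act m (a + b) = rm_act m a + rm_act m b;
  rm_actA : forall m a b, rm_act (rm_act m a) b = rm_act m (a * b);
  rm_act1 : forall m, rm_act m 1 = m;
  rm_act_k : forall m c, rm_act m (ra_k A c) = c *: m;
  rm_act_src : forall m r, rm_act m (src A r) = lact r m;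
  rm_act_tgt : forall m r, rm_act m (tgt A r) = ract m r
}.

Section RegularModule.
Definition reg_act (m : ra_bim) (a : A) : ra_bim := (m : A) * a.
Lemma reg_actDl m m' a : reg_act (m + m') a = reg_act m a + reg_act m' a.
Proof. exact: (@mulrDl A). Qed.
Lemma reg_actDr m a b : reg_act m (a + b) = reg_act m a + reg_act m b.
Proof. exact: (@mulrDr A). Qed.
Lemma reg_actA m a b : reg_act (reg_act m a) b = reg_act m (a * b).
Proof. by rewrite /reg_act mulrA. Qed.
Lemma reg_act1 m : reg_act m 1 = m.
Proof. exact: (@mulr1 A). Qed.
Lemma reg_act_k m c : reg_act m (ra_k A c) = c *: m.
Proof. by rewrite /reg_act -ra_kC. Qed.
Lemma reg_act_src m r : reg_act m (src A r) = lact r m.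
Proof. by rewrite /reg_act -srcC. Qed.
Lemma reg_act_tgt m r : reg_act m (tgt A r) = ract m r.
Proof. by rewrite /reg_act -tgtC. Qed.
Definition ra_rmod : rmodule := RModule reg_actDl reg_actDr reg_actA reg_act1
  reg_act_k reg_act_src reg_act_tgt.
End RegularModule.

(* The factorwise action (m • a) (b • c) := m b • a c of A • A on M • A.      *)
Section FactorwiseAction.
Variable M : rmodule.
Local Notation T := (bul M ra_bim).

Lemma rm_actZl c (m : M) a : rm_act (c *: m) a = c *: rm_act m a.
Proof. by rewrite -!rm_act_k !rm_actA ra_kC. Qed.

Definition fact2_fun (m : M) (a b c : ra_bim) : T :=
  bpure (rm_act m (b : A)) ((a : A) * (c : A) : ra_bim).
Lemma fact2_bilin m a : bilin (fact2_fun m a).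
Proof.
split=> [c b b' d|c b d d']; rewrite /fact2_fun.
  rewrite rm_actDr (_ : rm_act m (c *: b : ra_bim) = c *: rm_act m (b : A)).
    exact: (bpure_bilin M ra_bim).1.
  rewrite -rm_act_k rm_actA -ra_kC; congr (rm_act _ _).
rewrite -(bpure_bilin M ra_bim).2; apply: congr1.
change ((a : A) * (ra_k A c * (d : A) + (d' : A)) =
  ra_k A c * ((a : A) * (d : A)) + (a : A) * (d' : A)).
by rewrite mulrDr !mulrA ra_kC.
Qed.
Lemma fact2_bal m a b r c :
  fact2_fun m a (ract b r) c = fact2_fun m a b (lact r c).
Proof.
rewrite /fact2_fun /= /reg_ract /reg_lact tgtC -rm_actA rm_act_tgt bpure_bal.
by apply: congr1; rewrite /= /reg_lact !mulrA srcC.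
Qed.
Definition fact1_fun (y : bul ra_bim ra_bim) (m : M) (a : ra_bim) : T :=
  blift (fact2_bilin m a) (fact2_bal m a) y.
Lemma fact1_pure m a b c : fact1_fun (bpure b c) m a =
  bpure (rm_act m (b : A)) ((a : A) * (c : A) : ra_bim).
Proof. exact: bliftE. Qed.
Lemma fact1_0 m a : fact1_fun 0 m a = 0.
Proof. exact: lin0. Qed.
Lemma fact1_D x y m a :
  fact1_fun (x + y) m a = fact1_fun x m a + fact1_fun y m a.
Proof. exact: linD. Qed.
Lemma fact1_bilin y : bilin (fact1_fun y).
Proof.
split=> [c m m' a|c m a a'].
  elim/bul_ind: y => [|x y Hx Hy|b d].
  - by rewrite !fact1_0 scaler0 addr0.
  - by rewrite !fact1_D Hx Hy scalerDr addrACA.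
  - by rewrite !fact1_pure rm_actDl rm_actZl (bpure_bilin M ra_bim).1.
elim/bul_ind: y => [|x y Hx Hy|b d].
- by rewrite !fact1_0 scaler0 addr0.
- by rewrite !fact1_D Hx Hy scalerDr addrACA.
- rewrite !fact1_pure -(bpure_bilin M ra_bim).2; apply: congr1.
  change ((ra_k A c * (a : A) + (a' : A)) * (d : A) =
    ra_k A c * ((a : A) * (d : A)) + (a' : A) * (d : A)).
  by rewrite mulrDl mulrA.
Qed.
Lemma fact1_bal y m r a :
  fact1_fun y (ract m r) a = fact1_fun y m (lact r a).
Proof.
elim/bul_ind: y => [|x y Hx Hy|b c].
- by rewrite !fact1_0.
- by rewrite !fact1_D Hx Hy.
- rewrite !fact1_pure -rm_act_tgt rm_actA tgtC -rm_actA rm_act_tgt bpure_bal.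
  by apply: congr1; rewrite /= /reg_lact mulrA.
Qed.
Definition bul_fact (x : T) (y : bul ra_bim ra_bim) : T :=
  blift (fact1_bilin y) (fact1_bal y) x.
Lemma bul_factE m a b c : bul_fact (bpure m a) (bpure b c) =
  bpure (rm_act m (b : A)) ((a : A) * (c : A) : ra_bim).
Proof. by rewrite [LHS]bliftE fact1_pure. Qed.
Lemma bul_fact0l y : bul_fact 0 y = 0.
Proof. exact: lin0. Qed.
Lemma bul_factDl x x' y : bul_fact (x + x') y = bul_fact x y + bul_fact x' y.
Proof. exact: linD. Qed.
Lemma bul_fact0r x : bul_fact x 0 = 0.
Proof.
elim/bul_ind: x => [|x y Hx Hy|m a]; first exact: bul_fact0l.
  by rewrite bul_factDl Hx Hy addr0.
by rewrite [LHS]bliftE fact1_0.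
Qed.
Lemma bul_factDr x y y' : bul_fact x (y + y') = bul_fact x y + bul_fact x y'.
Proof.
elim/bul_ind: x => [|x z Hx Hz|m a].
- by rewrite !bul_fact0l addr0.
- by rewrite !bul_factDl Hx Hz addrACA.
- by rewrite /bul_fact !bliftE fact1_D.
Qed.
End FactorwiseAction.

Definition bul_mul : bul ra_bim ra_bim -> bul ra_bim ra_bim ->
  bul ra_bim ra_bim := @bul_fact ra_rmod.
Lemma bul_mulE (a b c d : ra_bim) : bul_mul (bpure a b) (bpure c d) =
  bpure ((a : A) * (c : A) : ra_bim) ((b : A) * (d : A) : ra_bim).
Proof. exact: (@bul_factE ra_rmod). Qed.

Section Counits.
Variable eps : bimap ra_bim (Rbim kR).

(* q • a |-> q ε(a) *)
Section CounitR.
Variable Q : bimod.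
Definition counitr_fun (q : Q) (a : ra_bim) : Q := ract q (eps a : R).
Lemma counitr_bilin : bilin counitr_fun.
Proof.
split=> [c m m' a|c m a a']; rewrite /counitr_fun.
  by rewrite ractDl ractZl.
rewrite linearP -ractZr -ractDr; congr (ract _ _).
Qed.
Lemma counitr_bal q r a : counitr_fun (ract q r) a = counitr_fun q (lact r a).
Proof. by rewrite /counitr_fun ractA bimapl. Qed.
Definition counitr : {linear bul Q ra_bim -> Q} :=
  blift counitr_bilin counitr_bal.
Lemma counitrE q a : counitr (bpure q a) = ract q (eps a : R).
Proof. exact: bliftE. Qed.
End CounitR.

(* a • p |-> ε(a) p *)
Section CounitL.
Variable P : bimod.
Definition counitl_fun (a : ra_bim) (p : P) : P := lact (eps a : R) p.
Lemma counitl_bilin : bilin counitl_fun.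
Proof.
split=> [c a a' p|c a p p']; rewrite /counitl_fun.
  rewrite linearP -lactZl -lactDl; congr (lact _ _).
by rewrite lactDr lactZr.
Qed.
Lemma counitl_bal a r p : counitl_fun (ract a r) p = counitl_fun a (lact r p).
Proof.
rewrite /counitl_fun lactA bimapr; congr (lact _ _).
exact: (@mulrC R).
Qed.
Definition counitl : {linear bul ra_bim P -> P} :=
  blift counitl_bilin counitl_bal.
Lemma counitlE a p : counitl (bpure a p) = lact (eps a : R) p.
Proof. exact: bliftE. Qed.
End CounitL.
End Counits.
End RegularBimodule.

Record bialgebroid := Bialgebroid {
  bg :> ralgebra;
  Delta : bimap (ra_bim bg) (bul (ra_bim bg) (ra_bim bg));
  eps : bimap (ra_bim bg) (Rbim kR);
  Delta_coassoc : forall a : ra_bim bg,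
    bulmap Delta (bimap_id (ra_bim bg)) (Delta a) =
    bulassoc _ _ _ (bulmap (bimap_id (ra_bim bg)) Delta (Delta a));
  Delta_counitl : forall a : ra_bim bg, counitl eps (ra_bim bg) (Delta a) = a;
  Delta_counitr : forall a : ra_bim bg, counitr eps (ra_bim bg) (Delta a) = a;
  Delta1 : Delta (1 : bg) = @bpure _ _ _ (ra_bim bg) (ra_bim bg) (1 : bg) (1 : bg);
  DeltaM : forall a b : bg, Delta (a * b) = bul_mul (Delta a) (Delta b);
  eps1 : eps (1 : bg) = (1 : R);
  epsM : forall a b : bg, eps (a * b) = (eps a : R) * (eps b : R)
}.

Section OverBialgebroid.
Variable A : bialgebroid.
Local Notation Ab := (ra_bim A).

Section Antipode.
Variable S : {linear Ab -> Ab}.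

Section MulS.
Hypothesis S_src : forall (a : A) r, S (a * src A r) = tgt A r * (S a : A).
(* a • b |-> a S(b) *)
Definition mulS_fun (a b : Ab) : Ab := (a : A) * (S b : A).
Lemma mulS_bilin : bilin mulS_fun.
Proof.
split=> [c a a' b|c a b b']; rewrite /mulS_fun.
  change ((ra_k A c * (a : A) + (a' : A)) * (S b : A) =
    ra_k A c * ((a : A) * (S b : A)) + (a' : A) * (S b : A)).
  by rewrite mulrDl mulrA.
rewrite linearP.
change ((a : A) * (ra_k A c * (S b : A) + (S b' : A)) =
  ra_k A c * ((a : A) * (S b : A)) + (a : A) * (S b' : A)).
by rewrite mulrDr !mulrA ra_kC.
Qed.
Lemma mulS_bal a r b : mulS_fun (ract a r) b = mulS_fun a (lact r b).
Proof.
by rewrite /mulS_fun /= /reg_ract /reg_lact srcC S_src mulrA tgtC.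
Qed.
Definition mulS : {linear bul Ab Ab -> Ab} := blift mulS_bilin mulS_bal.
Lemma mulSE a b : mulS (bpure a b) = (a : A) * (S b : A).
Proof. exact: bliftE. Qed.
End MulS.

Section SMul.
Hypothesis S_tgt : forall (a : A) r, S (tgt A r * a) = (S a : A) * src A r.
(* a • b |-> S(a) b *)
Definition Smul_fun (a b : Ab) : Ab := (S a : A) * (b : A).
Lemma Smul_bilin : bilin Smul_fun.
Proof.
split=> [c a a' b|c a b b']; rewrite /Smul_fun.
  rewrite linearP.
  change ((ra_k A c * (S a : A) + (S a' : A)) * (b : A) =
    ra_k A c * ((S a : A) * (b : A)) + (S a' : A) * (b : A)).
  by rewrite mulrDl mulrA.
change ((S a : A) * (ra_k A c * (b : A) + (b' : A)) =
  ra_k A c * ((S a : A) * (b : A)) + (S a : A) * (b' : A)).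
by rewrite mulrDr !mulrA ra_kC.
Qed.
Lemma Smul_bal a r b : Smul_fun (ract a r) b = Smul_fun a (lact r b).
Proof. by rewrite /Smul_fun /= /reg_ract /reg_lact S_tgt mulrA. Qed.
Definition Smul : {linear bul Ab Ab -> Ab} := blift Smul_bilin Smul_bal.
Lemma SmulE a b : Smul (bpure a b) = (S a : A) * (b : A).
Proof. exact: bliftE. Qed.
End SMul.

(* The first two conditions make a_1 S(a_2) and S(a_1) a_2 well defined.      *)
Record is_antipode : Prop := IsAntipode {
  S_src : forall (a : A) r, S (a * src A r) = tgt A r * (S a : A);
  S_tgt : forall (a : A) r, S (tgt A r * a) = (S a : A) * src A r;
  S_mulr : forall a : A, mulS S_src (Delta A a) = src A (eps A a : R);
  S_mull : forall a : A, Smul S_tgt (Delta A a) = tgt A (eps A a : R)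
}.
End Antipode.

Definition is_hopf_algebroid : Prop := exists S, is_antipode S.

Definition is_coaction (Q : bimod) (rho : bimap Q (bul Q Ab)) : Prop :=
  (forall q, bulmap rho (bimap_id Ab) (rho q) =
             bulassoc _ _ _ (bulmap (bimap_id Q) (Delta A) (rho q))) /\
  (forall q, counitr (eps A) Q (rho q) = q).

Record comodule := Comodule {
  cm_bim :> bimod;
  cm_rho : bimap cm_bim (bul cm_bim Ab);
  cm_coaction : is_coaction cm_rho
}.

Record comodule_map (P Q : comodule) := ComoduleMap {
  cmm :> bimap P Q;
  cmm_rho : forall p,
    bulmap cmm (bimap_id Ab) (cm_rho P p) = cm_rho Q (cmm p)
}.

Record hopf_module := HopfModule {
  hm_rmod :> rmodule A;
  hm_rho : bimap hm_rmod (bul hm_rmod Ab);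
  hm_coaction : is_coaction hm_rho;
  hm_compat : forall m (a : A),
    hm_rho (rm_act m a) = bul_fact (hm_rho m) (Delta A a)
}.

Record hopf_map (M N : hopf_module) := HopfMap {
  hmm :> bimap M N;
  hmm_act : forall m (a : A), hmm (rm_act m a) = rm_act (hmm m) a;
  hmm_rho : forall m,
    bulmap hmm (bimap_id Ab) (hm_rho M m) = hm_rho N (hmm m)
}.

(* ς_Q : Q ∘ A -> Q/[Q,R] • A, q ∘ a |-> [q_0] • q_1 a *)
Section Varsigma.
Variable Q : comodule.
Local Notation T := (bul (cq Q) Ab).
Definition vsg_rho (q : Q) : T :=
  bulmap (cq_proj Q) (bimap_id Ab) (cm_rho Q q).
Definition vsg_fun (q : Q) (a : Ab) : T := bul_mulr (a : A) (cq Q) (vsg_rho q).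

Lemma vsg_rhoP c q q' : vsg_rho (c *: q + q') = c *: vsg_rho q + vsg_rho q'.
Proof. by rewrite /vsg_rho !linearP. Qed.
Lemma vsg_bilin : bilin vsg_fun.
Proof.
split=> [c q q' a|c q a a']; rewrite /vsg_fun; first by rewrite vsg_rhoP linearP.
elim/bul_ind: (vsg_rho q) => [|x y Hx Hy|p b].
- by rewrite !(lin0, scaler0, addr0).
- by rewrite !(linD (bimap_lin _)) Hx Hy scalerDr addrACA.
- rewrite !bul_mulrE -(bpure_bilin (cq Q) Ab).2; apply: congr1.
  change ((b : A) * (ra_k A c * (a : A) + (a' : A)) =
    ra_k A c * ((b : A) * (a : A)) + (b : A) * (a' : A)).
  by rewrite mulrDr !mulrA ra_kC.
Qed.
Lemma vsg_bal r q r' a :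
  vsg_fun (ract (lact r q) r') a = vsg_fun q (ract (lact r a) r').
Proof.
rewrite /vsg_fun /vsg_rho !(bimapl, bimapr) -/(vsg_rho q).
elim/bul_ind: (vsg_rho q) => [|x y Hx Hy|p b].
- by rewrite !(lact0, ract0, lin0).
- by rewrite !(lactDr, ractDl, linD) Hx Hy.
- rewrite !(lact_bpure, ract_bpure, bul_mulrE) [lact r p]cq_act bpure_bal.
  apply: congr1; rewrite /= /reg_lact /reg_ract.
  by rewrite !mulrA -[(b : A) * _]tgtC -!mulrA [(b : A) * (_ * _)]mulrA -srcC !mulrA srcC.
Qed.
Definition varsigma_Q : {linear circ Q Ab -> T} := clift vsg_bilin vsg_bal.
Lemma varsigma_QE q a : varsigma_Q (cpure q a) =
  bul_mulr (a : A) (cq Q) (bulmap (cq_proj Q) (bimap_id Ab) (cm_rho Q q)).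
Proof. exact: cliftE. Qed.
End Varsigma.

End OverBialgebroid.
End Bialgebroids.

Record category := Category {
  ob :> Type;
  hom : ob -> ob -> Type;
  idc : forall x, hom x x;
  compc : forall x y z, hom y z -> hom x y -> hom x z;
  compc1l : forall x y (f : hom x y), compc (idc y) f = f;
  compc1r : forall x y (f : hom x y), compc f (idc x) = f;
  compcA : forall w x y z (h : hom y z) (g : hom x y) (f : hom w x),
    compc h (compc g f) = compc (compc h g) f
}.

Record functor (C D : category) := Functor {
  fob :> C -> D;
  fmap : forall x y, hom x y -> hom (fob x) (fob y);
  fmap1 : forall x, fmap (idc x) = idc (fob x);
  fmapM : forall x y z (g : hom y z) (f : hom x y),
    fmap (compc g f) = compc (fmap g) (fmap f)
}.

Definition id_functor (C : category) : functor C C :=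
  @Functor C C id (fun _ _ f => f) (fun _ => erefl) (fun _ _ _ _ _ => erefl).

Section CompFunctor.
Variables (C D E : category) (G : functor D E) (F : functor C D).
Definition comp_fmap x y (f : hom x y) : hom (G (F x)) (G (F y)) :=
  fmap G (fmap F f).
Lemma comp_fmap1 x : comp_fmap (idc x) = idc (G (F x)).
Proof. by rewrite /comp_fmap !fmap1. Qed.
Lemma comp_fmapM x y z (g : hom y z) (f : hom x y) :
  comp_fmap (compc g f) = compc (comp_fmap g) (comp_fmap f).
Proof. by rewrite /comp_fmap !fmapM. Qed.
Definition comp_functor : functor C E := Functor comp_fmap1 comp_fmapM.
End CompFunctor.

Record nattrans (C D : category) (F G : functor C D) := NatTrans {
  ntc :> forall x : C, hom (F x) (G x);
  ntc_nat : forall x y (f : hom x y),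
    compc (ntc y) (fmap F f) = compc (fmap G f) (ntc x)
}.

Definition is_iso (C : category) (x y : C) (f : hom x y) : Prop :=
  exists g : hom y x, compc g f = idc x /\ compc f g = idc y.

Definition is_nat_iso (C D : category) (F G : functor C D)
  (eta : nattrans F G) : Prop := forall x, is_iso (eta x).

Definition is_equivalence (C D : category) (F : functor C D) : Prop :=
  exists G : functor D C,
    (exists eta : nattrans (id_functor C) (comp_functor G F), is_nat_iso eta) /\
    (exists eps : nattrans (comp_functor F G) (id_functor D), is_nat_iso eps).

Section ModuleCategory.
Variable S : pzRingType.
Lemma idlin_lin (M : lmodType S) a : {morph (@id M) : x y / a *: x + y}.
Proof. by []. Qed.
Definition idlin (M : lmodType S) : {linear M -> M} := mklin (@idlin_lin M).
Section Comp.
Variables (M N P : lmodType S) (g : {linear N -> P}) (f : {linear M -> N}).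
Lemma complin_lin a : {morph (g \o f) : x y / a *: x + y}.
Proof. by move=> x y /=; rewrite !linearP. Qed.
Definition complin : {linear M -> P} := mklin complin_lin.
End Comp.
Definition Mod : category.
Proof.
by refine (@Category (lmodType S) (fun M N => {linear M -> N}) idlin complin
  _ _ _) => *; apply: linear_ext.
Defined.
End ModuleCategory.

Section BialgebroidCategories.
Variables (k R : comPzRingType) (kR : {rmorphism k -> R}).
Variable A : bialgebroid kR.
Local Notation Ab := (ra_bim A).

Lemma bulmap_id (M N : bimod kR) x :
  bulmap (bimap_id M) (bimap_id N) x = x.
Proof.
elim/bul_ind: x => [|x y Hx Hy|m n]; first exact: lin0.
  by rewrite linD Hx Hy.
by rewrite bulmapE.
Qed.

Lemma bulmap_comp (M M' M'' N N' N'' : bimod kR) (f' : bimap M' M'')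
  (f : bimap M M') (g' : bimap N' N'') (g : bimap N N') x :
  bulmap (bimap_comp f' f) (bimap_comp g' g) x =
  bulmap f' g' (bulmap f g x).
Proof.
elim/bul_ind: x => [|x y Hx Hy|m n]; first by rewrite !lin0.
  by rewrite !(linD (bimap_lin _)) Hx Hy.
by rewrite !bulmapE.
Qed.

Lemma bulmap_comp1 (M M' M'' N : bimod kR) (f' : bimap M' M'')
  (f : bimap M M') x : bulmap (bimap_comp f' f) (bimap_id N) x =
  bulmap f' (bimap_id N) (bulmap f (bimap_id N) x).
Proof.
rewrite -bulmap_comp; congr (bimap_lin (bulmap _ _) x).
exact: bimap_ext.
Qed.

Lemma comodule_map_ext (P Q : comodule A) (f g : comodule_map P Q) :
  f =1 g -> f = g.
Proof.
case: f g => f Hf [g Hg] /= /bimap_ext fg; subst g.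
by rewrite (Prop_irrelevance Hf Hg).
Qed.

Lemma comodule_map_id_rho (P : comodule A) p :
  bulmap (bimap_id P) (bimap_id Ab) (cm_rho P p) = cm_rho P (bimap_id P p).
Proof. exact: bulmap_id. Qed.
Definition comodule_map_id (P : comodule A) : comodule_map P P :=
  ComoduleMap (@comodule_map_id_rho P).

Section ComoduleMapComp.
Variables (P Q T : comodule A) (g : comodule_map Q T) (f : comodule_map P Q).
Lemma comodule_map_comp_rho p :
  bulmap (bimap_comp g f) (bimap_id Ab) (cm_rho P p) =
  cm_rho T (bimap_comp g f p).
Proof. by rewrite bulmap_comp1 !cmm_rho. Qed.
Definition comodule_map_comp : comodule_map P T :=
  ComoduleMap comodule_map_comp_rho.
End ComoduleMapComp.

Definition Comod : category.
Proof.
by refine (@Category (comodule A) (@comodule_map _ _ _ A) comodule_map_id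
  comodule_map_comp _ _ _) => *; apply: comodule_map_ext.
Defined.

Lemma hopf_map_ext (M N : hopf_module A) (f g : hopf_map M N) :
  f =1 g -> f = g.
Proof.
case: f g => f Hf Kf [g Hg Kg] /= /bimap_ext fg; subst g.
by rewrite (Prop_irrelevance Hf Hg) (Prop_irrelevance Kf Kg).
Qed.

Lemma hopf_map_id_rho (M : hopf_module A) m :
  bulmap (bimap_id M) (bimap_id Ab) (hm_rho M m) = hm_rho M (bimap_id M m).
Proof. exact: bulmap_id. Qed.
Definition hopf_map_id (M : hopf_module A) : hopf_map M M :=
  @HopfMap _ _ _ A M M (bimap_id M) (fun _ _ => erefl) (@hopf_map_id_rho M).

Section HopfMapComp.
Variables (M N P : hopf_module A) (g : hopf_map N P) (f : hopf_map M N).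
Lemma hopf_map_comp_act m (a : A) :
  bimap_comp g f (rm_act m a) = rm_act (bimap_comp g f m) a.
Proof. by rewrite /= /mklin_fun /= !hmm_act. Qed.
Lemma hopf_map_comp_rho m :
  bulmap (bimap_comp g f) (bimap_id Ab) (hm_rho M m) =
  hm_rho P (bimap_comp g f m).
Proof. by rewrite bulmap_comp1 !hmm_rho. Qed.
Definition hopf_map_comp : hopf_map M P :=
  HopfMap hopf_map_comp_act hopf_map_comp_rho.
End HopfMapComp.

Definition HopfMod : category.
Proof.
by refine (@Category (hopf_module A) (@hopf_map _ _ _ A) hopf_map_id
  hopf_map_comp _ _ _) => *; apply: hopf_map_ext.
Defined.

Definition circ_functor : functor Comod (Mod k).
Proof.
refine (@Functor Comod (Mod k) (fun Q : comodule A => circ Q Ab)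
  (fun P Q (f : comodule_map P Q) => circmap f (bimap_id Ab)) _ _).
- by move=> Q; apply/linear_ext/circ_ext => q a; rewrite circmapE.
- move=> P Q T g f; apply/linear_ext/circ_ext => q a.
  rewrite -[RHS]/(circmap g _ (circmap f _ (cpure q a))).
  by rewrite !circmapE.
Defined.

Definition cq_functor : functor Comod (Mod k).
Proof.
refine (@Functor Comod (Mod k) (fun Q : comodule A => bul_mod (cq Q) Ab)
  (fun P Q (f : comodule_map P Q) => bulmap (cqmap f) (bimap_id Ab)) _ _).
- move=> Q; apply/linear_ext/bul_ext => p a; rewrite bulmapE.
  by have [q ->] := cq_surj p; rewrite cqmapE.
- move=> P Q T g f; apply/linear_ext/bul_ext => p a.
  rewrite -[RHS]/(bulmap (cqmap g) _ (bulmap (cqmap f) _ (bpure p a))).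
  by rewrite !bulmapE; have [q ->] := cq_surj p; rewrite !cqmapE.
Defined.

Definition varsigma : nattrans circ_functor cq_functor.
Proof.
refine (@NatTrans _ _ circ_functor cq_functor (@varsigma_Q _ _ _ A) _).
move=> P Q f; apply/linear_ext/circ_ext => q a.
rewrite -[LHS]/(varsigma_Q Q (circmap f _ (cpure q a))).
rewrite -[RHS]/(bulmap (cqmap f) _ (varsigma_Q P (cpure q a))).
rewrite circmapE !varsigma_QE -cmm_rho.
elim/bul_ind: (cm_rho P q) => [|x y Hx Hy|p b]; first by rewrite !lin0.
  by rewrite !(linD (bimap_lin _)) Hx Hy.
by rewrite !(bulmapE, bul_mulrE) cqmapE.
Defined.

Section Comparison.
Variable N : lmodType R.
Local Notation Nb := (symbim kR N).
Local Notation NA := (bul Nb Ab).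

Definition cmp_act (x : NA) (a : A) : NA := bul_mulr a Nb x.
Lemma cmp_actE (n : Nb) (b : Ab) a :
  cmp_act (bpure n b) a = bpure n ((b : A) * a : Ab).
Proof. exact: bul_mulrE. Qed.
Lemma cmp_act0 a : cmp_act 0 a = 0.
Proof. exact: lin0. Qed.
Lemma cmp_actDl x y a : cmp_act (x + y) a = cmp_act x a + cmp_act y a.
Proof. exact: linD. Qed.
Lemma cmp_actDr x a b : cmp_act x (a + b) = cmp_act x a + cmp_act x b.
Proof.
elim/bul_ind: x => [|x y Hx Hy|n c].
- by rewrite !cmp_act0 addr0.
- by rewrite !cmp_actDl Hx Hy addrACA.
- by rewrite !cmp_actE -bpureDr mulrDr.
Qed.
Lemma cmp_actA x a b : cmp_act (cmp_act x a) b = cmp_act x (a * b).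
Proof.
elim/bul_ind: x => [|x y Hx Hy|n c].
- by rewrite !cmp_act0.
- by rewrite !cmp_actDl Hx Hy.
- by rewrite !cmp_actE mulrA.
Qed.
Lemma cmp_act1 x : cmp_act x 1 = x.
Proof.
elim/bul_ind: x => [|x y Hx Hy|n c].
- by rewrite !cmp_act0.
- by rewrite !cmp_actDl Hx Hy.
- by rewrite cmp_actE mulr1.
Qed.
Lemma cmp_act_k x c : cmp_act x (ra_k A c) = c *: x.
Proof.
elim/bul_ind: x => [|x y Hx Hy|n a].
- by rewrite cmp_act0 scaler0.
- by rewrite cmp_actDl Hx Hy scalerDr.
- by rewrite cmp_actE -ra_kC -bpureZr.
Qed.
Lemma cmp_act_src x r : cmp_act x (src A r) = lact r x.
Proof.
elim/bul_ind: x => [|x y Hx Hy|n a].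
- by rewrite cmp_act0 lact0.
- by rewrite cmp_actDl Hx Hy lactDr.
- by rewrite cmp_actE lact_bpure -srcC -bpure_bal.
Qed.
Lemma cmp_act_tgt x r : cmp_act x (tgt A r) = ract x r.
Proof.
elim/bul_ind: x => [|x y Hx Hy|n a].
- by rewrite cmp_act0 ract0.
- by rewrite cmp_actDl Hx Hy ractDl.
- by rewrite cmp_actE ract_bpure -tgtC.
Qed.
Definition cmp_rmod : rmodule A := RModule cmp_actDl cmp_actDr cmp_actA cmp_act1
  cmp_act_k cmp_act_src cmp_act_tgt.

(* n • a |-> (n • a_1) • a_2 *)
Definition cmp_rho_fun (x : NA) : bul NA Ab :=
  bulassoc _ _ _ (bulmap (bimap_id Nb) (Delta A) x).
Lemma cmp_rhoE n a :
  cmp_rho_fun (bpure n a) = bulassoc Nb Ab Ab (bpure n (Delta A a : bul Ab Ab)).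
Proof. by rewrite /cmp_rho_fun bulmapE. Qed.
Lemma cmp_rho_lin c : {morph cmp_rho_fun : x y / c *: x + y}.
Proof. by move=> x y; rewrite /cmp_rho_fun !linearP. Qed.
Lemma bulassocl (M P Q : bimod kR) r x :
  bulassoc M P Q (lact r x) = lact r (bulassoc M P Q x).
Proof.
elim/bul_ind: x => [|x y Hx Hy|m x]; first by rewrite lact0 !lin0 lact0.
  by rewrite !(lactDr, linD) Hx Hy.
rewrite lact_bpure; elim/bul_ind: x => [|x y Hx Hy|p q].
- by rewrite !(bilin0r (bpure_bilin _ _), lin0, lact0).
- by rewrite !(bpureDr, lactDr, linD) Hx Hy.
- by rewrite !bulassocE !lact_bpure.
Qed.
Lemma bulassocr (M P Q : bimod kR) x r :
  bulassoc M P Q (ract x r) = ract (bulassoc M P Q x) r.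
Proof.
elim/bul_ind: x => [|x y Hx Hy|m x]; first by rewrite ract0 !lin0 ract0.
  by rewrite !(ractDl, linD) Hx Hy.
rewrite ract_bpure; elim/bul_ind: x => [|x y Hx Hy|p q].
- by rewrite !(ract0, bilin0r (bpure_bilin _ _), lin0).
- by rewrite !(ractDl, bpureDr, linD) Hx Hy.
- by rewrite !(ract_bpure, bulassocE).
Qed.
Lemma cmp_rhol r x : cmp_rho_fun (lact r x) = lact r (cmp_rho_fun x).
Proof. by rewrite /cmp_rho_fun bimapl bulassocl. Qed.
Lemma cmp_rhor x r : cmp_rho_fun (ract x r) = ract (cmp_rho_fun x) r.
Proof. by rewrite /cmp_rho_fun bimapr bulassocr. Qed.
Definition cmp_rho : bimap cmp_rmod (bul cmp_rmod Ab) :=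
  @Bimap _ _ _ NA (bul NA Ab) (mklin cmp_rho_lin) cmp_rhol cmp_rhor.

Section Coassoc.
Variable n : Nb.
Local Notation T3 := (bul (bul NA Ab) Ab).
Definition cmp_n (x : bul Ab Ab) : bul NA Ab := bulassoc Nb Ab Ab (bpure n x).
Lemma cmp_n0 : cmp_n 0 = 0.
Proof. by rewrite /cmp_n (bilin0r (bpure_bilin _ _)) lin0. Qed.
Lemma cmp_nD x y : cmp_n (x + y) = cmp_n x + cmp_n y.
Proof. by rewrite /cmp_n bpureDr linD. Qed.
Lemma cmp_nE a b : cmp_n (bpure a b) = bpure (bpure n a : NA) b.
Proof. exact: bulassocE. Qed.
Lemma cmp_nP c x y : cmp_n (c *: x + y) = c *: cmp_n x + cmp_n y.
Proof. by rewrite /cmp_n (bpure_bilin _ _).2 linearP. Qed.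
Lemma cmp_nr x r : cmp_n (ract x r) = ract (cmp_n x) r.
Proof. by rewrite /cmp_n -ract_bpure bulassocr. Qed.

(* (a • b) • c |-> ((n • a) • b) • c *)
Definition cmp_n3_fun (x : bul Ab Ab) (c : Ab) : T3 := bpure (cmp_n x) c.
Lemma cmp_n3_bilin : bilin cmp_n3_fun.
Proof.
split=> *; rewrite /cmp_n3_fun; last exact: (bpure_bilin (bul NA Ab) Ab).2.
by rewrite cmp_nP (bpure_bilin (bul NA Ab) Ab).1.
Qed.
Lemma cmp_n3_bal x r c : cmp_n3_fun (ract x r) c = cmp_n3_fun x (lact r c).
Proof. by rewrite /cmp_n3_fun cmp_nr bpure_bal. Qed.
Definition cmp_n3 : {linear bul (bul Ab Ab) Ab -> T3} :=
  blift cmp_n3_bilin cmp_n3_bal.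
Lemma cmp_n3E x c : cmp_n3 (bpure x c) = bpure (cmp_n x) c.
Proof. exact: bliftE. Qed.

Lemma cmp_coassoc_l (x : bul Ab Ab) :
  bulmap (cmp_rho : bimap NA (bul NA Ab)) (bimap_id Ab) (cmp_n x) =
  cmp_n3 (bulmap (Delta A) (bimap_id Ab) x).
Proof.
elim/bul_ind: x => [|x y Hx Hy|a b]; first by rewrite cmp_n0 !lin0.
  by rewrite cmp_nD !(linD (bimap_lin _)) (linD cmp_n3) Hx Hy.
by rewrite cmp_nE !bulmapE cmp_n3E -[cmp_rho _]/(cmp_rho_fun _) cmp_rhoE.
Qed.

Lemma cmp_coassoc_r (x : bul Ab Ab) :
  bulassoc NA Ab Ab (bulmap (bimap_id NA) (Delta A) (cmp_n x)) =
  cmp_n3 (bulassoc Ab Ab Ab (bulmap (bimap_id Ab) (Delta A) x)).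
Proof.
elim/bul_ind: x => [|x y Hx Hy|a b]; first by rewrite cmp_n0 !lin0.
  by rewrite cmp_nD !(linD (bimap_lin _)) !(linD (bulassoc _ _ _))
    (linD cmp_n3) Hx Hy.
rewrite cmp_nE !bulmapE -![bimap_id _ _]/(_).
elim/bul_ind: (Delta A b) => [|x y Hx Hy|c d].
- by rewrite !(bilin0r (bpure_bilin _ _)) !lin0.
- by rewrite !bpureDr !(linD (bulassoc _ _ _)) (linD cmp_n3) Hx Hy.
- by rewrite !bulassocE cmp_n3E cmp_nE.
Qed.

Lemma cmp_counit_n (x : bul Ab Ab) :
  counitr (eps A) NA (cmp_n x) = bpure n (counitr (eps A) Ab x).
Proof.
elim/bul_ind: x => [|x y Hx Hy|a b].
- by rewrite cmp_n0 !lin0 (bilin0r (bpure_bilin _ _)).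
- by rewrite cmp_nD !(linD (counitr _ _)) bpureDr Hx Hy.
- by rewrite cmp_nE !counitrE ract_bpure.
Qed.

Lemma cmp_n_mul x y :
  cmp_n (bul_mul x y) = @bul_fact _ _ _ A cmp_rmod (cmp_n x) y.
Proof.
elim/bul_ind: x => [|x x' Hx Hx'|a b].
- by rewrite /bul_mul bul_fact0l cmp_n0 bul_fact0l.
- by rewrite /bul_mul bul_factDl !cmp_nD bul_factDl -Hx -Hx'.
elim/bul_ind: y => [|y y' Hy Hy'|c d].
- by rewrite /bul_mul !bul_fact0r cmp_n0.
- by rewrite /bul_mul !bul_factDr cmp_nD -Hy -Hy'.
rewrite bul_mulE !cmp_nE (@bul_factE _ _ _ A cmp_rmod).
by rewrite -[rm_act _ _]/(cmp_act _ _) cmp_actE.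
Qed.
End Coassoc.

Lemma cmp_coaction : is_coaction cmp_rho.
Proof.
split=> x.
  elim/bul_ind: x => [|x y Hx Hy|n a]; first by rewrite !lin0.
    by rewrite !(linD (bimap_lin _)) !(linD (bulassoc _ _ _)) Hx Hy.
  have -> : cmp_rho (bpure n a) = cmp_n n (Delta A a) by exact: cmp_rhoE.
  by rewrite [LHS]cmp_coassoc_l Delta_coassoc -cmp_coassoc_r.
elim/bul_ind: x => [|x y Hx Hy|n a]; first by rewrite !lin0.
  by rewrite !(linD (bimap_lin _)) (linD (counitr _ _)) Hx Hy.
have -> : cmp_rho (bpure n a) = cmp_n n (Delta A a) by exact: cmp_rhoE.
by rewrite [LHS]cmp_counit_n Delta_counitr.
Qed.

Lemma cmp_compat (m : cmp_rmod) (a : A) :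
  cmp_rho (rm_act m a) = bul_fact (cmp_rho m) (Delta A a).
Proof.
rewrite -[rm_act m a]/(cmp_act m a).
elim/bul_ind: m => [|x y Hx Hy|n b].
- by rewrite cmp_act0 !lin0 bul_fact0l.
- by rewrite cmp_actDl !(linD (bimap_lin _)) bul_factDl Hx Hy.
rewrite cmp_actE.
have E c : cmp_rho (bpure n c) = cmp_n n (Delta A c) by exact: cmp_rhoE.
by rewrite !E DeltaM cmp_n_mul.
Qed.

Definition cmp_hopf : hopf_module A := HopfModule cmp_coaction cmp_compat.
End Comparison.

Section ComparisonMap.
Variables (N N' : lmodType R) (f : {linear N -> N'}).
Definition cmp_map : bimap (cmp_hopf N) (cmp_hopf N') :=
  bulmap (symmap kR f) (bimap_id Ab).
Lemma cmp_mapE n a :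
  cmp_map (bpure (n : symbim kR N) a) = bpure (f n : symbim kR N') a.
Proof. exact: bulmapE. Qed.
Lemma cmp_map_act m (a : A) : cmp_map (rm_act m a) = rm_act (cmp_map m) a.
Proof.
rewrite -[rm_act m a]/(cmp_act m a) -[RHS]/(cmp_act _ a).
elim/bul_ind: m => [|x y Hx Hy|n b].
- by rewrite cmp_act0 !lin0 cmp_act0.
- by rewrite cmp_actDl !(linD (bimap_lin _)) cmp_actDl Hx Hy.
- by rewrite cmp_actE !cmp_mapE cmp_actE.
Qed.
Lemma cmp_map_rho m : bulmap cmp_map (bimap_id Ab) (hm_rho (cmp_hopf N) m) =
  hm_rho (cmp_hopf N') (cmp_map m).
Proof.
elim/bul_ind: m => [|x y Hx Hy|n a]; first by rewrite !lin0.
  by rewrite !(linD (bimap_lin _)) Hx Hy.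
rewrite cmp_mapE.
have E L (p : symbim kR L) : hm_rho (cmp_hopf L) (bpure p a) =
  cmp_n p (Delta A a) by exact: cmp_rhoE.
rewrite !E; elim/bul_ind: (Delta A a) => [|x y Hx Hy|b c].
- by rewrite !cmp_n0 lin0.
- by rewrite !cmp_nD !(linD (bimap_lin _)) Hx Hy.
- by rewrite !cmp_nE bulmapE cmp_mapE.
Qed.
Definition cmp_hopf_map : hopf_map (cmp_hopf N) (cmp_hopf N') :=
  HopfMap cmp_map_act cmp_map_rho.
End ComparisonMap.

Definition comparison : functor (Mod R) HopfMod.
Proof.
refine (@Functor (Mod R) HopfMod cmp_hopf cmp_hopf_map _ _).
- move=> N; apply/hopf_map_ext/bul_ext => n a.
  by rewrite -[LHS]/(cmp_map _ _) cmp_mapE.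
- move=> N N' N'' g f; apply/hopf_map_ext/bul_ext => n a.
  rewrite -[RHS]/(cmp_map g (cmp_map f (bpure n a))) -[LHS]/(cmp_map _ _).
  by rewrite !cmp_mapE.
Defined.
End BialgebroidCategories.

(* Main.v *)
From HB Require Import structures.
From mathcomp Require Import all_boot all_algebra.
From mathcomp Require Import boolp.
Require Import Defs.

(** Write [rho q] as [q0 . q1] and [Delta a] as [a1 . a2].

    (i) => (iii): the comparison functor [K] is always fully faithful, because
    a coinvariant element [x] of [N . A] equals [(N . eps)(x) . 1].  Given an
    antipode, a Hopf module [M] is isomorphic to [K V] where [V] is the quotient
    of [M] by the elements [m a - eps(a) m]: the map [m |-> [m0] . m1] has
    inverse [[m] . a |-> m0 S(m1) a], which is well defined since [S] is
    antimultiplicative.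

    (iii) => (ii): [Q o A] is the free Hopf module on the comodule [Q], with
    diagonal coaction, and [varsigma_Q] is the universal arrow from it to [K].
    An isomorphism [phi : Q o A -> K N] factors as [(f . A) varsigma_Q] with
    [f : Q / [Q, R] -> N]; pulling the unit of [N . A] back through [phi] shows
    that [f] is split injective, hence [varsigma_Q] is bijective.

    (ii) => (i): take [Q = R (x) A], the tensor product being over [k].  Then
    [varsigma_Q] is the Galois map [a (x) b |-> a1 . a2 b], and
    [S(a) = t(eps(a+)) a-] for [a+ (x) a- = varsigma_Q^-1(a . 1)]. *)

Set Implicit Arguments.
Unset Strict Implicit.
Unset Printing Implicit Defensive.

Import GRing.Theory.
Local Open Scope ring_scope.
Local Open Scope quotient_scope.

(** * Sums over tensors *)

Section TensorSum.
Variables (k : comPzRingType) (M N : lmodType k) (W : zmodType).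
Implicit Types (f : M -> N -> W) (x y : tensor M N).

Definition biadditive f : Prop :=
  (forall m m' n, f (m + m') n = f m n + f m' n) /\
  (forall m n n', f m (n + n') = f m n + f m n').

(** The target [W] is a bare abelian group, where [tlift] would ask for a [k]-module. Summands can
    then take values in the ring [A] and be transported along maps known only to be additive. *)
Definition tens_sum f x : W := \sum_(p <- repr (x : tens M N)) f p.1 p.2.

Section Balanced.
Variable f : M -> N -> W.
Hypotheses (fD : biadditive f)
  (f_bal : forall c m n, f (c *: m) n = f m (c *: n)).

Lemma biadditive0l n : f 0 n = 0.
Proof. by apply: (addrI (f 0 n)); rewrite -fD.1 !addr0. Qed.

Lemma tcong_sum s t : tcong s t ->
  \sum_(p <- s) f p.1 p.2 = \sum_(p <- t) f p.1 p.2.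
Proof.
elim=> {s t} //.
- by move=> s t u _ -> _ ->.
- by move=> s s' t t' _ ? _ ?; rewrite !big_cat /=; congr (_ + _).
- by move=> s t; rewrite !big_cat /= addrC.
- by move=> m m' n; rewrite !big_cons big_nil /= fD.1 !addr0.
- by move=> m n n'; rewrite !big_cons big_nil /= fD.2 !addr0.
- by move=> n; rewrite !big_cons big_nil /= biadditive0l addr0.
- by move=> c m n; rewrite !big_cons big_nil /= f_bal.
Qed.

Lemma tens_sum_pi s :
  tens_sum f (\pi_(tens M N) s : tens M N) = \sum_(p <- s) f p.1 p.2.
Proof. exact/tcong_sum/tens_repr. Qed.

Lemma tens_sumD x y : tens_sum f (x + y) = tens_sum f x + tens_sum f y.
Proof.
rewrite -[x]reprK -[y]reprK -[_ + _]/(tens_add _ _).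
by rewrite tens_add_pi !tens_sum_pi big_cat.
Qed.

Lemma tens_sum_pure m n : tens_sum f (tpure m n) = f m n.
Proof. by rewrite [LHS]tens_sum_pi big_seq1. Qed.

Lemma tens_sum0 : tens_sum f 0 = 0.
Proof. by apply: (addrI (tens_sum f 0)); rewrite -tens_sumD !addr0. Qed.

Lemma tens_sumB x y : tens_sum f (x - y) = tens_sum f x - tens_sum f y.
Proof.
apply: (addIr (tens_sum f y)); rewrite -tens_sumD !addrNK //.
Qed.
End Balanced.

Section Quotient.
Variable X : tensor M N -> Prop.

Definition quot_sum f (u : quotm X) : W :=
  tens_sum f (repr (u : Quotient.quot (spanp X))).

Variable f : M -> N -> W.
Hypotheses (fD : biadditive f)
  (f_bal : forall c m n, f (c *: m) n = f m (c *: n))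
  (fX : forall c v, X v -> tens_sum f (c *: v) = 0).

(** [W] has no scalars with which to pull [c] out of the sum, so the induction over the span carries
    an arbitrary scalar. *)
Lemma span_sum v : Defs.span X v -> forall c, tens_sum f (c *: v) = 0.
Proof.
elim=> [u Xu c||b u w _ fu _ fw c]; first exact: fX.
  by move=> c; rewrite scaler0 tens_sum0.
by rewrite scalerDr scalerA tens_sumD // fu fw addr0.
Qed.

Lemma quot_sum_proj v : quot_sum f (qproj X v) = tens_sum f v.
Proof.
apply/eqP; rewrite -subr_eq0 -tens_sumB // -[_ - _]scale1r.
apply/eqP/span_sum/qproj_eq0.
by rewrite linB /qproj /= /mklin_fun reprK subrr.
Qed.

Lemma quot_sumD u u' : quot_sum f (u + u') = quot_sum f u + quot_sum f u'.
Proof.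
have [v ->] := qproj_surj u; have [v' ->] := qproj_surj u'.
by rewrite -linD !quot_sum_proj tens_sumD.
Qed.
End Quotient.
End TensorSum.

(** * Sweedler sums over the two balanced tensor products *)

Section BulletSum.
Variables (k R : comPzRingType) (kR : {rmorphism k -> R}).
Implicit Types (M N P : bimod kR) (W : zmodType).

(** Balancedness over [k] follows from [bul_bal], since [k] acts through [kR] on both sides. *)
Record bul_balanced M N W (f : M -> N -> W) : Prop := BulBalanced {
  bulDl : forall m m' n, f (m + m') n = f m n + f m' n;
  bulDr : forall m n n', f m (n + n') = f m n + f m n';
  bul_bal : forall m r n, f (ract m r) n = f m (lact r n)
}.

Record tri_balanced M N P W (f : M -> N -> P -> W) : Prop := TriBalanced {
  tri_l : forall p, bul_balanced (fun m n => f m n p);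
  tri_r : forall m, bul_balanced (f m)
}.

(** [bul_sum x f] is Sweedler's [sum f x' x''] for [x = sum x' . x''].  It is
    computed on a chosen representative of [x], hence is meaningful only for
    balanced [f]; demanding this in the lemmas rather than in the definition
    keeps proof terms out of the summands. *)
Definition bul_sum M N W (x : bul M N) (f : M -> N -> W) : W :=
  quot_sum f (x : bul_mod M N).

Section Theory.
Variables (M N : bimod kR) (W : zmodType) (f : M -> N -> W).

Section BalancedTheory.
Hypothesis f_bal : bul_balanced f.

Let fD : biadditive f := conj (bulDl f_bal) (bulDr f_bal).
Let fk c m n : f (c *: m) n = f m (c *: n).
Proof. by rewrite -ract_k bul_bal // lact_k. Qed.
Let fX c v : bul_rel v -> tens_sum f (c *: v) = 0.
Proof.
move=> [m [r [n ->]]]; rewrite scalerBr.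
rewrite -!(bilinZl (tpure_bilin M N)) -ractZl tens_sumB // !tens_sum_pure //.
by rewrite bul_bal // subrr.
Qed.

Lemma bul_sumD x y : bul_sum (x + y) f = bul_sum x f + bul_sum y f.
Proof. exact: quot_sumD. Qed.

Lemma bul_sum_pure m n : bul_sum (bpure m n) f = f m n.
Proof. by rewrite [LHS]quot_sum_proj // tens_sum_pure. Qed.

Lemma bul_sum0 : bul_sum 0 f = 0.
Proof. by apply: (addrI (bul_sum 0 f)); rewrite -bul_sumD !addr0. Qed.

(** Additive maps that agree on the generators [m . n] coincide. This is the passage from maps built
    by [blift] to Sweedler sums. *)
Lemma bul_sumE (h : bul M N -> W) : {morph h : x y / x + y} ->
  (forall m n, h (bpure m n) = f m n) -> forall x, h x = bul_sum x f.
Proof.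
move=> hD hE; elim/bul_ind=> [|x y Hx Hy|m n].
- by rewrite bul_sum0; apply: (addrI (h 0)); rewrite -hD !addr0.
- by rewrite hD bul_sumD Hx Hy.
- by rewrite hE bul_sum_pure.
Qed.
End BalancedTheory.

(** Both sides are finite sums over the same chosen representative of [x], so they are compared term
    by term, whatever [f] and [g] are. Moving additive maps inside a sum and exchanging two sums
    rest on the same fact. *)
Lemma eq_bul_sum g x : (forall m n, f m n = g m n) ->
  bul_sum x f = bul_sum x g.
Proof. by move=> fg; apply: eq_bigr. Qed.

Lemma bul_sum_add g x :
  bul_sum x (fun m n => f m n + g m n) = bul_sum x f + bul_sum x g.
Proof. exact: big_split. Qed.

Lemma bul_sum_morph (W' : zmodType) (h : W -> W') x :
  {morph h : x y / x + y} -> h (bul_sum x f) = bul_sum x (fun m n => h (f m n)).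
Proof.
move=> hD; apply: (big_morph h hD).
by apply: (addrI (h 0)); rewrite -hD !addr0.
Qed.
End Theory.

Lemma linear_bul_sum M N (U V : lmodType k) (h : {linear U -> V}) x
    (f : M -> N -> U) : h (bul_sum x f) = bul_sum x (fun m n => h (f m n)).
Proof. exact: (bul_sum_morph f x (linD h)). Qed.

Lemma lact_bul_sum M N P r x (f : M -> N -> P) :
  lact r (bul_sum x f) = bul_sum x (fun m n => lact r (f m n)).
Proof. exact: (bul_sum_morph f x (lactDr r)). Qed.

Lemma ract_bul_sum M N P x (f : M -> N -> P) r :
  ract (bul_sum x f) r = bul_sum x (fun m n => ract (f m n) r).
Proof. exact: (linear_bul_sum (ractm P r)). Qed.

Lemma bpure_suml M N P P' x (f : M -> N -> P) (p : P') :
  bpure (bul_sum x f) p = bul_sum x (fun m n => bpure (f m n) p).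
Proof.
by apply: (bul_sum_morph f (h := fun y => bpure y p) x) => y z; apply: bpureDl.
Qed.

Lemma bpure_sumr M N P P' x (f : M -> N -> P) (p : P') :
  bpure p (bul_sum x f) = bul_sum x (fun m n => bpure p (f m n)).
Proof. by apply: bul_sum_morph => y z; apply: bpureDr. Qed.

Lemma bpure_balanced M N : bul_balanced (fun m n => bpure m n : bul M N).
Proof. by split=> *; [exact: bpureDl|exact: bpureDr|exact: bpure_bal]. Qed.

Lemma bpure3_balanced M N P :
  tri_balanced (fun m n p => bpure (bpure m n : bul M N) p : bul (bul M N) P).
Proof.
split=> [p|m]; split=> [x y z|x y z|x r z].
- by rewrite !bpureDl.
- by rewrite bpureDr bpureDl.
- by rewrite bpure_bal.
- by rewrite bpureDr bpureDl.
- by rewrite bpureDr.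
- by rewrite -ract_bpure bpure_bal.
Qed.

Lemma bul_sum_id M N (x : bul M N) :
  bul_sum x (fun m n => bpure m n : bul M N) = x.
Proof.
by symmetry; apply: (bul_sumE (h := id) (@bpure_balanced M N)).
Qed.

Lemma bul_sum_bul M N M' N' W (x : bul M N) (g : M -> N -> bul M' N')
    (f : M' -> N' -> W) : bul_balanced f ->
  bul_sum (bul_sum x g) f = bul_sum x (fun m n => bul_sum (g m n) f).
Proof.
by move=> fP; apply: (bul_sum_morph g (h := fun y => bul_sum y f) x) => y z;
  apply: bul_sumD.
Qed.

Lemma bul_sum_mulr M N (S : pzRingType) (x : bul M N) (f : M -> N -> S) a :
  bul_sum x f * a = bul_sum x (fun m n => f m n * a).
Proof. exact: mulr_suml. Qed.

Lemma bul_sum_mull M N (S : pzRingType) (x : bul M N) (f : M -> N -> S) a :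
  a * bul_sum x f = bul_sum x (fun m n => a * f m n).
Proof. exact: mulr_sumr. Qed.

Lemma bul_sum_exchange M N M' N' W (x : bul M N) (y : bul M' N')
    (f : M -> N -> M' -> N' -> W) :
  bul_sum x (fun m n => bul_sum y (f m n)) =
  bul_sum y (fun p q => bul_sum x (fun m n => f m n p q)).
Proof. exact: exchange_big. Qed.

Section Maps.
Variables (M N M' N' : bimod kR) (W : zmodType) (f : M' -> N' -> W).
Hypothesis f_bal : bul_balanced f.

Lemma bul_balanced_comp (u : bimap M M') (v : bimap N N') :
  bul_balanced (fun m n => f (u m) (v n)).
Proof.
split=> *; rewrite ?linD; first exact: bulDl; first exact: bulDr.
by rewrite bimapr bimapl bul_bal.
Qed.

Lemma bul_sum_map (u : bimap M M') (v : bimap N N') x :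
  bul_sum (bulmap u v x) f = bul_sum x (fun m n => f (u m) (v n)).
Proof.
apply: (bul_sumE (h := fun y => bul_sum (bulmap u v y) f)
  (bul_balanced_comp u v)) => [y z|m n].
  by rewrite linD bul_sumD.
by rewrite bulmapE bul_sum_pure.
Qed.
End Maps.

Section Actions.
Variables (M N : bimod kR) (W : zmodType) (f : M -> N -> W).
Hypothesis f_bal : bul_balanced f.

Lemma bul_balanced_lact r : bul_balanced (fun m n => f (lact r m) n).
Proof.
split=> *; first by rewrite lactDr bulDl.
  exact: bulDr.
by rewrite -lractA bul_bal.
Qed.

Lemma bul_balanced_ract r : bul_balanced (fun m n => f m (ract n r)).
Proof.
split=> *; first exact: bulDl.
  by rewrite ractDl bulDr.
by rewrite lractA bul_bal.
Qed.

Lemma bul_sum_lact r x :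
  bul_sum (lact r x) f = bul_sum x (fun m n => f (lact r m) n).
Proof.
apply: (bul_sumE (h := fun y => bul_sum (lact r y) f)
  (bul_balanced_lact r)) => [y z|m n].
  by rewrite lactDr bul_sumD.
by rewrite lact_bpure bul_sum_pure.
Qed.

Lemma bul_sum_ract x r :
  bul_sum (ract x r) f = bul_sum x (fun m n => f m (ract n r)).
Proof.
apply: (bul_sumE (h := fun y => bul_sum (ract y r) f)
  (bul_balanced_ract r)) => [y z|m n].
  by rewrite ractDl bul_sumD.
by rewrite ract_bpure bul_sum_pure.
Qed.
End Actions.

Section Assoc.
Variables (M N P : bimod kR) (W : zmodType) (f : M -> N -> P -> W).
Hypothesis f_bal : tri_balanced f.

Lemma tri_balanced_l :
  bul_balanced (fun (x : bul M N) p => bul_sum x (fun m n => f m n p)).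
Proof.
split=> [x y p|x p p'|x r p].
- exact: bul_sumD (tri_l f_bal p) _ _.
- rewrite -bul_sum_add; apply: eq_bul_sum => m n.
  exact: bulDr (tri_r f_bal m) _ _ _.
- rewrite (bul_sum_ract (tri_l f_bal p)); apply: eq_bul_sum => m n.
  exact: bul_bal (tri_r f_bal m) _ _ _.
Qed.

Lemma tri_balanced_r :
  bul_balanced (fun m (x : bul N P) => bul_sum x (f m)).
Proof.
split=> [m m' x|m x y|m r x].
- rewrite -bul_sum_add; apply: eq_bul_sum => n p.
  exact: bulDl (tri_l f_bal p) _ _ _.
- exact: bul_sumD (tri_r f_bal m) _ _.
- rewrite (bul_sum_lact (tri_r f_bal m)); apply: eq_bul_sum => n p.
  exact: bul_bal (tri_l f_bal p) _ _ _.
Qed.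

(** Two nested uses of [bul_sumE] reduce to pure tensors. Through this lemma coassociativity becomes
    an identity of iterated sums. *)
Lemma bul_sum_assoc (x : bul M (bul N P)) :
  bul_sum (bulassoc M N P x)
    (fun (y : bul M N) p => bul_sum y (fun m n => f m n p)) =
  bul_sum x (fun m (y : bul N P) => bul_sum y (f m)).
Proof.
set g := fun _ => _.
apply: (bul_sumE (h := fun y => bul_sum (bulassoc M N P y) g)
  tri_balanced_r) => [y z|m y].
  by rewrite linD (bul_sumD tri_balanced_l).
apply: (bul_sumE (h := fun y => bul_sum (bulassoc M N P (bpure m y)) g)
  (tri_r f_bal m)) => [u v|n p].
  by rewrite bpureDr linD (bul_sumD tri_balanced_l).
rewrite bulassocE (bul_sum_pure tri_balanced_l).
exact: bul_sum_pure (tri_l f_bal p) _ _.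
Qed.
End Assoc.

Lemma bul_sum_scale M N (W : lmodType k) c x (f : M -> N -> W) :
  c *: bul_sum x f = bul_sum x (fun m n => c *: f m n).
Proof. exact: (bul_sum_morph f x (scalerDr c)). Qed.

Lemma bul_sumP M N (W : lmodType k) (f : M -> N -> W) c x y :
  bul_balanced f -> (forall m n, f (c *: m) n = c *: f m n) ->
  bul_sum (c *: x + y) f = c *: bul_sum x f + bul_sum y f.
Proof.
move=> f_bal fZ; rewrite bul_sumD // -(@lact_k _ _ _ (bul M N)) bul_sum_lact //.
rewrite bul_sum_scale; congr (_ + _).
by apply: eq_bul_sum => m n; rewrite lact_k fZ.
Qed.

Record circ_balanced M N W (f : M -> N -> W) : Prop := CircBalanced {
  circDl : forall m m' n, f (m + m') n = f m n + f m' n;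
  circDr : forall m n n', f m (n + n') = f m n + f m n';
  circ_lact : forall r m n, f (lact r m) n = f m (lact r n);
  circ_ract : forall m r n, f (ract m r) n = f m (ract n r)
}.

Definition circ_sum M N W (x : circ M N) (f : M -> N -> W) : W :=
  quot_sum f x.

Section CircSum.
Variables (M N : bimod kR) (W : zmodType) (f : M -> N -> W).
Hypothesis f_bal : circ_balanced f.

Let fD : biadditive f := conj (circDl f_bal) (circDr f_bal).
Let fk c m n : f (c *: m) n = f m (c *: n).
Proof. by rewrite -!lact_k circ_lact. Qed.
Let fX c v : circ_rel v -> tens_sum f (c *: v) = 0.
Proof.
move=> [r [m [r' [n ->]]]]; rewrite scalerBr.
rewrite -!(bilinZl (tpure_bilin M N)) -ractZl -lactZr tens_sumB //.
by rewrite !tens_sum_pure // circ_ract // circ_lact // lractA subrr.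
Qed.

Lemma circ_sumD x y : circ_sum (x + y) f = circ_sum x f + circ_sum y f.
Proof. exact: quot_sumD. Qed.

Lemma circ_sum_pure m n : circ_sum (cpure m n) f = f m n.
Proof. by rewrite [LHS]quot_sum_proj // tens_sum_pure. Qed.
End CircSum.

Lemma cpure_lact M N r (m : M) (n : N) : cpure (lact r m) n = cpure m (lact r n).
Proof. by have := cpure_bal r m 1 n; rewrite !ract1. Qed.

Lemma cpure_ract M N (m : M) r (n : N) : cpure (ract m r) n = cpure m (ract n r).
Proof. by have := cpure_bal 1 m r n; rewrite !lact1. Qed.

Lemma cpureDl M N (m m' : M) (n : N) : cpure (m + m') n = cpure m n + cpure m' n.
Proof. exact: bilinDl (cpure_bilin _ _) _ _ _. Qed.

Lemma cpureDr M N (m : M) (n n' : N) : cpure m (n + n') = cpure m n + cpure m n'.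
Proof. exact: bilinDr (cpure_bilin _ _) _ _ _. Qed.
End BulletSum.

(** * Auxiliary bimodules and categories *)

(* [M (x) N] over [k], with [R] acting on [M] from the left and on [N] from the
   right. *)
Section OuterBimodule.
Variables (k R : comPzRingType) (kR : {rmorphism k -> R}) (M N : bimod kR).
Local Notation T := (tensor M N).

Lemma tpureDl (m m' : M) (n : N) : tpure (m + m') n = tpure m n + tpure m' n.
Proof. exact: bilinDl (tpure_bilin M N) _ _ _. Qed.
Lemma tpureDr (m : M) (n n' : N) : tpure m (n + n') = tpure m n + tpure m n'.
Proof. exact: bilinDr (tpure_bilin M N) _ _ _. Qed.

Section Map.
Variables (f : {linear M -> M}) (g : {linear N -> N}).
Lemma tmap_bilin : bilin (fun m n => tpure (f m) (g n) : T).
Proof.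
by split=> *; rewrite linearP; [apply: (tpure_bilin M N).1|
  apply: (tpure_bilin M N).2].
Qed.
Definition tmap : {linear T -> T} := tlift tmap_bilin.
Lemma tmapE m n : tmap (tpure m n) = tpure (f m) (g n).
Proof. exact: tliftE. Qed.
End Map.

Definition outer_lact r (x : T) : T := tmap (lactm M r) (bimap_id N) x.
Definition outer_ract (x : T) r : T := tmap (bimap_id M) (ractm N r) x.
Lemma outer_lactE r m n : outer_lact r (tpure m n) = tpure (lact r m) n.
Proof. exact: tmapE. Qed.
Lemma outer_ractE m n r : outer_ract (tpure m n) r = tpure m (ract n r).
Proof. exact: tmapE. Qed.

Lemma outer_lactDr r x y : outer_lact r (x + y) = outer_lact r x + outer_lact r y.
Proof. exact: linD. Qed.
Lemma outer_ractDl x y r : outer_ract (x + y) r = outer_ract x r + outer_ract y r.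
Proof. exact: linD. Qed.
Lemma outer_lact0 r : outer_lact r 0 = 0. Proof. exact: lin0. Qed.
Lemma outer_ract0 r : outer_ract 0 r = 0. Proof. exact: lin0. Qed.

Lemma outer_lactDl r r' x :
  outer_lact (r + r') x = outer_lact r x + outer_lact r' x.
Proof.
elim/tensor_ind: x => [|x y Hx Hy|m n]; first by rewrite !outer_lact0 addr0.
  by rewrite !outer_lactDr Hx Hy addrACA.
by rewrite !outer_lactE lactDl tpureDl.
Qed.
Lemma outer_lactA r r' x : outer_lact r (outer_lact r' x) = outer_lact (r * r') x.
Proof.
elim/tensor_ind: x => [|x y Hx Hy|m n]; first by rewrite !outer_lact0.
  by rewrite !outer_lactDr Hx Hy.
by rewrite !outer_lactE lactA.
Qed.
Lemma outer_lact1 x : outer_lact 1 x = x.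
Proof.
elim/tensor_ind: x => [|x y Hx Hy|m n]; first by rewrite !outer_lact0.
  by rewrite !outer_lactDr Hx Hy.
by rewrite !outer_lactE lact1.
Qed.
Lemma outer_ractDr x r r' :
  outer_ract x (r + r') = outer_ract x r + outer_ract x r'.
Proof.
elim/tensor_ind: x => [|x y Hx Hy|m n]; first by rewrite !outer_ract0 addr0.
  by rewrite !outer_ractDl Hx Hy addrACA.
by rewrite !outer_ractE ractDr tpureDr.
Qed.
Lemma outer_ractA x r r' : outer_ract (outer_ract x r) r' = outer_ract x (r * r').
Proof.
elim/tensor_ind: x => [|x y Hx Hy|m n]; first by rewrite !outer_ract0.
  by rewrite !outer_ractDl Hx Hy.
by rewrite !outer_ractE ractA.
Qed.
Lemma outer_ract1 x : outer_ract x 1 = x.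
Proof.
elim/tensor_ind: x => [|x y Hx Hy|m n]; first by rewrite !outer_ract0.
  by rewrite !outer_ractDl Hx Hy.
by rewrite !outer_ractE ract1.
Qed.
Lemma outer_lractA r x r' :
  outer_ract (outer_lact r x) r' = outer_lact r (outer_ract x r').
Proof.
elim/tensor_ind: x => [|x y Hx Hy|m n].
  by rewrite !(outer_ract0, outer_lact0).
  by rewrite !(outer_lactDr, outer_ractDl) Hx Hy.
by rewrite !(outer_ractE, outer_lactE).
Qed.
Lemma outer_lact_k c x : outer_lact (kR c) x = c *: x.
Proof.
elim/tensor_ind: x => [|x y Hx Hy|m n]; first by rewrite outer_lact0 scaler0.
  by rewrite outer_lactDr Hx Hy scalerDr.
by rewrite outer_lactE lact_k (bilinZl (tpure_bilin M N)).
Qed.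
Lemma outer_ract_k c x : outer_ract x (kR c) = c *: x.
Proof.
elim/tensor_ind: x => [|x y Hx Hy|m n]; first by rewrite outer_ract0 scaler0.
  by rewrite outer_ractDl Hx Hy scalerDr.
by rewrite outer_ractE ract_k (bilinZr (tpure_bilin M N)).
Qed.

Canonical outer : bimod kR := Bimod outer_lactDl outer_lactDr outer_lactA
  outer_lact1 outer_ractDl outer_ractDr outer_ractA outer_ract1 outer_lractA
  outer_lact_k outer_ract_k.

Lemma lact_tpure r m n : lact (b := outer) r (tpure m n) = tpure (lact r m) n.
Proof. exact: outer_lactE. Qed.
Lemma ract_tpure m n r : ract (b := outer) (tpure m n) r = tpure m (ract n r).
Proof. exact: outer_ractE. Qed.
End OuterBimodule.

Section LeftModule.
Variables (k R : comPzRingType) (kR : {rmorphism k -> R}) (M : bimod kR).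
(** A copy of the carrier, so that the [R]-module structure given by the left action does not clash
    with the [k]-module structure of [M]. It is what the coinvariants of a Hopf module are a
    quotient of. *)
Definition left_module_of : Type := M.
Local Notation L := left_module_of.
HB.instance Definition _ := GRing.Zmodule.copy L M.
Definition left_scale (r : R) (m : L) : L := lact r (m : M).
Fact left_scaleA r r' m : left_scale r (left_scale r' m) = left_scale (r * r') m.
Proof. exact: lactA. Qed.
Fact left_scale1 : left_id 1 left_scale.
Proof. exact: lact1. Qed.
Fact left_scaleDr : right_distributive left_scale +%R.
Proof. exact: (@lactDr _ _ _ M). Qed.
Fact left_scaleDl m : {morph left_scale^~ m : r r' / r + r'}.
Proof. by move=> r r'; apply: (@lactDl _ _ _ M). Qed.
HB.instance Definition _ := GRing.Zmodule_isLmodule.Build R L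
  left_scaleA left_scale1 left_scaleDr left_scaleDl.
Definition left_module : lmodType R := L.
End LeftModule.

(** * Equivalences of categories from full faithfulness and essential surjectivity *)

Section Equivalence.
Variables (C D : category) (F : functor C D).

Definition faithful : Prop :=
  forall x y (f g : hom x y), fmap F f = fmap F g -> f = g.
Definition full : Prop :=
  forall x y (h : hom (F x) (F y)), exists f : hom x y, fmap F f = h.
Definition essentially_surjective : Prop :=
  forall d : D, exists (x : C) (i : hom (F x) d), is_iso i.

Lemma equivalence_ess_surj : is_equivalence F -> essentially_surjective.
Proof. by move=> [G [_ [e e_iso]]] d; exists (G d), (e d); apply: e_iso. Qed.

Section Inverse.
Hypotheses (F_faithful : faithful).
Variables (lift : forall x y, hom (F x) (F y) -> hom x y)
  (liftE : forall x y (h : hom (F x) (F y)), fmap F (lift h) = h)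
  (G : D -> C) (i : forall d, hom (F (G d)) d) (j : forall d, hom d (F (G d)))
  (ij : forall d, compc (i d) (j d) = idc d)
  (ji : forall d, compc (j d) (i d) = idc (F (G d))).

(** The inverse sends a morphism [f] to the lift of its conjugate [j f i]. Functoriality and
    naturality are checked after applying [F], which is faithful. *)
Lemma inverse_equivalence : is_equivalence F.
Proof.
pose Gm d e (f : hom d e) := lift (compc (j e) (compc f (i d))).
have Gm1 d : Gm d d (idc d) = idc (G d).
  by apply: F_faithful; rewrite liftE compc1l ji fmap1.
have GmM d e e' (g : hom e e') (f : hom d e) :
    Gm d e' (compc g f) = compc (Gm e e' g) (Gm d e f).
  apply: F_faithful; rewrite fmapM !liftE !compcA; congr (compc (compc _ f) _).
  by rewrite -!compcA ij compc1r.
pose GF := @Functor D C G Gm Gm1 GmM.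
exists GF; split.
  have nat x y (f : hom x y) : compc (lift (j (F y))) (fmap (id_functor C) f) =
      compc (fmap (comp_functor GF F) f) (lift (j (F x))).
    apply: F_faithful; rewrite !fmapM !liftE -!compcA ij compc1r //.
  exists (@NatTrans _ _ (id_functor C) (comp_functor GF F)
    (fun x => lift (j (F x))) nat) => x.
  by exists (lift (i (F x))); split; apply: F_faithful;
    rewrite !fmapM !liftE fmap1 ?ij ?ji.
have nat d e (f : hom d e) : compc (i e) (fmap (comp_functor F GF) f) =
    compc (fmap (id_functor D) f) (i d).
  by rewrite /= /comp_fmap /= liftE compcA ij compc1l.
exists (@NatTrans _ _ (comp_functor F GF) (id_functor D) i nat) => d.
by exists (j d); split; [exact: ji|exact: ij].
Qed.
End Inverse.

(** A functor is data, whereas fullness and essential surjectivity only assert existence; [cid]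
    selects the lifts, preimages and isomorphisms. *)
Lemma equivalence_of_ff :
  faithful -> full -> essentially_surjective -> is_equivalence F.
Proof.
move=> F1 F2 F3.
pose lift x y (h : hom (F x) (F y)) := projT1 (cid (F2 x y h)).
pose Gs d := cid (F3 d).
pose i d := cid (projT2 (Gs d)).
pose j d := cid (projT2 (i d)).
apply: (inverse_equivalence F1 (lift := lift) _ (G := fun d => projT1 (Gs d))
  (i := fun d => projT1 (i d)) (j := fun d => projT1 (j d))).
- by move=> x y h; rewrite /lift; case: cid.
- by move=> d; case: (projT2 (j d)).
- by move=> d; case: (projT2 (j d)).
Qed.
End Equivalence.

Section Bialgebroid.
Variables (k R : comPzRingType) (kR : {rmorphism k -> R}).
Variable A : bialgebroid kR.
Local Notation Ab := (ra_bim A).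
Local Notation s := (src A).
Local Notation t := (tgt A).
Local Notation "\bul_ ( m , a <- x ) F" := (bul_sum x (fun m (a : A) => F))
  (at level 36, F at level 36, m name, a name, x at level 50) : ring_scope.
Local Notation "\Delta_ ( a , b <- x ) F" :=
  (bul_sum (Delta A x) (fun a b : A => F))
  (at level 36, F at level 36, a name, b name, x at level 50) : ring_scope.

(** * Sweedler sums over a bialgebroid *)

Definition epsR (a : A) : R := eps A a.

Lemma epsD a b : epsR (a + b) = epsR a + epsR b.
Proof. exact: (linD (eps A)). Qed.
Lemma eps_src r a : epsR (s r * a) = r * epsR a.
Proof. exact: (bimapl (eps A)). Qed.
Lemma eps_tgt r a : epsR (t r * a) = r * epsR a.
Proof. exact: (bimapr (eps A) a r). Qed.
Lemma epsRM a b : epsR (a * b) = epsR a * epsR b.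
Proof. exact: epsM. Qed.
Lemma epsR1 : epsR 1 = 1.
Proof. exact: eps1. Qed.

Section Builders.
Variable W : zmodType.

(** Here and in the next three lemmas the actions on [A] are displayed as products with [s r] and
    [t r], to which they are convertible. Balancedness then becomes a computation in the ring [A]
    with central [s r] and [t r]. *)
Lemma bul_balancedA (M : bimod kR) (f : M -> A -> W) :
  (forall m m' a, f (m + m') a = f m a + f m' a) ->
  (forall m a b, f m (a + b) = f m a + f m b) ->
  (forall m r a, f (ract m r) a = f m (s r * a)) ->
  @bul_balanced _ _ _ M Ab W f.
Proof. by []. Qed.

Lemma bul_balancedAA (f : A -> A -> W) :
  (forall a a' b, f (a + a') b = f a b + f a' b) ->
  (forall a b b', f a (b + b') = f a b + f a b') ->
  (forall a r b, f (t r * a) b = f a (s r * b)) ->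
  @bul_balanced _ _ _ Ab Ab W f.
Proof. by []. Qed.

Lemma tri_balancedA (M : bimod kR) (f : M -> A -> A -> W) :
  (forall m m' a b, f (m + m') a b = f m a b + f m' a b) ->
  (forall m a a' b, f m (a + a') b = f m a b + f m a' b) ->
  (forall m a b b', f m a (b + b') = f m a b + f m a b') ->
  (forall m r a b, f (ract m r) a b = f m (s r * a) b) ->
  (forall m a r b, f m (t r * a) b = f m a (s r * b)) ->
  @tri_balanced _ _ _ M Ab Ab W f.
Proof.
by move=> *; split=> [b|m]; [apply: bul_balancedA|apply: bul_balancedAA].
Qed.

Lemma tri_balancedAA (f : A -> A -> A -> W) :
  (forall a a' b c, f (a + a') b c = f a b c + f a' b c) ->
  (forall a b b' c, f a (b + b') c = f a b c + f a b' c) ->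
  (forall a b c c', f a b (c + c') = f a b c + f a b c') ->
  (forall a r b c, f (t r * a) b c = f a (s r * b) c) ->
  (forall a b r c, f a (t r * b) c = f a b (s r * c)) ->
  @tri_balanced _ _ _ Ab Ab Ab W f.
Proof. by move=> *; apply: tri_balancedA. Qed.
End Builders.

Section Coaction.
Variables (Q : bimod kR) (rho : bimap Q (bul Q Ab)).
Hypothesis rhoP : is_coaction rho.
Variable W : zmodType.

Lemma coaction_assoc (f : Q -> A -> A -> W) :
  @tri_balanced _ _ _ Q Ab Ab W f -> forall q,
  \bul_(p, c <- rho q) \bul_(m, b <- rho p) f m b c =
  \bul_(m, a <- rho q) \Delta_(b, c <- a) f m b c.
Proof.
(* Both sides of coassociativity lie in [(Q . A) . A]; the threefold sum of [f] is applied to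
   them. *)
move=> fP q; have := congr1 (fun y => @bul_sum _ _ _ (bul Q Ab) Ab _ y
  (fun (y : bul Q Ab) (p : Ab) => @bul_sum _ _ _ Q Ab _ y
    (fun m n => f m n p))) (rhoP.1 q).
rewrite (bul_sum_map (tri_balanced_l fP)) (bul_sum_assoc fP).
by rewrite (bul_sum_map (tri_balanced_r fP)).
Qed.

Lemma coaction_counit q : \bul_(p, a <- rho q) ract p (epsR a) = q.
Proof.
rewrite -[RHS](rhoP.2 q); symmetry.
apply: (bul_sumE (h := counitr (eps A) Q) _) => [|y z|m a]; last exact: counitrE.
  apply: bul_balancedA => *.
  - exact: ractDl.
  - by rewrite epsD ractDr.
  - by rewrite eps_src ractA.
exact: linD.
Qed.

Section Sums.
Variable f : Q -> A -> W.
Hypothesis fP : @bul_balanced _ _ _ Q Ab W f.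

Lemma coaction_sumD q q' : \bul_(p, a <- rho (q + q')) f p a =
  \bul_(p, a <- rho q) f p a + \bul_(p, a <- rho q') f p a.
Proof. by rewrite linD (bul_sumD fP). Qed.
Lemma coaction_sum_lact r q : \bul_(p, a <- rho (lact r q)) f p a =
  \bul_(p, a <- rho q) f (lact r p) a.
Proof. by rewrite bimapl (bul_sum_lact fP). Qed.
Lemma coaction_sum_ract q r : \bul_(p, a <- rho (ract q r)) f p a =
  \bul_(p, a <- rho q) f p (t r * a).
Proof. by rewrite bimapr (bul_sum_ract fP). Qed.
End Sums.
End Coaction.

(** [A] is a comodule over itself, so the lemmas on coactions apply to sums over [Delta]. *)
Lemma Delta_coaction : is_coaction (Delta A).
Proof. by split=> a; [exact: Delta_coassoc|exact: Delta_counitr]. Qed.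

Lemma Delta_sum_counitr a : \Delta_(b, c <- a) (t (epsR c) * b) = a.
Proof. exact: (coaction_counit Delta_coaction a). Qed.

Lemma Delta_sum_counitl a : \Delta_(b, c <- a) (s (epsR b) * c) = a.
Proof.
rewrite -[RHS](Delta_counitl a); symmetry.
apply: (bul_sumE (h := counitl (eps A) Ab) _) => [|y z|m b]; last exact: counitlE.
  apply: bul_balancedAA => *.
  - by rewrite epsD rmorphD mulrDl.
  - by rewrite mulrDr.
  - by rewrite eps_tgt mulrC rmorphM mulrA.
exact: linD.
Qed.

Section DeltaSums.
Variables (W : zmodType) (f : A -> A -> W).
Hypothesis fP : @bul_balanced _ _ _ Ab Ab W f.

Lemma Delta_sumD x y : \Delta_(a, b <- (x + y : Ab)) f a b =
  \Delta_(a, b <- x) f a b + \Delta_(a, b <- y) f a b.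
Proof. exact: coaction_sumD fP _ _. Qed.
Lemma Delta_sum_src r x : \Delta_(a, b <- (s r * x)) f a b =
  \Delta_(a, b <- x) f (s r * a) b.
Proof. exact: coaction_sum_lact fP _ _. Qed.
Lemma Delta_sum_tgt r x : \Delta_(a, b <- (t r * x)) f a b =
  \Delta_(a, b <- x) f a (t r * b).
Proof. exact: coaction_sum_ract fP _ _. Qed.
Lemma Delta_sum1 : \Delta_(a, b <- 1) f a b = f 1 1.
Proof. by rewrite Delta1 (bul_sum_pure fP). Qed.
End DeltaSums.

Section Factorwise.
Variables (M : rmodule A) (W : zmodType) (f : M -> A -> W).
Hypothesis fP : @bul_balanced _ _ _ M Ab W f.

(** Centrality of the values of [s] and [t] makes the factorwise product respect the balancing
    relation. *)
Lemma bul_balanced_fact1 m b :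
  @bul_balanced _ _ _ Ab Ab W (fun c d : A => f (rm_act m c) (b * d)).
Proof.
apply: bul_balancedAA => [c c' d|c d d'|c r d].
- by rewrite rm_actDr (bulDl fP).
- by rewrite mulrDr; apply: (bulDr fP).
- rewrite tgtC -rm_actA rm_act_tgt (bul_bal fP); congr f.
  by rewrite -[lact _ _]/(s r * (b * d)) mulrA srcC mulrA.
Qed.

Lemma bul_balanced_fact (y : bul Ab Ab) : @bul_balanced _ _ _ M Ab W
  (fun m (b : A) => bul_sum y (fun c d : A => f (rm_act m c) (b * d))).
Proof.
apply: bul_balancedA => [m m' b|m b b'|m r b].
- rewrite -bul_sum_add; apply: eq_bul_sum => c d.
  by rewrite rm_actDl (bulDl fP).
- rewrite -bul_sum_add; apply: eq_bul_sum => c d.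
  by rewrite mulrDl; apply: (bulDr fP).
- apply: eq_bul_sum => c d.
  rewrite -rm_act_tgt rm_actA tgtC -rm_actA rm_act_tgt (bul_bal fP); congr f.
  by rewrite -[lact _ _]/(s r * (b * d)) mulrA.
Qed.

(** By additivity in [x] and then in [y] it is enough to treat pure tensors. Multiplicativity of
    [Delta] and the Hopf module condition are used through this identity. *)
Lemma bul_sum_fact x (y : bul Ab Ab) : \bul_(m, a <- bul_fact x y) f m a =
  \bul_(m, b <- x) bul_sum y (fun c d : A => f (rm_act m c) (b * d)).
Proof.
apply: (bul_sumE (h := fun x => bul_sum (bul_fact x y) f) (bul_balanced_fact y))
  => [x1 x2|m b].
  by rewrite bul_factDl (bul_sumD fP).
apply: (bul_sumE (h := fun y => bul_sum (bul_fact (bpure m b) y) f)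
  (bul_balanced_fact1 m b)) => [y1 y2|c d].
  by rewrite bul_factDr (bul_sumD fP).
by rewrite bul_factE (bul_sum_pure fP).
Qed.
End Factorwise.

Lemma Delta_sumM (W : zmodType) (f : A -> A -> W) (x y : A) :
  @bul_balanced _ _ _ Ab Ab W f ->
  \Delta_(a, b <- x * y) f a b =
  \Delta_(a, b <- x) \Delta_(c, d <- y) f (a * c) (b * d).
Proof.
by move=> fP; rewrite DeltaM [LHS](@bul_sum_fact (ra_rmod A) _ _ fP).
Qed.

Lemma hopf_sum_act (M : hopf_module A) (W : zmodType) (f : M -> A -> W)
    (m : M) (x : A) : @bul_balanced _ _ _ M Ab W f ->
  \bul_(p, a <- hm_rho M (rm_act m x)) f p a =
  \bul_(p, a <- hm_rho M m) \Delta_(b, c <- x) f (rm_act p b) (a * c).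
Proof. by move=> fP; rewrite hm_compat bul_sum_fact. Qed.

(** * The comodule M (x) A *)

Section OuterComodule.

Variable M : bimod kR.
Local Notation T := (outer M Ab).

Lemma outer_pure_balanced m :
  @bul_balanced _ _ _ Ab Ab _ (fun a b => bpure (tpure m a : T) b).
Proof.
apply: bul_balancedAA => *.
- by rewrite tpureDr bpureDl.
- exact: bpureDr.
- by rewrite -[LHS](congr1 (fun y => bpure y _) (ract_tpure _ _ _)) bpure_bal.
Qed.

(** The coaction [M (x) Delta], followed by the map from [M (x) (A . A)] to [(M (x) A) . A]. *)
Definition outer_rho_fun (m : M) (a : Ab) : bul T Ab :=
  \Delta_(b, c <- a) bpure (tpure m (b : Ab) : T) (c : Ab).

Lemma outer_rho_bilin : bilin outer_rho_fun.
Proof.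
split=> [c m m' a|c m a a']; rewrite /outer_rho_fun.
  rewrite bul_sum_scale -bul_sum_add; apply: eq_bul_sum => b d.
  by rewrite (tpure_bilin M Ab).1 (bpure_bilin T Ab).1.
rewrite linearP; apply: bul_sumP => [|b d]; first exact: outer_pure_balanced.
by rewrite (bilinZr (tpure_bilin M Ab)) bpureZl.
Qed.

Definition outer_rho_lin : {linear T -> bul T Ab} := tlift outer_rho_bilin.
Lemma outer_rho_linE m a : outer_rho_lin (tpure m a) =
  \Delta_(b, c <- a) bpure (tpure m (b : Ab) : T) (c : Ab).
Proof. exact: tliftE. Qed.

Lemma outer_rhol r x : outer_rho_lin (lact r x) = lact r (outer_rho_lin x).
Proof.
elim/tensor_ind: x => [|x y Hx Hy|m a]; first by rewrite !(lact0, lin0).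
  by rewrite !(lactDr, linD) Hx Hy.
rewrite lact_tpure !outer_rho_linE lact_bul_sum.
by apply: eq_bul_sum => b c; rewrite lact_bpure lact_tpure.
Qed.
Lemma outer_rhor x r : outer_rho_lin (ract x r) = ract (outer_rho_lin x) r.
Proof.
elim/tensor_ind: x => [|x y Hx Hy|m a]; first by rewrite !(ract0, lin0).
  by rewrite !(ractDl, linD) Hx Hy.
rewrite ract_tpure !outer_rho_linE ract_bul_sum bimapr.
rewrite (bul_sum_ract (outer_pure_balanced m)).
by apply: eq_bul_sum => b c; rewrite ract_bpure.
Qed.
Definition outer_rho : bimap T (bul T Ab) := Bimap outer_rhol outer_rhor.
Lemma outer_rhoE m a : outer_rho (tpure m a) =
  \Delta_(b, c <- a) bpure (tpure m (b : Ab) : T) (c : Ab).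
Proof. exact: tliftE. Qed.

Lemma outer_tri_balanced m : @tri_balanced _ _ _ Ab Ab Ab _
  (fun a b c => bpure (bpure (tpure m a : T) b : bul T Ab) c).
Proof.
have [l r] := bpure3_balanced T Ab Ab; split=> a; last exact: r.
split=> *.
- by rewrite tpureDr (bulDl (l _)).
- exact: (bulDr (l _)).
- rewrite -(bul_bal (l _)); congr (bpure (bpure _ _) _).
  by rewrite ract_tpure.
Qed.

Lemma outer_coaction : is_coaction outer_rho.
Proof.
split=> x.
  elim/tensor_ind: x => [|x y Hx Hy|m a]; first by rewrite !lin0.
    by rewrite !(linD (bimap_lin _)) !(linD (bulassoc _ _ _)) Hx Hy.
  rewrite outer_rhoE 2!(linear_bul_sum (bulmap _ _)).
  rewrite (linear_bul_sum (bulassoc _ _ _)).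
  transitivity (\Delta_(b, c <- a) \Delta_(d, e <- b)
    bpure (bpure (tpure m (d : Ab) : T) (e : Ab) : bul T Ab) (c : Ab)).
    apply: eq_bul_sum => b c; rewrite bulmapE.
    by rewrite -bpure_suml -outer_rhoE.
  rewrite (coaction_assoc (Delta_coaction) (outer_tri_balanced m)).
  apply: eq_bul_sum => b c; rewrite bulmapE -[bimap_id _ _]/(tpure m b).
  rewrite -[Delta A c in RHS]bul_sum_id bpure_sumr linear_bul_sum.
  by apply: eq_bul_sum => d e; rewrite bulassocE.
elim/tensor_ind: x => [|x y Hx Hy|m a]; first by rewrite !lin0.
  by rewrite !(linD (bimap_lin _)) (linD (counitr _ _)) Hx Hy.
rewrite outer_rhoE linear_bul_sum -[in RHS](Delta_sum_counitr a).
transitivity (\Delta_(b, c <- a) (tpure m (t (epsR c) * b : Ab) : T)).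
  by apply: eq_bul_sum => b c; rewrite counitrE ract_tpure.
by symmetry; apply: bul_sum_morph; apply: (@tpureDr _ _ _ M Ab).
Qed.

Definition outer_comodule : comodule A := Comodule outer_coaction.
End OuterComodule.

(** * From varsigma to the antipode *)

Section Varsigma.

Variable Q : comodule A.

Lemma varsigma_pure (q : Q) (a : A) : varsigma_Q Q (cpure q (a : Ab)) =
  \bul_(p, b <- cm_rho Q q) bpure (cq_class Q p : cq Q) (b * a : Ab).
Proof.
rewrite varsigma_QE -{1}[cm_rho Q q]bul_sum_id.
rewrite (linear_bul_sum (bulmap _ _)) (linear_bul_sum (bul_mulr _ _)).
by apply: eq_bul_sum => p b; rewrite bulmapE bul_mulrE.
Qed.

Definition circ_mulr (b : A) : {linear circ Q Ab -> circ Q Ab} :=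
  circmap (bimap_id Q) (rmulm b).
Lemma circ_mulrE b (q : Q) (a : A) :
  circ_mulr b (cpure q (a : Ab)) = cpure q (a * b : Ab).
Proof. exact: circmapE. Qed.

(** The argument [a] occurs in [[q0] . q1 a] only as the last factor. The inverse of [varsigma] is
    then right [A]-linear as well. *)
Lemma varsigma_mulr b z :
  varsigma_Q Q (circ_mulr b z) = bul_mulr b (cq Q) (varsigma_Q Q z).
Proof.
elim/circ_ind: z => [|x y Hx Hy|q a]; first by rewrite !lin0.
  by rewrite !linD Hx Hy.
rewrite circ_mulrE !varsigma_pure (linear_bul_sum (bul_mulr _ _)).
by apply: eq_bul_sum => p c; rewrite bul_mulrE mulrA.
Qed.
End Varsigma.

Section AntipodeOfVarsigma.

Local Notation Q := (outer_comodule (Rbim kR)).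
Local Notation T := (outer (Rbim kR) Ab).
Local Notation "x #t a" := (tpure (x : Rbim kR) (a : Ab) : T) (at level 40).
Local Notation vs := (varsigma_Q Q).

Section Evaluation.
Variables (w : A -> A) (c : R -> A).
Hypotheses (wD : {morph w : a b / a + b})
  (w_tgt : forall r a, w (t r * a) = c r * w a)
  (c_k : forall x, c (kR x) = ra_k A x).

Lemma outer_eval_bilin :
  bilin (fun (x : Rbim kR) (a : Ab) => (s (x : R) * w a : Ab)).
Proof.
split=> [b x x' a|b x a a'].
  change (s (kR b * (x : R) + (x' : R)) * w a =
    ra_k A b * (s (x : R) * w a) + s (x' : R) * w a).
  by rewrite rmorphD rmorphM src_k mulrDl mulrA.
change (s (x : R) * w (ra_k A b * (a : A) + (a' : A)) =
  ra_k A b * (s (x : R) * w a) + s (x : R) * w a').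
by rewrite wD -tgt_k w_tgt c_k mulrDr !mulrA tgt_k ra_kC.
Qed.
(** The parameter [c] tells what the right action of [R] turns into: [t] for evaluations on [Q o A],
    [s] for evaluations on [Q / [Q, R] . A]. *)
Definition outer_eval : {linear T -> Ab} := tlift outer_eval_bilin.
Lemma outer_evalE x a : outer_eval (x #t a) = s (x : R) * w a.
Proof. exact: tliftE. Qed.

Lemma outer_eval_lact r q : outer_eval (lact r q) = s r * (outer_eval q : A).
Proof.
elim/tensor_ind: q => [|x y Hx Hy|x a].
- by rewrite lact0 !lin0 mulr0.
- rewrite lactDr !linD Hx Hy; symmetry; exact: (@mulrDr A).
- rewrite lact_tpure !outer_evalE mulrA -rmorphM //.
Qed.
Lemma outer_eval_ract r q : outer_eval (ract q r) = c r * (outer_eval q : A).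
Proof.
elim/tensor_ind: q => [|x y Hx Hy|x a].
- by rewrite ract0 !lin0 mulr0.
- rewrite ractDl !linD Hx Hy; symmetry; exact: (@mulrDr A).
- by rewrite ract_tpure !outer_evalE w_tgt mulrA srcC mulrA.
Qed.
End Evaluation.

Section CircEvaluation.
Variable w : A -> A.
Hypotheses (wD : {morph w : a b / a + b})
  (w_tgt : forall r a, w (t r * a) = t r * w a).
Local Notation u := (outer_eval wD w_tgt (tgt_k A)).

Lemma circ_eval_balanced :
  @circ_balanced _ _ _ T Ab A (fun q (b : A) => (u q : A) * b).
Proof.
split=> [q q' b|q b b'|r q b|q r b].
- by rewrite linD; apply: (@mulrDl A).
- exact: (@mulrDr A).
- by rewrite outer_eval_lact srcC -mulrA.
- by rewrite outer_eval_ract tgtC -mulrA.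
Qed.
Definition circ_eval (z : circ T Ab) : A :=
  circ_sum z (fun q (b : A) => (u q : A) * b).
Lemma circ_evalD y z : circ_eval (y + z) = circ_eval y + circ_eval z.
Proof. exact: circ_sumD circ_eval_balanced _ _. Qed.
Lemma circ_eval_pure q b : circ_eval (cpure q (b : Ab)) = (u q : A) * b.
Proof. exact: circ_sum_pure circ_eval_balanced _ _. Qed.
Lemma circ_evalE x a b :
  circ_eval (cpure (x #t a) (b : Ab)) = s (x : R) * w a * b.
Proof. by rewrite circ_eval_pure outer_evalE. Qed.
Lemma circ_eval0 : circ_eval 0 = 0.
Proof. by apply: (addrI (circ_eval 0)); rewrite -circ_evalD !addr0. Qed.
End CircEvaluation.

(* Functionals on [cq T . A] are compared by composing them with the surjective
   [varsigma_Q]. *)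
Section BulEvaluation.
Variable w : A -> A.
Hypotheses (wD : {morph w : a b / a + b})
  (w_tgt : forall r a, w (t r * a) = s r * w a).
Local Notation u := (outer_eval wD w_tgt (src_k A)).

(** With [c] equal to [s], both actions of [r] turn into multiplication by [s r], so commutators are
    killed. *)
Lemma cq_eval_rel v : comm_rel v -> u v = 0.
Proof.
move=> [q [r ->]].
by rewrite linB outer_eval_ract outer_eval_lact subrr.
Qed.
Definition cq_eval : {linear cq T -> Ab} := qlift cq_eval_rel.
Lemma cq_evalE q : cq_eval (cq_class T q) = u q.
Proof. exact: qliftE. Qed.

Lemma bul_eval_balanced :
  @bul_balanced _ _ _ (cq T) Ab A (fun p (b : A) => (cq_eval p : A) * b).
Proof.
apply: bul_balancedA => [p p' b|p b b'|p r b].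
- by rewrite linD; apply: (@mulrDl A).
- exact: (@mulrDr A).
- have [q ->] := cq_surj p; rewrite /= cq_ractE !cq_evalE outer_eval_ract.
  by rewrite srcC -mulrA.
Qed.
Definition bul_eval (y : bul (cq T) Ab) : A :=
  \bul_(p, b <- y) ((cq_eval p : A) * b).
Lemma bul_evalD y z : bul_eval (y + z) = bul_eval y + bul_eval z.
Proof. exact: bul_sumD bul_eval_balanced _ _. Qed.
Lemma bul_evalE x a b :
  bul_eval (bpure (cq_class T (x #t a) : cq T) (b : Ab)) = s (x : R) * w a * b.
Proof. by rewrite [LHS](bul_sum_pure bul_eval_balanced) cq_evalE outer_evalE. Qed.
End BulEvaluation.

Lemma varsigma_outer x a b : vs (cpure (x #t a) (b : Ab)) =
  \Delta_(c, d <- a) bpure (cq_class T (x #t c) : cq T) (d * b : Ab).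
Proof.
have fP : @bul_balanced _ _ _ T Ab _
    (fun p (d : A) => bpure (cq_class T p : cq T) (d * b : Ab)).
  apply: bul_balancedA => [p p' d|p d d'|p r d].
  - by rewrite linD; apply: bpureDl.
  - by rewrite mulrDl; apply: bpureDr.
  - rewrite -mulrA -[s r * _]/(lact r (d * b : Ab)) -bpure_bal.
    by rewrite [in RHS]/= cq_ractE.
rewrite varsigma_pure [cm_rho _ _]outer_rhoE (bul_sum_bul _ _ fP).
by apply: eq_bul_sum => c d; rewrite (bul_sum_pure fP).
Qed.

(** Evaluation after [varsigma] yields the convolution of [w] with the identity, so functionals on
    the target are compared through convolution products. *)
Lemma bul_eval_varsigma w (wD : {morph w : a b / a + b})
    (w_tgt : forall r a, w (t r * a) = s r * w a) x a b :
  bul_eval wD w_tgt (vs (cpure (x #t a) (b : Ab))) =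
  s (x : R) * (\Delta_(c, d <- a) (w c * d)) * b.
Proof.
rewrite varsigma_outer (bul_sum_morph _ _ (bul_evalD wD w_tgt)).
rewrite bul_sum_mull bul_sum_mulr; apply: eq_bul_sum => c d.
by rewrite bul_evalE !mulrA.
Qed.

Section Antipode.
Variable g : {linear bul_mod (cq Q) Ab -> circ Q Ab}.
Hypotheses (gK : forall z, g (vs z) = z) (Kg : forall y, vs (g y) = y).

Let teD : {morph (fun a : A => t (epsR a)) : a b / a + b}.
Proof. by move=> a b; rewrite epsD rmorphD. Qed.
Let te_tgt r a : t (epsR (t r * a)) = t r * t (epsR a).
Proof. by rewrite eps_tgt rmorphM. Qed.
Let seD : {morph (fun a : A => s (epsR a)) : a b / a + b}.
Proof. by move=> a b; rewrite epsD rmorphD. Qed.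
Let se_tgt r a : s (epsR (t r * a)) = s r * s (epsR a).
Proof. by rewrite eps_tgt rmorphM. Qed.

Definition varsigma_antipode (a : A) : A := circ_eval teD te_tgt
  (g (bpure (cq_class T ((1 : R) #t a) : cq T) ((1 : A) : Ab))).
Local Notation S := varsigma_antipode.

Lemma g_mulr b y : g (bul_mulr b (cq Q) y) = circ_mulr Q b (g y).
Proof. by rewrite -{1}[y]Kg -varsigma_mulr gK. Qed.

Local Notation E := (circ_eval teD te_tgt).
Local Notation y1 a := (bpure (cq_class T ((1 : R) #t a) : cq T) ((1 : A) : Ab)).

Lemma circ_eval_mulr b (z : circ T Ab) : E (circ_mulr Q b z) = E z * b.
Proof.
elim/circ_ind: z => [|x y Hx Hy|q a].
- by rewrite lin0 circ_eval0 mul0r.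
- by rewrite linD !circ_evalD mulrDl Hx Hy.
- by rewrite circ_mulrE !circ_eval_pure mulrA.
Qed.

Lemma antipodeD : {morph S : a b / a + b}.
Proof.
move=> a b; rewrite /varsigma_antipode.
by rewrite (@tpureDr _ _ _ (Rbim kR) Ab) linD bpureDl linD circ_evalD.
Qed.

(** In [[1 (x) t(r) a] . 1] the factor [t r] is the right action of [r]; it crosses the bullet and
    becomes right multiplication by [s r], with which [g] and the evaluation commute. *)
Lemma antipode_tgt r a : S (t r * a) = S a * s r.
Proof.
rewrite /varsigma_antipode -circ_eval_mulr -g_mulr; congr (E (g _)).
rewrite bul_mulrE mul1r.
rewrite -[t r * a]/(ract (a : Ab) r) -(ract_tpure (M := Rbim kR)).
rewrite -cq_ractE -[cq_ract _ r]/(ract (b := cq T) _ r) bpure_bal.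
by congr bpure; apply: mulr1.
Qed.

(** The element [(1 (x) a) o 1] is evaluated directly, and again after being written as [g] of its
    image [[1 (x) a1] . a2]. *)
Lemma antipode_mull a : \Delta_(b, c <- a) (S b * c) = t (epsR a).
Proof.
have <- : E (cpure ((1 : R) #t a) (1 : Ab)) = t (epsR a).
  by rewrite circ_evalE rmorph1 mul1r mulr1.
rewrite -[cpure _ _]gK varsigma_outer (linear_bul_sum g).
rewrite (bul_sum_morph _ _ (circ_evalD teD te_tgt)); apply: eq_bul_sum => b c.
rewrite /varsigma_antipode -circ_eval_mulr -g_mulr; congr (E (g _)).
by rewrite bul_mulrE mul1r mulr1.
Qed.

Section SourceMap.
Variable r : R.
(** Multiplication by [s r] on the factor [A] is not part of the bimodule structure of [R (x) A],
    but it is an endomorphism of that comodule because [Delta] is left [R]-linear. *)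
Definition outer_src : {linear T -> T} := tmap (bimap_id (Rbim kR)) (lactm Ab r).
Lemma outer_srcE x a : outer_src (x #t a) = x #t (s r * a).
Proof. exact: tmapE. Qed.
Lemma outer_srcl r' q : outer_src (lact r' q) = lact r' (outer_src q).
Proof.
elim/tensor_ind: q => [|x y Hx Hy|x a]; first by rewrite !(lact0, lin0).
  by rewrite !(lactDr, linD) Hx Hy.
by rewrite lact_tpure !outer_srcE lact_tpure.
Qed.
Lemma outer_srcr q r' : outer_src (ract q r') = ract (outer_src q) r'.
Proof.
elim/tensor_ind: q => [|x y Hx Hy|x a]; first by rewrite !(ract0, lin0).
  by rewrite !(ractDl, linD) Hx Hy.
rewrite ract_tpure !outer_srcE ract_tpure.
by congr tpure; symmetry; apply: (lractA r (a : Ab) r').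
Qed.
Definition outer_src_bimap : bimap T T := Bimap outer_srcl outer_srcr.

Lemma outer_src_rho q : bulmap outer_src_bimap (bimap_id Ab) (cm_rho Q q) =
  cm_rho Q (outer_src_bimap q).
Proof.
elim/tensor_ind: q => [|x y Hx Hy|x a]; first by rewrite !lin0.
  by rewrite !(linD (bimap_lin _)) Hx Hy.
rewrite [outer_src_bimap _]outer_srcE ![cm_rho _ _]outer_rhoE.
rewrite (linear_bul_sum (bulmap _ _)).
rewrite (Delta_sum_src (outer_pure_balanced (x : Rbim kR))).
by apply: eq_bul_sum => b c; rewrite bulmapE [outer_src_bimap _]outer_srcE.
Qed.
Definition outer_src_map : comodule_map Q Q :=
  @ComoduleMap _ _ _ A Q Q outer_src_bimap outer_src_rho.
End SourceMap.

(** The scalar [r] comes out of [eps (s r * a)], and the evaluation then applies [t] to it. *)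
Lemma circ_eval_src r (z : circ T Ab) :
  E (circmap (outer_src_map r) (bimap_id Ab) z) = t r * E z.
Proof.
elim/circ_ind: z => [|x y Hx Hy|q a].
- by rewrite lin0 circ_eval0 mulr0.
- by rewrite linD !circ_evalD mulrDr Hx Hy.
rewrite circmapE !circ_eval_pure mulrA; congr (_ * _).
elim/tensor_ind: q => [|x y Hx Hy|x b].
- by rewrite !lin0 mulr0.
- rewrite !linD Hx Hy; symmetry; exact: (@mulrDr A).
- rewrite -[LHS]/(outer_eval teD te_tgt (tgt_k A) (outer_src r _)).
  by rewrite outer_srcE !outer_evalE eps_src rmorphM !mulrA srcC.
Qed.

(** Naturality of [varsigma] at the endomorphism [outer_src_map r] lets it pass through the inverse
    [g]; the evaluation turns it into [t r]. *)
Lemma antipode_src r a : S (s r * a) = t r * S a.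
Proof.
rewrite /varsigma_antipode -circ_eval_src; congr E.
rewrite -[RHS]gK; congr (g _).
have := congr1 (fun h : {linear circ Q Ab -> bul_mod (cq Q) Ab} => h (g (y1 a)))
  (ntc_nat (varsigma A) (outer_src_map r)).
rewrite -[LHS]/(vs (circmap _ _ (g _))) => ->.
rewrite -[RHS]/(bulmap (cqmap (outer_src_map r)) (bimap_id Ab) (vs (g _))).
by rewrite Kg bulmapE cqmapE -outer_srcE.
Qed.

Let convS (a : A) : A := \Delta_(b, c <- a) (b * S c).

Lemma mulS_balanced :
  @bul_balanced _ _ _ Ab Ab A (fun b c : A => b * S c).
Proof.
apply: bul_balancedAA => [a a' b|a b b'|a r b].
- exact: mulrDl.
- by rewrite antipodeD mulrDr.
- by rewrite antipode_src mulrA tgtC.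
Qed.

Let convSD : {morph convS : a b / a + b}.
Proof. by move=> a b; apply: Delta_sumD mulS_balanced _ _. Qed.

Let convS_tgt r a : convS (t r * a) = s r * convS a.
Proof.
rewrite /convS (Delta_sum_tgt mulS_balanced) srcC bul_sum_mulr.
by apply: eq_bul_sum => b c; rewrite antipode_tgt mulrA.
Qed.

(** After composition with [varsigma] the two functionals become the convolutions of [convS] and of
    [s eps] with the identity. The second is the identity by the counit law. So is the first: by
    associativity [a1 S(a2) a3] equals [a1 t(eps(a2))]. *)
Lemma bul_eval_conv y : bul_eval convSD convS_tgt y = bul_eval seD se_tgt y.
Proof.
rewrite -[y]Kg; elim/circ_ind: (g y) => [|u v Hu Hv|q d].
- by rewrite lin0 /bul_eval !(bul_sum0 (bul_eval_balanced _ _)).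
- by rewrite linD !bul_evalD Hu Hv.
elim/tensor_ind: q => [|u v Hu Hv|x a].
- rewrite (bilin0l (cpure_bilin T Ab)) lin0.
  by rewrite /bul_eval !(bul_sum0 (bul_eval_balanced _ _)).
- by rewrite (cpureDl (u : T)) linD !bul_evalD Hu Hv.
rewrite !bul_eval_varsigma Delta_sum_counitl; congr (_ * _ * _).
rewrite -[RHS]Delta_sum_counitr.
transitivity (\Delta_(b, c <- a) \Delta_(d, e <- b) (d * S e * c)).
  by apply: eq_bul_sum => b c; rewrite bul_sum_mulr.
rewrite (coaction_assoc (Delta_coaction) (f := fun d e c : A => d * S e * c)).
  apply: eq_bul_sum => b c; rewrite tgtC -antipode_mull bul_sum_mull.
  by apply: eq_bul_sum => e f; rewrite mulrA.
apply: tri_balancedAA => [b b' e c|b e e' c|b e c c'|b r e c|b e r c].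
- by rewrite !mulrDl.
- by rewrite antipodeD mulrDr mulrDl.
- by rewrite mulrDr.
- by rewrite antipode_src !mulrA tgtC.
- by rewrite antipode_tgt !mulrA.
Qed.

Lemma antipode_mulr a : \Delta_(b, c <- a) (b * S c) = s (epsR a).
Proof.
have := bul_eval_conv (y1 a).
by rewrite !bul_evalE rmorph1 !mul1r !mulr1.
Qed.

Lemma antipode_lin c : {morph (S : Ab -> Ab) : a b / c *: a + b}.
Proof.
move=> a b; rewrite -[S (c *: a + b)]/(S (ra_k A c * (a : A) + (b : A))).
rewrite antipodeD -src_k antipode_src; congr (_ + _).
by rewrite tgt_k.
Qed.

Lemma hopf_of_varsigma_inverse : is_hopf_algebroid A.
Proof.
exists (mklin antipode_lin).
have S_s (a : A) r : mklin antipode_lin (a * s r) = t r * S a.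
  by rewrite -srcC; apply: antipode_src.
have S_t (a : A) r : mklin antipode_lin (t r * a) = S a * s r.
  exact: antipode_tgt.
exists S_s S_t => a.
  rewrite -antipode_mulr.
  apply: (bul_sumE (h := mulS S_s) mulS_balanced) => [x y|b c].
    exact: (linD (mulS S_s)).
  exact: mulSE.
rewrite -antipode_mull; apply: (bul_sumE (h := Smul S_t) _) => [|x y|b c].
- apply: bul_balancedAA => *.
  + by rewrite antipodeD mulrDl.
  + by rewrite mulrDr.
  + by rewrite antipode_tgt mulrA.
- exact: (linD (Smul S_t)).
- exact: SmulE.
Qed.
End Antipode.

Lemma hopf_of_varsigma : is_nat_iso (varsigma A) -> is_hopf_algebroid A.
Proof.
move=> /(_ Q) [g [gK Kg]]; apply: (@hopf_of_varsigma_inverse g).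
  move=> z; exact: (congr1 (fun h : {linear circ Q Ab -> circ Q Ab} => h z) gK).
move=> y.
exact: (congr1
  (fun h : {linear bul_mod (cq Q) Ab -> bul_mod (cq Q) Ab} => h y) Kg).
Qed.
End AntipodeOfVarsigma.

(** * The comparison functor is fully faithful *)

Section Counit.
Variable M : bimod kR.
Local Notation ceps := (counitr (eps A) M).

Lemma counitr_lact r x : ceps (lact r x) = lact r (ceps x).
Proof.
elim/bul_ind: x => [|x y Hx Hy|m a]; first by rewrite !(lact0, lin0).
  by rewrite !(lactDr, linD) Hx Hy.
by rewrite lact_bpure !counitrE lractA.
Qed.
Lemma counitr_ract x r : ceps (ract x r) = ract (ceps x) r.
Proof.
elim/bul_ind: x => [|x y Hx Hy|m a]; first by rewrite !(ract0, lin0).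
  by rewrite !(ractDl, linD) Hx Hy.
rewrite ract_bpure !counitrE ractA; congr (ract _ _).
by rewrite mulrC; apply: (eps_tgt r (a : A)).
Qed.
Definition counitr_bimap : bimap (bul M Ab) M := Bimap counitr_lact counitr_ract.

Lemma counitr_mulr x (a : A) : ceps (bul_mulr a M x) = ract (ceps x) (epsR a).
Proof.
elim/bul_ind: x => [|x y Hx Hy|m b]; first by rewrite !(ract0, lin0).
  by rewrite !(ractDl, linD) Hx Hy.
by rewrite bul_mulrE !counitrE ractA; congr (ract _ _); apply: epsRM.
Qed.

Lemma counitr_pure m (a : A) : ceps (bpure m (a : Ab)) = ract m (epsR a).
Proof. exact: counitrE. Qed.
End Counit.

Section Cofree.
Variable N : lmodType R.
Local Notation Nb := (symbim kR N).
Local Notation K := (cmp_hopf A N).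

Lemma cmp_rho_pure (n : Nb) (a : A) : hm_rho K (bpure n (a : Ab)) =
  \Delta_(b, c <- a) bpure (bpure n (b : Ab) : bul Nb Ab) (c : Ab).
Proof.
rewrite [LHS]cmp_rhoE -[Delta A a in LHS]bul_sum_id bpure_sumr linear_bul_sum.
by apply: eq_bul_sum => b c; rewrite bulassocE.
Qed.

(** The left counit law: [n eps(a1) . a2] equals [n . s(eps(a1)) a2]. An element of [N . A] can thus
    be recovered from its coaction and [N . eps]. *)
Lemma counit_cmp_rho (x : K) :
  bulmap (counitr_bimap Nb) (bimap_id Ab) (hm_rho K x) = x.
Proof.
elim/bul_ind: x => [|x y Hx Hy|n a]; first by rewrite !lin0.
  by rewrite !(linD (bimap_lin _)) Hx Hy.
rewrite cmp_rho_pure (linear_bul_sum (bulmap _ _)) -[in RHS](Delta_sum_counitl a).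
transitivity (\Delta_(b, c <- a) bpure n (s (epsR b) * c : Ab)).
  apply: eq_bul_sum => b c; rewrite bulmapE -[counitr_bimap _ _]/(counitr _ _ _).
  by rewrite counitrE bpure_bal.
by symmetry; apply: bul_sum_morph; apply: (@bpureDr _ _ _ Nb Ab).
Qed.
End Cofree.

(** The morphism [f] is recovered by applying [f . A] to [n . 1] and then the counit. *)
Lemma comparison_faithful : faithful (comparison A).
Proof.
move=> N N' f g fg; apply: linear_ext => n.
have := congr1 (fun h : hopf_map (cmp_hopf A N) (cmp_hopf A N') =>
  counitr (eps A) (symbim kR N')
    (h (bpure (n : symbim kR N) ((1 : A) : Ab)))) fg.
rewrite -[fmap _ f]/(cmp_hopf_map A f) -[fmap _ g]/(cmp_hopf_map A g).
rewrite -![cmp_hopf_map _ _ _]/(cmp_map _ _ _) !cmp_mapE !counitrE.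
by rewrite eps1 !ract1.
Qed.

Section Full.
Variables (N N' : lmodType R) (h : hopf_map (cmp_hopf A N) (cmp_hopf A N')).
Local Notation Nb := (symbim kR N).
Local Notation Nb' := (symbim kR N').
Local Notation pure1 n := (bpure (n : Nb) ((1 : A) : Ab)).

Definition comparison_lift_fun (n : N) : N' := counitr (eps A) Nb' (h (pure1 n)).

Lemma comparison_lift_lin r :
  {morph comparison_lift_fun : x y / r *: x + y}.
Proof.
move=> x y; rewrite /comparison_lift_fun.
rewrite -[r *: x + y]/(lact r (x : Nb) + (y : Nb)) bpureDl -lact_bpure.
by rewrite linD bimapl linD counitr_lact.
Qed.
Definition comparison_lift : {linear N -> N'} := mklin comparison_lift_lin.

(** Since [Delta 1] is [1 . 1], the element [n . 1] is coinvariant, and so is its image;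
    [counit_cmp_rho] then gives the form of that image. *)
Lemma hopf_map_pure1 (n : Nb) :
  h (pure1 n) = bpure (comparison_lift n : Nb') ((1 : A) : Ab).
Proof.
rewrite -[LHS]counit_cmp_rho -hmm_rho cmp_rho_pure.
rewrite (Delta_sum1 (f := fun b c : A =>
  bpure (bpure n (b : Ab) : bul Nb Ab) (c : Ab))).
  by rewrite !bulmapE.
apply: bul_balancedAA => *.
- by rewrite (@bpureDr _ _ _ Nb Ab) bpureDl.
- exact: bpureDr.
- by rewrite -(bpure_bal (M := bul Nb Ab)) ract_bpure.
Qed.

(** Both maps are [A]-linear, and [n . a] is [n . 1] multiplied by [a]. *)
Lemma comparison_liftE : cmp_hopf_map A comparison_lift = h.
Proof.
apply/hopf_map_ext/bul_ext => n a.
rewrite -[LHS]/(cmp_map _ _ _) cmp_mapE -[a in RHS](mul1r (a : A)).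
rewrite -cmp_actE -[cmp_act _ _]/(rm_act (pure1 n : cmp_hopf A N) a).
rewrite hmm_act hopf_map_pure1.
by rewrite -[RHS]/(cmp_act _ _) cmp_actE mul1r.
Qed.
End Full.

Lemma comparison_full : full (comparison A).
Proof. by move=> N N' h; exists (comparison_lift h); apply: comparison_liftE. Qed.

(** * The antipode is antimultiplicative *)

Section AntipodeCalculus.

Variable S : A -> A.
Hypotheses (SD : {morph S : a b / a + b})
  (S_src : forall r a, S (s r * a) = t r * S a)
  (S_tgt : forall r a, S (t r * a) = S a * s r)
  (S_conv : forall a, \Delta_(b, c <- a) (b * S c) = s (epsR a))
  (conv_S : forall a, \Delta_(b, c <- a) (S b * c) = t (epsR a)).

Lemma antipode_sum (M N : bimod kR) (x : bul M N) (f : M -> N -> A) :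
  S (bul_sum x f) = bul_sum x (fun m n => S (f m n)).
Proof. exact: bul_sum_morph SD. Qed.

Lemma antipode_counitl a : \Delta_(b, c <- a) (t (epsR b) * S c) = S a.
Proof.
rewrite -[in RHS](Delta_sum_counitl a) antipode_sum.
by apply: eq_bul_sum => b c; rewrite S_src.
Qed.

Lemma antipode_mulr_counitr x a :
  \Delta_(b, c <- a) (S (x * b) * s (epsR c)) = S (x * a).
Proof.
rewrite -[in RHS](Delta_sum_counitr a) bul_sum_mull antipode_sum.
by apply: eq_bul_sum => b c; rewrite -S_tgt mulrA tgtC mulrA.
Qed.

Lemma conv_balanced : @bul_balanced _ _ _ Ab Ab A (fun a b : A => S a * b).
Proof.
apply: bul_balancedAA => *; first by rewrite SD mulrDl.
  exact: mulrDr.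
by rewrite S_tgt mulrA.
Qed.

(** The element [S(x1 a1) x2 a2 S(a3)] is computed twice: contracting [a2 S(a3)] gives the left
    side, contracting [S(x1 a1) x2 a2] by multiplicativity of [Delta] gives the right side. *)
Lemma antipode_twist x a : \Delta_(b, c <- x) (S (b * a) * c) = t (epsR x) * S a.
Proof.
transitivity (\Delta_(b, c <- a) ((\Delta_(d, e <- x * b) (S d * e)) * S c)).
  transitivity (\Delta_(d, e <- x) \Delta_(b, c <- a) \Delta_(b', c' <- b)
      (S (d * b') * (e * c') * S c)).
    apply: eq_bul_sum => d e; transitivity
      (\Delta_(b, c <- a) \Delta_(b', c' <- c) (S (d * b) * (e * b') * S c')).
      (* The counit is inserted as [s(eps(a2))] and expanded into [a2 S(a3)]. *)
      rewrite -antipode_mulr_counitr bul_sum_mulr; apply: eq_bul_sum => b c.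
      rewrite -mulrA srcC -S_conv !bul_sum_mull.
      by apply: eq_bul_sum => b' c'; rewrite !mulrA.
    symmetry; apply: (coaction_assoc (Delta_coaction)
      (f := fun b c f : A => S (d * b) * (e * c) * S f)).
    apply: tri_balancedAA => [b b' c f|b c c' f|b c f f'|b r c f|b c r f].
    - by rewrite mulrDr SD !mulrDl.
    - by rewrite mulrDr mulrDr mulrDl.
    - by rewrite SD mulrDr.
    - have -> : d * (t r * b) = t r * (d * b) by rewrite !mulrA tgtC.
      by rewrite S_tgt -!mulrA; congr (_ * _); rewrite !mulrA srcC.
    - by rewrite S_src -!mulrA; congr (_ * (_ * _)); rewrite !mulrA tgtC.
  rewrite bul_sum_exchange; apply: eq_bul_sum => b c.
  rewrite (Delta_sumM _ _ conv_balanced) bul_sum_mulr; apply: eq_bul_sum => d e.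
  by rewrite bul_sum_mulr.
rewrite -antipode_counitl bul_sum_mull; apply: eq_bul_sum => b c.
by rewrite conv_S epsRM rmorphM mulrA.
Qed.

(** The element [S(a1 b) a2 S(a3)] is computed twice: [a2 S(a3)] contracts to leave [S(a b)], while
    [antipode_twist] turns [S(a1 b) a2] into [t(eps(a1)) S(b)]. *)
Lemma antipodeM a b : S (a * b) = S b * S a.
Proof.
transitivity (\Delta_(c, d <- a) \Delta_(e, f <- c) (S (e * b) * f * S d)).
  rewrite (coaction_assoc (Delta_coaction)
    (f := fun e f d : A => S (e * b) * f * S d)).
    rewrite -[in LHS](Delta_sum_counitr a) bul_sum_mulr antipode_sum.
    apply: eq_bul_sum => c d; rewrite -mulrA S_tgt -S_conv bul_sum_mull.
    by apply: eq_bul_sum => e f; rewrite mulrA.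
  apply: tri_balancedAA => [e e' f d|e f f' d|e f d d'|e r f d|e f r d].
  - by rewrite mulrDl SD !mulrDl.
  - by rewrite mulrDr mulrDl.
  - by rewrite SD mulrDr.
  - by rewrite -[t r * e * b]mulrA S_tgt !mulrA.
  - by rewrite S_src -!mulrA; congr (_ * _); rewrite !mulrA tgtC.
transitivity (\Delta_(c, d <- a) (t (epsR c) * S b * S d)).
  by apply: eq_bul_sum => c d; rewrite -antipode_twist bul_sum_mulr.
rewrite -[in RHS](antipode_counitl a) bul_sum_mull; apply: eq_bul_sum => c d.
by rewrite mulrA -tgtC.
Qed.
End AntipodeCalculus.

(** * The fundamental theorem of Hopf modules *)

Section HopfIso.

Variables (M N : hopf_module A) (h : hopf_map M N) (g : N -> M).
Hypotheses (gK : cancel h g) (Kg : cancel g h).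

Let g_lin c : {morph (g : N -> M) : x y / c *: x + y}.
Proof. by move=> x y; rewrite -{1}[x]Kg -{1}[y]Kg -linearP gK. Qed.
Let gl r x : g (lact r x) = lact r (g x).
Proof. by rewrite -{1}[x]Kg -bimapl gK. Qed.
Let gr x r : g (ract x r) = ract (g x) r.
Proof. by rewrite -{1}[x]Kg -bimapr gK. Qed.
Let gb : bimap N M := @Bimap _ _ _ N M (mklin g_lin) gl gr.
Let g_act x (a : A) : gb (rm_act x a) = rm_act (gb x) a.
Proof. by rewrite -{1}[x]Kg -hmm_act; apply: gK. Qed.
Let g_rho x : bulmap gb (bimap_id Ab) (hm_rho N x) = hm_rho M (gb x).
Proof.
rewrite -{1}[x]Kg -hmm_rho -bulmap_comp1 -[RHS](bulmap_id (M := M)).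
congr (bimap_lin (bulmap _ _) _); apply: bimap_ext => y; exact: gK.
Qed.

Lemma hopf_map_bij_iso : @is_iso (HopfMod A) M N h.
Proof.
exists (HopfMap g_act g_rho : hopf_map N M).
by split; apply: hopf_map_ext => x; [apply: gK|apply: Kg].
Qed.
End HopfIso.

Section FundamentalTheorem.

Variable M : hopf_module A.

(** The quotient is [M / M ker eps], that is [M (x)_A R] along [eps]. Taking a quotient instead of
    the submodule of coinvariants makes [m |-> [m0] . m1] available before any antipode is given. *)
Definition coinv_rel (x : left_module M) : Prop :=
  exists (m : M) (a : A), x = (rm_act m a - lact (epsR a) m : M).
Definition coinv : lmodType R := quotm coinv_rel.
Local Notation V := (symbim kR coinv).
Definition coinv_class : {linear left_module M -> coinv} := qproj coinv_rel.

Lemma coinv_act (m : M) (a : A) :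
  coinv_class (rm_act m a) = epsR a *: coinv_class m.
Proof.
rewrite -linZ; apply/eqP; rewrite -subr_eq0 -linB; apply/eqP/qproj_gen.
by exists m, a.
Qed.

Definition coinv_map_fun (m : M) : V := coinv_class m.
Lemma coinv_map_lin c : {morph coinv_map_fun : x y / c *: x + y}.
Proof.
move=> x y; rewrite -[c *: x]lact_k; exact: (linearP coinv_class (kR c) x y).
Qed.
Lemma coinv_mapl r m : coinv_map_fun (lact r m) = lact r (coinv_map_fun m).
Proof. exact: (linZ coinv_class). Qed.
(** As [eps (t r)] is [r], the two actions of [R] agree on the quotient, as they must for a
    symmetric bimodule. *)
Lemma coinv_mapr m r : coinv_map_fun (ract m r) = ract (coinv_map_fun m) r.
Proof.
rewrite -rm_act_tgt [LHS]coinv_act -[t r]mulr1 eps_tgt epsR1 mulr1.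
by [].
Qed.
Definition coinv_map : bimap M V :=
  @Bimap _ _ _ M V (mklin coinv_map_lin) coinv_mapl coinv_mapr.

Lemma coinv_map_act (m : M) (a : A) :
  coinv_map (rm_act m a) = ract (coinv_map m) (epsR a).
Proof. exact: coinv_act. Qed.

Definition coinv_unit : bimap M (cmp_hopf A coinv) :=
  bimap_comp (bulmap coinv_map (bimap_id Ab)) (hm_rho M).

Lemma coinv_unitE m : coinv_unit m =
  \bul_(p, a <- hm_rho M m) bpure (coinv_map p) (a : Ab).
Proof.
rewrite -[LHS]/(bulmap coinv_map (bimap_id Ab) (hm_rho M m)).
rewrite -{1}[hm_rho M m]bul_sum_id (linear_bul_sum (bulmap _ _)).
by apply: eq_bul_sum => p a; rewrite bulmapE.
Qed.

Lemma coinv_pure_balanced :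
  @bul_balanced _ _ _ M Ab _ (fun p a => bpure (coinv_map p) a : bul V Ab).
Proof.
exact: (bul_balanced_comp (@bpure_balanced _ _ _ V Ab) coinv_map (bimap_id Ab)).
Qed.

(** In [[m0 a1] . m1 a2] the class absorbs [a1] as [eps(a1)], which crosses the bullet and
    recombines with [a2] by the counit law. *)
Lemma coinv_unit_act m (a : A) :
  coinv_unit (rm_act m a) = rm_act (coinv_unit m) a.
Proof.
rewrite !coinv_unitE (hopf_sum_act _ _ coinv_pure_balanced).
rewrite -[RHS]/(bul_mulr a V _) (linear_bul_sum (bul_mulr a V)).
apply: eq_bul_sum => p b; rewrite bul_mulrE.
rewrite -[in RHS](Delta_sum_counitl a) bul_sum_mull bpure_sumr.
apply: eq_bul_sum => c d; rewrite coinv_map_act bpure_bal; congr bpure.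
by rewrite -[lact _ _]/(s (epsR c) * (b * d)) !mulrA srcC.
Qed.

Lemma coinv_unit_rho m : bulmap coinv_unit (bimap_id Ab) (hm_rho M m) =
  hm_rho (cmp_hopf A coinv) (coinv_unit m).
Proof.
rewrite coinv_unitE (linear_bul_sum (hm_rho (cmp_hopf A coinv))).
rewrite -{1}[hm_rho M m]bul_sum_id (linear_bul_sum (bulmap _ _)).
transitivity (\bul_(p, b <- hm_rho M m) \bul_(q, a <- hm_rho M p)
  bpure (bpure (coinv_map q) (a : Ab) : bul V Ab) (b : Ab)).
  apply: eq_bul_sum => p b; rewrite bulmapE.
  by rewrite coinv_unitE bpure_suml.
rewrite (coaction_assoc (hm_coaction M)
  (f := fun q a b => bpure (bpure (coinv_map q) (a : Ab) : bul V Ab) (b : Ab))).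
  by apply: eq_bul_sum => p a; rewrite cmp_rho_pure.
have [l r] := bpure3_balanced V Ab Ab; split=> [b|q]; last exact: r.
exact: (bul_balanced_comp (l b) coinv_map (bimap_id Ab)).
Qed.

Definition coinv_unit_hopf : hopf_map M (cmp_hopf A coinv) :=
  HopfMap coinv_unit_act coinv_unit_rho.

Section Inverse.
Variable S : A -> A.
Hypotheses (SD : {morph S : a b / a + b})
  (S_src : forall r a, S (s r * a) = t r * S a)
  (S_tgt : forall r a, S (t r * a) = S a * s r)
  (S_conv : forall a, \Delta_(b, c <- a) (b * S c) = s (epsR a))
  (conv_S : forall a, \Delta_(b, c <- a) (S b * c) = t (epsR a)).

Lemma rm_act_sumr (P P' : bimod kR) (x : bul P P') (f : P -> P' -> A) (m : M) :
  rm_act m (bul_sum x f) = bul_sum x (fun p q => rm_act m (f p q)).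
Proof. exact: bul_sum_morph (rm_actDr m). Qed.

Lemma rm_act_suml (P P' : bimod kR) (x : bul P P') (f : P -> P' -> M) a :
  rm_act (bul_sum x f) a = bul_sum x (fun p q => rm_act (f p q) a).
Proof.
by apply: (bul_sum_morph f (h := fun m => rm_act m a) x) => y z; apply: rm_actDl.
Qed.

Lemma act_antipode_balanced :
  @bul_balanced _ _ _ M Ab M (fun p a => rm_act p (S a)).
Proof.
apply: bul_balancedA => *; first exact: rm_actDl.
  by rewrite SD rm_actDr.
by rewrite S_src -rm_actA rm_act_tgt.
Qed.

(** The classical projection of a Hopf module onto its coinvariants. *)
Definition coinv_proj (m : M) : M := \bul_(p, a <- hm_rho M m) rm_act p (S a).

Lemma coinv_projD m m' : coinv_proj (m + m') = coinv_proj m + coinv_proj m'.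
Proof. exact: coaction_sumD act_antipode_balanced _ _. Qed.

(** By antimultiplicativity [m0 a1 S(m1 a2)] is [m0 a1 S(a2) S(m1)], and [a1 S(a2)] contracts to
    [s(eps(a))]. Hence the projection factors through the quotient. *)
Lemma coinv_proj_act m a : coinv_proj (rm_act m a) = lact (epsR a) (coinv_proj m).
Proof.
rewrite /coinv_proj (hopf_sum_act _ _ act_antipode_balanced) lact_bul_sum.
apply: eq_bul_sum => p b; rewrite -rm_act_src rm_actA -srcC -S_conv.
rewrite bul_sum_mulr rm_act_sumr; apply: eq_bul_sum => c d.
by rewrite (antipodeM SD S_src S_tgt S_conv conv_S) rm_actA mulrA.
Qed.

Lemma coinv_proj_lin r :
  {morph (coinv_proj : left_module M -> left_module M) : x y / r *: x + y}.
Proof.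
move=> x y; rewrite -[coinv_proj _]/(coinv_proj (lact r (x : M) + (y : M))).
rewrite coinv_projD -rm_act_src coinv_proj_act.
by rewrite -[s r]mulr1 eps_src epsR1 mulr1.
Qed.

Definition coinv_proj_linear : {linear left_module M -> left_module M} :=
  mklin coinv_proj_lin.

Lemma coinv_proj_rel v : coinv_rel v -> coinv_proj_linear v = 0.
Proof.
move=> [m [a ->]].
rewrite -[_ - _]/((rm_act m a : left_module M) - epsR a *: (m : left_module M)).
rewrite linB linZ; apply/eqP; rewrite subr_eq0; apply/eqP.
exact: coinv_proj_act.
Qed.
Definition coinv_lift : {linear coinv -> left_module M} := qlift coinv_proj_rel.
Lemma coinv_liftE (m : M) : coinv_lift (coinv_class m) = coinv_proj m :> M.
Proof. exact: (qliftE coinv_proj_rel (m : left_module M)). Qed.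

Lemma coinv_counit_balanced : @bul_balanced _ _ _ V Ab M
  (fun v (a : A) => rm_act (coinv_lift v : M) a).
Proof.
apply: bul_balancedA => [v w a|v a b|v r a].
- by rewrite linD; apply: rm_actDl.
- exact: rm_actDr.
- rewrite -rm_actA rm_act_src -[ract v r]/(r *: (v : coinv)) linZ //.
Qed.
Definition coinv_counit (y : cmp_hopf A coinv) : M :=
  \bul_(v, a <- y) rm_act (coinv_lift v : M) a.

Lemma coinv_counitD y z : coinv_counit (y + z) = coinv_counit y + coinv_counit z.
Proof. exact: bul_sumD coinv_counit_balanced _ _. Qed.
Lemma coinv_counitE m (a : A) :
  coinv_counit (bpure (coinv_map m) (a : Ab)) = rm_act (coinv_proj m) a.
Proof.
rewrite [LHS](bul_sum_pure coinv_counit_balanced).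
by rewrite -[coinv_map m]/(coinv_class m) coinv_liftE.
Qed.

(** By coassociativity the composite is [m0 S(m1) m2], and [S(m1) m2] contracts to the counit. *)
Lemma coinv_unitK : cancel coinv_unit coinv_counit.
Proof.
move=> m; rewrite coinv_unitE (bul_sum_morph _ _ coinv_counitD).
rewrite -[RHS](coaction_counit (hm_coaction M)).
transitivity (\bul_(p, c <- hm_rho M m) \bul_(q, b <- hm_rho M p)
    rm_act q (S b * c)).
  apply: eq_bul_sum => p c; rewrite coinv_counitE rm_act_suml.
  by apply: eq_bul_sum => q b; rewrite rm_actA.
rewrite (coaction_assoc (hm_coaction M) (f := fun q b c => rm_act q (S b * c))).
  apply: eq_bul_sum => p a.
  by rewrite -rm_act_sumr conv_S rm_act_tgt.
apply: tri_balancedA => *.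
- exact: rm_actDl.
- by rewrite SD mulrDl rm_actDr.
- by rewrite mulrDr rm_actDr.
- by rewrite -rm_act_tgt rm_actA S_src mulrA.
- by rewrite S_tgt mulrA.
Qed.

(** By [A]-linearity the left side is [[m0] . m1 S(m2)], where [m1 S(m2)] contracts to the
    counit. *)
Lemma coinv_unit_proj m :
  coinv_unit (coinv_proj m) = bpure (coinv_map m) ((1 : A) : Ab).
Proof.
rewrite /coinv_proj linear_bul_sum.
transitivity (\bul_(p, c <- hm_rho M m) \bul_(q, b <- hm_rho M p)
    (bpure (coinv_map q) (b * S c : Ab) : bul V Ab)).
  apply: eq_bul_sum => p a; rewrite coinv_unit_act coinv_unitE.
  rewrite -[LHS]/(bul_mulr (S a) V _) (linear_bul_sum (bul_mulr _ V)).
  by apply: eq_bul_sum => q b; rewrite bul_mulrE.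
rewrite (coaction_assoc (hm_coaction M)
  (f := fun q b c => bpure (coinv_map q) (b * S c : Ab) : bul V Ab)).
  rewrite -[in RHS](coaction_counit (hm_coaction M) m).
  rewrite linear_bul_sum bpure_suml; apply: eq_bul_sum => p a.
  rewrite bimapr bpure_bal -bpure_sumr S_conv; congr bpure.
  by symmetry; apply: (@mulr1 A).
apply: tri_balancedA => [q q' b c|q b b' c|q b c c'|q r b c|q b r c].
- by rewrite linD bpureDl.
- by rewrite mulrDl (@bpureDr _ _ _ V Ab).
- by rewrite SD mulrDr (@bpureDr _ _ _ V Ab).
- by rewrite bimapr bpure_bal -mulrA.
- by rewrite S_src mulrA tgtC.
Qed.

Lemma coinv_counitK : cancel coinv_counit coinv_unit.
Proof.
elim/bul_ind=> [|x y Hx Hy|v a].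
- by rewrite /coinv_counit (bul_sum0 coinv_counit_balanced) lin0.
- by rewrite coinv_counitD linD Hx Hy.
have [m ->] := qproj_surj (v : quotm coinv_rel).
rewrite -[qproj _ _]/(coinv_map m) coinv_counitE coinv_unit_act coinv_unit_proj.
by rewrite -[LHS]/(cmp_act _ _) cmp_actE mul1r.
Qed.
End Inverse.
End FundamentalTheorem.

Lemma equivalence_of_hopf : is_hopf_algebroid A -> is_equivalence (comparison A).
Proof.
move=> [S [S_s S_t Sr Sl]].
apply: equivalence_of_ff; [exact: comparison_faithful|exact: comparison_full|].
pose S' : A -> A := S.
have SD : {morph S' : a b / a + b} by apply: (linD S).
have S_src r a : S' (s r * a) = t r * S' a by rewrite srcC; apply: S_s.
have S_tgt r a : S' (t r * a) = S' a * s r by apply: S_t.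
have S_conv a : \Delta_(b, c <- a) (b * S' c) = s (epsR a).
  rewrite -[RHS]Sr; symmetry; apply: (bul_sumE (h := mulS S_s) _) => [|x y|b c].
  - apply: bul_balancedAA => *; first exact: mulrDl.
      by rewrite SD mulrDr.
    by rewrite S_src mulrA tgtC.
  - exact: (linD (mulS S_s)).
  - exact: mulSE.
have conv_S a : \Delta_(b, c <- a) (S' b * c) = t (epsR a).
  rewrite -[RHS]Sl; symmetry; apply: (bul_sumE (h := Smul S_t) _) => [|x y|b c].
  - exact: conv_balanced.
  - exact: (linD (Smul S_t)).
  - exact: SmulE.
move=> M; have [h [hK Kh]] := hopf_map_bij_iso (h := coinv_unit_hopf M)
  (coinv_unitK SD S_src S_tgt S_conv conv_S)
  (coinv_counitK SD S_src S_tgt S_conv conv_S).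
by exists (coinv M), h; exists (coinv_unit_hopf M).
Qed.

(** * The free Hopf module on a comodule *)

Section FreeHopfModule.

Variable Q : comodule A.

Definition free_act (z : circ Q Ab) (a : A) : circ Q Ab := circ_mulr Q a z.
Lemma free_actE q (a b : A) :
  free_act (cpure q (a : Ab)) b = cpure q (a * b : Ab).
Proof. exact: circ_mulrE. Qed.
Lemma free_actDl y z a : free_act (y + z) a = free_act y a + free_act z a.
Proof. exact: linD. Qed.
Lemma free_act0 a : free_act 0 a = 0.
Proof. exact: lin0. Qed.
Lemma free_actDr z a b : free_act z (a + b) = free_act z a + free_act z b.
Proof.
elim/circ_ind: z => [|x y Hx Hy|q c]; first by rewrite !free_act0 addr0.
  by rewrite !free_actDl Hx Hy addrACA.
by rewrite !free_actE mulrDr (@cpureDr _ _ _ Q Ab).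
Qed.
Lemma free_actA z a b : free_act (free_act z a) b = free_act z (a * b).
Proof.
elim/circ_ind: z => [|x y Hx Hy|q c]; first by rewrite !free_act0.
  by rewrite !free_actDl Hx Hy.
by rewrite !free_actE mulrA.
Qed.
Lemma free_act1 z : free_act z 1 = z.
Proof.
elim/circ_ind: z => [|x y Hx Hy|q c]; first by rewrite !free_act0.
  by rewrite !free_actDl Hx Hy.
by rewrite !free_actE mulr1.
Qed.
Lemma free_act_k z c : free_act z (ra_k A c) = c *: z.
Proof.
elim/circ_ind: z => [|x y Hx Hy|q a]; first by rewrite free_act0 scaler0.
  by rewrite !free_actDl Hx Hy scalerDr.
rewrite free_actE -ra_kC -[ra_k A c * a]/(c *: (a : Ab)).
exact: bilinZr (cpure_bilin Q Ab) _ _ _.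
Qed.

(** The actions of [R] are read off the action of [A], as the definition of [rmodule] requires. *)
Definition free_lact (r : R) z := free_act z (s r).
Definition free_ract z (r : R) := free_act z (t r).
Lemma free_lactDl r r' z : free_lact (r + r') z = free_lact r z + free_lact r' z.
Proof. by rewrite /free_lact rmorphD free_actDr. Qed.
Lemma free_lactDr r y z : free_lact r (y + z) = free_lact r y + free_lact r z.
Proof. exact: free_actDl. Qed.
Lemma free_lactA r r' z : free_lact r (free_lact r' z) = free_lact (r * r') z.
Proof. by rewrite /free_lact free_actA -srcC rmorphM. Qed.
Lemma free_lact1 z : free_lact 1 z = z.
Proof. by rewrite /free_lact rmorph1 free_act1. Qed.
Lemma free_ractDl y z r : free_ract (y + z) r = free_ract y r + free_ract z r.
Proof. exact: free_actDl. Qed.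
Lemma free_ractDr z r r' : free_ract z (r + r') = free_ract z r + free_ract z r'.
Proof. by rewrite /free_ract rmorphD free_actDr. Qed.
Lemma free_ractA z r r' : free_ract (free_ract z r) r' = free_ract z (r * r').
Proof. by rewrite /free_ract free_actA rmorphM. Qed.
Lemma free_ract1 z : free_ract z 1 = z.
Proof. by rewrite /free_ract rmorph1 free_act1. Qed.
Lemma free_lractA r z r' :
  free_ract (free_lact r z) r' = free_lact r (free_ract z r').
Proof. by rewrite /free_ract /free_lact !free_actA srcC. Qed.
Lemma free_lact_k c z : free_lact (kR c) z = c *: z.
Proof. by rewrite /free_lact src_k free_act_k. Qed.
Lemma free_ract_k c z : free_ract z (kR c) = c *: z.
Proof. by rewrite /free_ract tgt_k free_act_k. Qed.
Definition free_bim : bimod kR := Bimod free_lactDl free_lactDr free_lactA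
  free_lact1 free_ractDl free_ractDr free_ractA free_ract1 free_lractA
  free_lact_k free_ract_k.
Local Notation F := free_bim.
Local Notation "q #o a" := (cpure (q : Q) (a : Ab) : F) (at level 40).

Lemma free_act_src (z : F) r : free_act z (s r) = lact r z. Proof. by []. Qed.
Lemma free_act_tgt (z : F) r : free_act z (t r) = ract z r. Proof. by []. Qed.
Definition free_rmod : rmodule A := @RModule _ _ _ A F free_act free_actDl
  free_actDr free_actA free_act1 free_act_k free_act_src free_act_tgt.

Lemma free_lactE r q (a : A) : lact r (q #o a) = q #o (s r * a).
Proof. by rewrite -[LHS]/(free_act _ _) free_actE srcC. Qed.
Lemma free_ractE q (a : A) r : ract (q #o a) r = q #o (t r * a).
Proof. by rewrite -[LHS]/(free_act _ _) free_actE tgtC. Qed.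
Lemma cpure_ractF q r (a : A) : ract q r #o a = ract (q #o a) r.
Proof. by rewrite free_ractE cpure_ract. Qed.

(** One summand of the diagonal coaction [q o a |-> (q0 o a1) . q1 a2]. *)
Definition free_term q (b c d : A) : bul F Ab := bpure (q #o c) (b * d : Ab).

Lemma free_term_balanced_l c d :
  @bul_balanced _ _ _ Q Ab _ (fun p b => free_term p b c d).
Proof.
apply: bul_balancedA => [p p' b|p b b'|p r b]; rewrite /free_term.
- by rewrite cpureDl bpureDl.
- by rewrite mulrDl (@bpureDr _ _ _ F Ab).
- rewrite cpure_ractF bpure_bal; congr bpure; exact: mulrA.
Qed.
Lemma free_term_balanced_r q b :
  @bul_balanced _ _ _ Ab Ab _ (fun c d : A => free_term q b c d).
Proof.
apply: bul_balancedAA => [c c' d|c d d'|c r d]; rewrite /free_term.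
- by rewrite (@cpureDr _ _ _ Q Ab) bpureDl.
- by rewrite mulrDr (@bpureDr _ _ _ F Ab).
- rewrite -free_ractE bpure_bal; congr bpure.
  by rewrite -[LHS]/(s r * (b * d)) !mulrA srcC.
Qed.

Definition free_rho_fun (q : Q) (a : Ab) : bul F Ab :=
  \bul_(p, b <- cm_rho Q q) \Delta_(c, d <- a) free_term p b c d.

Lemma free_rho_balanced (a : Ab) : @bul_balanced _ _ _ Q Ab _
  (fun p (b : A) => \Delta_(c, d <- a) free_term p b c d).
Proof.
by split=> *; rewrite -?bul_sum_add; apply: eq_bul_sum => c d;
  [apply: (bulDl (free_term_balanced_l _ _))
  |apply: (bulDr (free_term_balanced_l _ _))
  |apply: (bul_bal (free_term_balanced_l _ _))].
Qed.

Lemma free_rho_bilin : bilin free_rho_fun.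
Proof.
split=> [x q q' a|x q a a']; rewrite /free_rho_fun.
  rewrite linearP; apply: bul_sumP => [|p b]; first exact: free_rho_balanced.
  rewrite bul_sum_scale; apply: eq_bul_sum => c d.
  by rewrite /free_term (bilinZl (cpure_bilin Q Ab)) bpureZl.
rewrite bul_sum_scale -bul_sum_add; apply: eq_bul_sum => p b.
rewrite linearP; apply: bul_sumP => [|c d]; first exact: free_term_balanced_r.
by rewrite /free_term (bilinZr (cpure_bilin Q Ab)) bpureZl.
Qed.
(** A left scalar reaches [q0] on one side and [a1] on the other, and is moved across [o]. A right
    scalar reaches [q1] or [a2], hence in both cases the product [q1 a2], by centrality. *)
Lemma free_rho_bal r q r' a :
  free_rho_fun (ract (lact r q) r') a = free_rho_fun q (ract (lact r a) r').
Proof.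
rewrite /free_rho_fun (coaction_sum_ract _ (free_rho_balanced a)).
rewrite (coaction_sum_lact _ (bul_balanced_ract (free_rho_balanced a) r')).
apply: eq_bul_sum => p b; rewrite !bimapr !bimapl.
rewrite (bul_sum_ract (free_term_balanced_r p b)).
rewrite (bul_sum_lact (bul_balanced_ract (free_term_balanced_r p b) r')).
apply: eq_bul_sum => c d; rewrite /free_term cpure_lact; congr bpure.
by rewrite -[ract d r']/(t r' * d) -[ract b r']/(t r' * b) !mulrA tgtC.
Qed.
Definition free_rho_lin : {linear F -> bul F Ab} :=
  clift free_rho_bilin free_rho_bal.
Lemma free_rho_linE q (a : A) : free_rho_lin (q #o a) =
  \bul_(p, b <- cm_rho Q q) \Delta_(c, d <- a) free_term p b c d.
Proof. exact: cliftE. Qed.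

Lemma free_rhol r z : free_rho_lin (lact r z) = lact r (free_rho_lin z).
Proof.
elim/circ_ind: z => [|x y Hx Hy|q a]; first by rewrite !(lact0, lin0).
  by rewrite !(lactDr, linD) Hx Hy.
rewrite free_lactE !free_rho_linE lact_bul_sum; apply: eq_bul_sum => p b.
rewrite (Delta_sum_src (free_term_balanced_r p b)) lact_bul_sum.
by apply: eq_bul_sum => c d; rewrite /free_term lact_bpure free_lactE.
Qed.
Lemma free_rhor z r : free_rho_lin (ract z r) = ract (free_rho_lin z) r.
Proof.
elim/circ_ind: z => [|x y Hx Hy|q a]; first by rewrite !(ract0, lin0).
  by rewrite !(ractDl, linD) Hx Hy.
rewrite free_ractE !free_rho_linE ract_bul_sum; apply: eq_bul_sum => p b.
rewrite (Delta_sum_tgt (free_term_balanced_r p b)) ract_bul_sum.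
apply: eq_bul_sum => c d; rewrite /free_term ract_bpure; congr bpure.
by rewrite -[RHS]/(t r * (b * d)) !mulrA tgtC.
Qed.
Definition free_rho : bimap F (bul F Ab) := Bimap free_rhol free_rhor.
Lemma free_rhoE q (a : A) : free_rho (q #o a) =
  \bul_(p, b <- cm_rho Q q) \Delta_(c, d <- a) free_term p b c d.
Proof. exact: free_rho_linE. Qed.

Definition free_term3 q (a b c d e : A) : bul (bul F Ab) Ab :=
  bpure (bpure (q #o c) (a * d : Ab) : bul F Ab) (b * e : Ab).

Lemma free_term3_balanced_r q a b :
  @tri_balanced _ _ _ Ab Ab Ab _ (fun c d e : A => free_term3 q a b c d e).
Proof.
have [l r] := bpure3_balanced F Ab Ab.
apply: tri_balancedAA => *; rewrite /free_term3.
- by rewrite (@cpureDr _ _ _ Q Ab) !bpureDl.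
- by rewrite mulrDr (@bpureDr _ _ _ F Ab) bpureDl.
- by rewrite mulrDr (@bpureDr _ _ _ (bul F Ab) Ab).
- rewrite -free_ractE bpure_bal; congr (bpure (bpure _ _) _).
  by rewrite -[LHS]/(s _ * (_ * _)) !mulrA srcC.
- rewrite mulrA -tgtC -mulrA -[t _ * (_ * _)]/(ract (_ * _ : Ab) _).
  rewrite -ract_bpure bpure_bal; congr bpure.
  by rewrite -[LHS]/(s _ * (_ * _)) !mulrA srcC.
Qed.

Lemma free_term3_balanced_l c d e :
  @tri_balanced _ _ _ Q Ab Ab _ (fun q a b => free_term3 q a b c d e).
Proof.
apply: tri_balancedA => *; rewrite /free_term3.
- by rewrite cpureDl !bpureDl.
- by rewrite mulrDl (@bpureDr _ _ _ F Ab) bpureDl.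
- by rewrite mulrDl (@bpureDr _ _ _ (bul F Ab) Ab).
- rewrite cpure_ractF bpure_bal; congr (bpure (bpure _ _) _); exact: mulrA.
- rewrite -mulrA -[t _ * (_ * _)]/(ract (_ * _ : Ab) _).
  rewrite -ract_bpure bpure_bal; congr bpure; exact: mulrA.
Qed.

Lemma free_sum3_balanced (a : Ab) : @tri_balanced _ _ _ Q Ab Ab _
  (fun q b b' => \Delta_(c, c' <- a) \Delta_(d, e <- c') free_term3 q b b' c d e).
Proof.
by split=> [b'|q]; split=> *; rewrite -?bul_sum_add; apply: eq_bul_sum => c c';
  rewrite -?bul_sum_add; apply: eq_bul_sum => d e;
  have [l r] := free_term3_balanced_l c d e;
  [apply: (bulDl (l _))|apply: (bulDr (l _))|apply: (bul_bal (l _))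
  |apply: (bulDl (r _))|apply: (bulDr (r _))|apply: (bul_bal (r _))].
Qed.

(** Coassociativity is spent on [a] here, so that this side and that of [bulassoc_free_rho] differ
    only in the bracketing of [q0], [q1], [q2]. *)
Lemma bulmap_free_rho q (a : A) :
  bulmap free_rho (bimap_id Ab) (free_rho (q #o a)) =
  \bul_(p, b <- cm_rho Q q) \bul_(p', b' <- cm_rho Q p)
    \Delta_(c, c' <- a) \Delta_(d, e <- c') free_term3 p' b' b c d e.
Proof.
rewrite free_rhoE (linear_bul_sum (bulmap _ _)); apply: eq_bul_sum => p b.
rewrite (linear_bul_sum (bulmap _ _)).
transitivity (\Delta_(c, d <- a) \bul_(p', b' <- cm_rho Q p) \Delta_(c', d' <- c)
    free_term3 p' b' b c' d' d).
  apply: eq_bul_sum => c d; rewrite bulmapE free_rhoE bpure_suml.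
  by apply: eq_bul_sum => p' b'; rewrite bpure_suml.
rewrite bul_sum_exchange; apply: eq_bul_sum => p' b'.
exact: (coaction_assoc (Delta_coaction) (free_term3_balanced_r p' b' b)).
Qed.

Lemma bulassoc_free_rho q (a : A) :
  bulassoc F Ab Ab (bulmap (bimap_id F) (Delta A) (free_rho (q #o a))) =
  \bul_(p, b <- cm_rho Q q) \Delta_(b', b'' <- b)
    \Delta_(c, c' <- a) \Delta_(d, e <- c') free_term3 p b' b'' c d e.
Proof.
rewrite free_rhoE (linear_bul_sum (bulmap _ _)) (linear_bul_sum (bulassoc _ _ _)).
apply: eq_bul_sum => p b.
rewrite (linear_bul_sum (bulmap _ _)) (linear_bul_sum (bulassoc _ _ _)).
rewrite bul_sum_exchange; apply: eq_bul_sum => c c'.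
rewrite bulmapE -[Delta A _]bul_sum_id.
rewrite (Delta_sumM _ _ (@bpure_balanced _ _ _ Ab Ab)).
rewrite bpure_sumr (linear_bul_sum (bulassoc _ _ _)); apply: eq_bul_sum => b' b''.
rewrite bpure_sumr (linear_bul_sum (bulassoc _ _ _)); apply: eq_bul_sum => d e.
by rewrite bulassocE.
Qed.

Lemma free_coaction : is_coaction free_rho.
Proof.
split=> z.
  elim/circ_ind: z => [|x y Hx Hy|q a]; first by rewrite !lin0.
    by rewrite !(linD (bimap_lin _)) !(linD (bulassoc _ _ _)) Hx Hy.
  rewrite bulmap_free_rho bulassoc_free_rho.
  exact: (coaction_assoc (cm_coaction Q) (free_sum3_balanced a)).
elim/circ_ind: z => [|x y Hx Hy|q a]; first by rewrite !lin0.
  by rewrite !(linD (bimap_lin _)) (linD (counitr _ _)) Hx Hy.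
rewrite free_rhoE (linear_bul_sum (counitr _ _)).
rewrite -[q in RHS](coaction_counit (cm_coaction Q)).
(* In [(q0 o a1) eps(q1 a2)] the counit splits: [eps(a2)] recombines with [a1], leaving
   [q0 eps(q1) o a]. *)
transitivity (\bul_(p, b <- cm_rho Q q) (ract p (epsR b) #o a)).
  apply: eq_bul_sum => p b.
  rewrite (linear_bul_sum (counitr _ _)) cpure_ractF free_ractE.
  rewrite -[a in RHS]Delta_sum_counitr bul_sum_mull.
  transitivity (\Delta_(c, d <- a) (p #o (t (epsR b) * (t (epsR d) * c)))).
    apply: eq_bul_sum => c d; rewrite counitr_pure epsRM free_ractE.
    by rewrite rmorphM mulrA.
  by symmetry; apply: bul_sum_morph; apply: (@cpureDr _ _ _ Q Ab).
symmetry; apply: (bul_sum_morph _ (h := fun p => p #o a) _) => x y.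
exact: cpureDl.
Qed.

Lemma free_compat (z : free_rmod) (x : A) :
  free_rho (rm_act z x) = bul_fact (M := free_rmod) (free_rho z) (Delta A x).
Proof.
elim/circ_ind: z => [|y z Hy Hz|q a].
- by rewrite [rm_act _ _]free_act0 !lin0 bul_fact0l.
- by rewrite rm_actDl !(linD (bimap_lin _)) bul_factDl Hy Hz.
rewrite [rm_act _ _]free_actE !free_rhoE.
rewrite (bul_sum_morph (h := fun y => bul_fact (M := free_rmod) y _) _ _
  (fun y z => bul_factDl _ _ _)).
apply: eq_bul_sum => p b; rewrite (Delta_sumM _ _ (free_term_balanced_r p b)).
rewrite (bul_sum_morph (h := fun y => bul_fact (M := free_rmod) y _) _ _
  (fun y z => bul_factDl _ _ _)).
apply: eq_bul_sum => c d; rewrite -[Delta A x in RHS]bul_sum_id.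
rewrite (bul_sum_morph _ _ (fun y z => bul_factDr _ _ _)).
apply: eq_bul_sum => e f; rewrite bul_factE [rm_act _ _]free_actE.
by rewrite /free_term mulrA.
Qed.

Definition free_hopf : hopf_module A :=
  @HopfModule _ _ _ A free_rmod free_rho free_coaction free_compat.

Definition free_unit_fun (q : Q) : F := q #o 1.
Lemma free_unit_lin c : {morph free_unit_fun : x y / c *: x + y}.
Proof. by move=> x y; apply: (cpure_bilin Q Ab).1. Qed.
Lemma free_unitl r q : free_unit_fun (lact r q) = lact r (free_unit_fun q).
Proof. by rewrite free_lactE -cpure_lact. Qed.
Lemma free_unitr q r : free_unit_fun (ract q r) = ract (free_unit_fun q) r.
Proof. by rewrite free_ractE -cpure_ract. Qed.
Definition free_unit : bimap Q free_hopf :=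
  @Bimap _ _ _ Q F (mklin free_unit_lin) free_unitl free_unitr.

Lemma free_unit_act q (a : A) : rm_act (free_unit q) a = q #o a.
Proof. by rewrite [LHS]free_actE mul1r. Qed.

Lemma free_unit_rho q :
  hm_rho free_hopf (free_unit q) = bulmap free_unit (bimap_id Ab) (cm_rho Q q).
Proof.
rewrite [LHS]free_rhoE -[cm_rho Q q in RHS]bul_sum_id.
rewrite (linear_bul_sum (bulmap _ _)); apply: eq_bul_sum => p b.
rewrite (Delta_sum1 (free_term_balanced_r p b)) bulmapE /free_term.
by rewrite mulr1.
Qed.

(** The left action on [Q o A] is multiplication by [s r]; on the target this is the left action
    because the two actions on [Q / [Q, R]] coincide. *)
Lemma varsigmal r (z : F) : varsigma_Q Q (lact r z) = lact r (varsigma_Q Q z).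
Proof.
rewrite [LHS]varsigma_mulr.
elim/bul_ind: (varsigma_Q Q z) => [|x y Hx Hy|p b]; first by rewrite lact0 lin0.
  by rewrite lactDr !(linD (bimap_lin _)) Hx Hy.
by rewrite bul_mulrE lact_bpure [lact r p]cq_act bpure_bal -srcC.
Qed.
End FreeHopfModule.

(** * Factoring an isomorphism onto a comparison module through [varsigma] *)

Section VarsigmaOfEquivalence.

Variables (Q : comodule A) (N : lmodType R).
Local Notation V := (symbim kR N).
Local Notation F := (free_hopf Q).
Local Notation K := (cmp_hopf A N).
Variables (phi : hopf_map F K) (psi : hopf_map K F).
Hypotheses (phiK : cancel phi psi) (psiK : cancel psi phi).
Local Notation vs := (varsigma_Q Q).
Local Notation pure1 n := (bpure (n : V) ((1 : A) : Ab)).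

Definition coinv0 : bimap Q V :=
  bimap_comp (counitr_bimap V) (bimap_comp phi (free_unit Q)).

(** A comodule map into [N . A] is determined by its composite with the counit, here [coinv0]. *)
Lemma phi_unit q : phi (free_unit Q q) = bulmap coinv0 (bimap_id Ab) (cm_rho Q q).
Proof.
rewrite -[LHS]counit_cmp_rho -hmm_rho free_unit_rho.
by rewrite /coinv0 !bulmap_comp1.
Qed.

Lemma coinv0_rel v : comm_rel v -> coinv0 v = 0.
Proof. by move=> [q [r ->]]; rewrite linB bimapl bimapr subrr. Qed.
Definition cq_lift_lin : {linear cq Q -> V} := qlift coinv0_rel.
Lemma cq_lift_linE q : cq_lift_lin (cq_class Q q) = coinv0 q.
Proof. exact: qliftE. Qed.
Lemma cq_liftl r x : cq_lift_lin (lact r x) = lact r (cq_lift_lin x).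
Proof. by have [q ->] := cq_surj x; rewrite /= cq_lactE !cq_lift_linE bimapl. Qed.
Lemma cq_liftr x r : cq_lift_lin (ract x r) = ract (cq_lift_lin x) r.
Proof. by have [q ->] := cq_surj x; rewrite /= cq_ractE !cq_lift_linE bimapr. Qed.
Definition cq_lift : bimap (cq Q) V := Bimap cq_liftl cq_liftr.
Lemma cq_liftE q : cq_lift (cq_class Q q) = coinv0 q.
Proof. exact: cq_lift_linE. Qed.

(** The retraction of [cq_lift]: the unit [n . 1] is pulled back through [phi], sent on by
    [varsigma], and its [A] part removed by the counit. *)
Definition cq_inv_fun (n : V) : cq Q :=
  counitr (eps A) (cq Q) (vs (psi (pure1 n))).
Lemma cq_inv_lin c : {morph cq_inv_fun : x y / c *: x + y}.
Proof.
by move=> x y; rewrite /cq_inv_fun (bpure_bilin V Ab).1 !linearP.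
Qed.
Lemma cq_invl r n : cq_inv_fun (lact r n) = lact r (cq_inv_fun n).
Proof.
by rewrite /cq_inv_fun -lact_bpure bimapl varsigmal counitr_lact.
Qed.
Lemma cq_invr n r : cq_inv_fun (ract n r) = ract (cq_inv_fun n) r.
Proof. by rewrite -[RHS]cq_act; apply: cq_invl. Qed.
Definition cq_inv : bimap V (cq Q) :=
  @Bimap _ _ _ V (cq Q) (mklin cq_inv_lin) cq_invl cq_invr.

Lemma cq_inv_act n (a : A) :
  counitr (eps A) (cq Q) (vs (psi (bpure n (a : Ab)))) = ract (cq_inv n) (epsR a).
Proof.
rewrite -[a in LHS]mul1r -cmp_actE -[cmp_act _ _]/(rm_act (pure1 n : K) a).
by rewrite hmm_act [vs _]varsigma_mulr counitr_mulr.
Qed.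

(** The class [[q]] is the counit applied to the image of [q o 1] under [varsigma]. Writing [q o 1]
    as [psi (phi (q o 1))] and expanding [phi] by [phi_unit] produces [cq_inv]. *)
Lemma cq_liftK : cancel cq_lift cq_inv.
Proof.
move=> x; have [q ->] := cq_surj x; rewrite cq_liftE.
have <- : counitr (eps A) (cq Q) (vs (free_unit Q q)) = cq_class Q q.
  rewrite [vs _]varsigma_pure (linear_bul_sum (counitr _ _)).
  rewrite -[q in RHS](coaction_counit (cm_coaction Q)) linear_bul_sum.
  apply: eq_bul_sum => p b; rewrite counitr_pure mulr1.
  exact: (cq_ractE p (epsR b)).
rewrite -[free_unit Q q]phiK phi_unit -[cm_rho Q q in RHS]bul_sum_id.
rewrite -[q in LHS](coaction_counit (cm_coaction Q)).
rewrite (linear_bul_sum coinv0) (linear_bul_sum cq_inv).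
rewrite (linear_bul_sum (bulmap _ _)) (linear_bul_sum psi) (linear_bul_sum vs).
rewrite (linear_bul_sum (counitr _ _)); apply: eq_bul_sum => p b.
by rewrite bulmapE cq_inv_act !bimapr.
Qed.

(** Both sides are right [A]-linear, and [Q o A] is generated over [A] by the elements [q o 1],
    where [phi_unit] applies. *)
Lemma phiE z : phi z = bulmap cq_lift (bimap_id Ab) (vs z).
Proof.
elim/circ_ind: z => [|x y Hx Hy|q a]; first by rewrite !lin0.
  by rewrite linD (linD vs) linD Hx Hy.
rewrite -free_unit_act hmm_act phi_unit -[rm_act _ _]/(bul_mulr a V _).
rewrite [rm_act _ _]free_actE mul1r varsigma_pure.
rewrite -[cm_rho Q q in LHS]bul_sum_id.
rewrite (linear_bul_sum (bulmap coinv0 _)) (linear_bul_sum (bul_mulr _ _)).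
rewrite (linear_bul_sum (bulmap cq_lift _)).
by apply: eq_bul_sum => p b; rewrite bulmapE bul_mulrE bulmapE cq_liftE.
Qed.

(** By [phiE], [varsigma] followed by [cq_lift . A] is the bijection [phi], so [psi] after
    [cq_lift . A] is a left inverse. *)
Lemma varsigma_iso : @is_iso (Mod k) (circ Q Ab) (bul_mod (cq Q) Ab) vs.
Proof.
have gK x : bulmap cq_inv (bimap_id Ab) (bulmap cq_lift (bimap_id Ab) x) = x.
  rewrite -bulmap_comp1 -[RHS]bulmap_id; congr (bimap_lin (bulmap _ _) x).
  exact/bimap_ext/cq_liftK.
pose inv := bimap_comp psi (bulmap cq_lift (bimap_id Ab)) : {linear _ -> _}.
exists (inv : {linear bul_mod (cq Q) Ab -> circ Q Ab}).
split; apply: linear_ext => x.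
  by rewrite -[LHS]/(psi (bulmap _ _ (vs x))) -phiE phiK.
(* For the other composite, the split injection [cq_lift . A] is applied and then undone by
   [cq_inv . A]. *)
rewrite -[LHS]/(vs (psi (bulmap _ _ x))) -[LHS]gK -phiE psiK.
exact: gK.
Qed.
End VarsigmaOfEquivalence.

Lemma varsigma_iso_of_equivalence :
  is_equivalence (comparison A) -> is_nat_iso (varsigma A).
Proof.
move=> /equivalence_ess_surj ess Q.
have [N [psi [phi [h1 h2]]]] := ess (free_hopf Q).
apply: (@varsigma_iso Q N phi psi) => x.
  exact: (congr1 (fun h : hopf_map (free_hopf Q) (free_hopf Q) => h x) h2).
exact: (congr1 (fun h : hopf_map (cmp_hopf A N) (cmp_hopf A N) => h x) h1).
Qed.

End Bialgebroid.

Theorem corollary4p10 (k R : comPzRingType) (kR : {rmorphism k -> R})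
    (A : bialgebroid kR) :
  (is_hopf_algebroid A <-> is_nat_iso (varsigma A)) /\
  (is_nat_iso (varsigma A) <-> is_equivalence (comparison A)).
Proof.
split; split.
- by move=> /equivalence_of_hopf/varsigma_iso_of_equivalence.
- exact: hopf_of_varsigma.
- by move=> /hopf_of_varsigma/equivalence_of_hopf.
- exact: varsigma_iso_of_equivalence.
Qed.
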